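(* Fix an integer $L\ge 1$, a path-loss exponent $\alpha>2$, a link distance $d_r>0$, a noise variance $\sigma^2\ge 0$ and a density $\lambda>0$. Let $\Pi=\{X_k\}$ be a homogeneous Poisson point process on $\mathbb{R}^2$ with intensity $\lambda$ (the interferers). A receiver with $L$ antennas is located at the origin, and its intended transmitter is at distance $d_r$. All nodes transmit with unit power. The desired channel vector $\mathbf{c}_r\in\mathbb{C}^L$ and the interferer channel vectors $\mathbf{c}_k\in\mathbb{C}^L$ ($X_k\in\Pi$) are mutually independent, independent of $\Pi$, and each has i.i.d. zero-mean unit-variance circularly symmetric complex Gaussian entries (Rayleigh fading). The noise covariance is $\sigma^2\mathbf{I}_L$. Let $$\mathbf{R}=\sum_{X_k\in\Pi}|X_k|^{-\alpha}\mathbf{c}_k\mathbf{c}_k^{H}+\sigma^2\mathbf{I}_L ,$$ and let the output SINR of the optimum combining (MMSE) receiver, whose weight vector is $\mathbf{w}_{OC}=\mathbf{R}^{-1}\mathbf{c}_r$, be $$\beta_{\mathrm{out}}=d_r^{-\alpha}\,\mathbf{c}_r^{H}\mathbf{R}^{-1}\mathbf{c}_r .$$ For a threshold $\beta>0$, put $\gamma=\beta d_r^{\alpha}$. Then the outage probability $F(\gamma,\lambda)=\Pr(\beta_{\mathrm{out}}\le\beta)$ is $$F(\gamma,\lambda)=1-\sum_{i=0}^{L-1}\frac{\left(\lambda\Delta\gamma^{2/\alpha}+\sigma^2\gamma\right)^i}{i!}\exp\!\left(-\lambda\Delta\gamma^{2/\alpha}-\sigma^2\gamma\right),$$ where $\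Delta=\pi\,\frac{2}{\alpha}\,\Gamma(2/\alpha)\,\Gamma(1-2/\alpha)$.
   Context: $\mathbf{c}^H$ denotes the conjugate transpose and $\Gamma(\cdot)$ the Gamma function. The optimum combining weight $\mathbf{w}_{OC}=\mathbf{R}^{-1}\mathbf{c}_r$ maximizes $\frac{\mathbf{w}^H\mathbf{c}_r\mathbf{c}_r^H\mathbf{w}}{\mathbf{w}^H\mathbf{R}\mathbf{w}}$ over $\mathbf{w}\in\mathbb{C}^L\setminus\{0\}$; the resulting SINR is $\beta_{\mathrm{out}}$ above. *)

(* Defs.v *)
From HB Require Import structures.
From mathcomp Require Import all_boot all_order all_algebra.
From mathcomp Require Import all_classical all_reals all_analysis.
From mathcomp Require Import complex.

Set Implicit Arguments.
Unset Strict Implicit.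
Unset Printing Implicit Defensive.

Import Order.TTheory GRing.Theory Num.Theory.
Import numFieldNormedType.Exports.

Local Open Scope classical_set_scope.
Local Open Scope ring_scope.

Section defs.
Variable R : realType.

Definition Gamma (s : R) : R :=
  fine (\int[@lebesgue_measure R]_(x in [set x : R | (0 < x)%R])
          ((x `^ (s - 1)) * expR (- x))%R%:E)%E.

Definition Delta (alpha : R) : R :=
  pi * (2 / alpha) * Gamma (2 / alpha) * Gamma (1 - 2 / alpha).

Definition area (A : set (R * R)) : \bar R :=
  ((@lebesgue_measure R) \x (@lebesgue_measure R))%E A.

(** Poisson probability mass function with mean mu >= 0
    (mu^k / k! * e^-mu; for mu = 0 this is the Dirac mass at 0). *)
Definition pois (mu : R) (k : nat) : R := mu ^+ k / (k`!)%:R * expR (- mu).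

Definition ppcount (T : Type) (X : nat -> T -> R * R) (A : set (R * R)) (w : T)
  : \bar R := (\esum_(k in [set k | A (X k w)]) (1 : \bar R))%E.

(** The random points (X_k)_k (an enumeration of the point set) form a
    homogeneous Poisson point process on R^2 with intensity lam:
    the counts in finitely many pairwise disjoint Borel sets of finite area are
    independent Poisson random variables with means lam * area. *)
Definition is_PPP (d : measure_display) (T : measurableType d)
  (P : probability T R) (X : nat -> T -> R * R) (lam : R) : Prop :=
  (forall k, measurable_fun setT (X k)) /\
  forall (n : nat) (A : 'I_n -> set (R * R)) (m : 'I_n -> nat),
    (forall i, measurable (A i)) ->
    (forall i, (area (A i) < +oo)%E) ->
    (forall i j, i != j -> A i `&` A j = set0) ->
    P [set w | forall i, ppcount X (A i) w = ((m i)%:R)%:E] =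
    (\prod_(i < n) (pois (lam * fine (area (A i))) (m i))%:E)%E.

(** Law of the real/imaginary parts of a CN(0,1) entry: N(0, 1/2). *)
Definition halfgauss : set R -> \bar R := normal_prob 0 (Num.sqrt (2^-1)).

(** Fading: real and imaginary parts of all entries of the interferer
    channel vectors c_k (cre k j, cim k j) and of the desired channel
    vector c_r (crre j, crim j) are measurable, i.i.d. N(0,1/2)
    (i.e. each entry is CN(0,1), all entries i.i.d.), and all of them are
    jointly independent of the point sequence (X_k)_k. This is expressed as
    a product formula on the generating cylinder events. *)
Definition fading_indep (d : measure_display) (T : measurableType d)
  (P : probability T R) (L : nat) (X : nat -> T -> R * R)
  (cre cim : nat -> 'I_L -> T -> R) (crre crim : 'I_L -> T -> R) : Prop :=
  (forall k j, measurable_fun setT (cre k j)) /\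
  (forall k j, measurable_fun setT (cim k j)) /\
  (forall j, measurable_fun setT (crre j)) /\
  (forall j, measurable_fun setT (crim j)) /\
  forall (K : nat) (D : nat -> set (R * R))
         (B1 B2 : nat -> 'I_L -> set R) (E1 E2 : 'I_L -> set R),
    (forall k, measurable (D k)) ->
    (forall k j, measurable (B1 k j)) -> (forall k j, measurable (B2 k j)) ->
    (forall j, measurable (E1 j)) -> (forall j, measurable (E2 j)) ->
    P ([set w | forall k, (k < K)%N -> D k (X k w)] `&`
       [set w | forall k j, (k < K)%N -> B1 k j (cre k j w) /\ B2 k j (cim k j w)] `&`
       [set w | forall j, E1 j (crre j w) /\ E2 j (crim j w)]) =
    (P [set w | forall k, (k < K)%N -> D k (X k w)] *
     (\prod_(k < K) \prod_(j < L) (halfgauss (B1 k j) * halfgauss (B2 k j))) *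
     \prod_(j < L) (halfgauss (E1 j) * halfgauss (E2 j)))%E.

Definition cvec (L : nat) (re im : 'I_L -> R) : 'cV[R[i]]_L :=
  \col_j ((re j) +i* (im j))%C.

Definition ctrans (m n : nat) (A : 'M[R[i]]_(m, n)) : 'M[R[i]]_(n, m) :=
  map_mx (@conjc R) A^T.

Definition clim (u : nat -> R[i]) : R[i] :=
  ((limn (fun n => complex.Re (u n))) +i* (limn (fun n => complex.Im (u n))))%C.

Definition pathloss (alpha : R) (x : R * R) : R :=
  (x.1 ^+ 2 + x.2 ^+ 2) `^ (- (alpha / 2)).

Definition Rmat (T : Type) (L : nat) (alpha sigma2 : R) (X : nat -> T -> R * R)
  (cre cim : nat -> 'I_L -> T -> R) (w : T) : 'M[R[i]]_L :=
  \matrix_(a < L, b < L)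
     clim (fun n => (\sum_(k < n)
        (pathloss alpha (X k w))%:C%C *:
           (cvec (cre k ^~ w) (cim k ^~ w) *m ctrans (cvec (cre k ^~ w) (cim k ^~ w))))
        a b)
  + (sigma2%:C%C)%:M.

Definition beta_out (T : Type) (L : nat) (alpha d sigma2 : R)
  (X : nat -> T -> R * R) (cre cim : nat -> 'I_L -> T -> R)
  (crre crim : 'I_L -> T -> R) (w : T) : R[i] :=
  let cr := cvec (crre ^~ w) (crim ^~ w) in
  (d `^ (- alpha))%:C%C *
  (ctrans cr *m invmx (Rmat alpha sigma2 X cre cim w) *m cr) ord0 ord0.

End defs.

(* Main.v *)
(** Conditionally on the points of the process, only the powers [p_k] of the
    interferers matter. For fixed powers let [A_n] be [s I] plus the sum over
    [k < n] of [p_k c_k c_k^H], and let [S_n(L)] be the probability that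
    [x^H A_n^-1 x > g] with [L] antennas. Then, with [q_n = p_n g / (1 + p_n g)],

      S_(n+1)(L) = (1 - q_n) S_n(L) + q_n S_n(L - 1),

    so [S_n(L)] is the probability that a Poisson variable of mean [s g] plus
    independent Bernoulli variables of parameters [q_k], [k < n], is [< L].
    To get the recursion, the Sherman-Morrison formula expresses the event for
    [n + 1] through the trace and the determinant of the Gram matrix of
    [x] and [c_n] for [A_n^-1]. These are invariant when [x] and [c_n] are mixed
    by an element of U(2), which preserves their joint law; mixing by a uniform
    element makes the relation between the three probabilities explicit. The last
    one, [P (det > g c_n^H A_n^-1 c_n)], loses one antenna: rotate the antennas so
    that [c_n] is a multiple of the first basis vector and take a Schur complement.

    Averaging over the process, the generating function of [S_n] in [L] tends
    to that of a Poisson variable by the Laplace functional of the process, the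
    integral of [q] over the plane being [Delta alpha * g `^ (2 / alpha)]; hence so
    do the coefficients. Finally [A_n] with [s = sigma2 + 1 / (n + 1)] tends almost
    surely to [R], which is almost surely invertible because it dominates its first
    [L] rank-one terms. *)
Require Import Defs.
From HB Require Import structures.
From mathcomp Require Import all_boot all_order all_algebra.
From mathcomp Require Import all_classical all_reals all_analysis measurable_realfun.
From mathcomp Require Import complex ring lra.

Import Order.TTheory GRing.Theory Num.Theory.
Import numFieldNormedType.Exports.

Local Open Scope classical_set_scope.
Local Open Scope ring_scope.

Set Implicit Arguments.
Unset Strict Implicit.
Unset Printing Implicit Defensive.

(** * Integration in the plane *)

(** The recursion in [n] rests on a linearity. Given the Gram matrix of [x] and [c_n] for the
    inverse of [A_n], with trace [t] and determinant [D], each of the three events compares the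
    first diagonal entry with a threshold that depends on [t] and [D] only. After a uniform mixing
    this entry is uniform between the two eigenvalues, so its tail is affine there. With
    [tau = 1 / p_n], the threshold for [n + 1] is the average of the other two with weights
    [tau / (g + tau) = 1 - q_n] and [g / (g + tau) = q_n], and the three always fall in the same
    affine piece of the tail.

    The probabilities [S_n(L)] do not factor over the interferers, but their generating function in
    [L] does, which is what a Laplace functional can average. The perturbed noise
    [sigma2 + 1 / (n + 1)] keeps [A_n] positive definite even if [sigma2 = 0]. The final passage to
    the limit yields one-sided bounds only; they meet because the limit law is continuous in the
    threshold. *)

Lemma pushforward_measure_ex d1 d2 (T1 : measurableType d1) (T2 : measurableType d2)
  (R : realType) (m : {measure set T1 -> \bar R}) (f : T1 -> T2) :
  measurable_fun setT f ->
  exists m' : {measure set T2 -> \bar R}, forall A, m' A = m (f @^-1` A).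
Proof.
move=> mf.
pose m' : {measure set T2 -> \bar R} := pushforward m f.
by exists (m' mf).
Qed.

Lemma pushforward_probability_ex d1 d2 (T1 : measurableType d1) (T2 : measurableType d2)
  (R : realType) (m : probability T1 R) (f : T1 -> T2) :
  measurable_fun setT f ->
  exists m' : probability T2 R, forall A, m' A = m (f @^-1` A).
Proof.
move=> mf.
pose F : {mfun T1 >-> T2} := HB.pack_for {mfun T1 >-> T2} f (isMeasurableFun.Build _ _ _ _ f mf).
by exists (distribution m F).
Qed.

Lemma prod_rect d1 d2 (T1 : measurableType d1) (T2 : measurableType d2) (R : realType)
  (m1 : probability T1 R) (m2 : probability T2 R) A B : measurable A -> measurable B ->
  (m1 \x m2)%E (A `*` B) = (m1 A * m2 B)%E.
Proof. exact: product_measure1E. Qed.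

Lemma prod_setT d1 d2 (T1 : measurableType d1) (T2 : measurableType d2) (R : realType)
  (m1 : probability T1 R) (m2 : probability T2 R) :
  (m1 \x m2)%E setT = 1%E.
Proof.
have -> : [set: T1 * T2] = setT `*` setT by apply/seteqP.
by rewrite prod_rect// !probability_setT mule1.
Qed.

Section density.
Context d (T : measurableType d) (R : realType).
Variables (l m : {measure set T -> \bar R}) (h : T -> R).
Hypothesis mh : measurable_fun setT h.
Hypothesis h0 : forall x, 0 <= h x.
Hypothesis mE : forall A, measurable A -> m A = (\int[l]_(x in A) (h x)%:E)%E.
Import HBNNSimple.

(** The hypothesis on [m] is the case of an indicator; simple functions follow by linearity, and
    nonnegative ones by monotone convergence along a common approximating sequence. *)
Lemma ge0_integral_density (f : T -> \bar R) : measurable_fun setT f ->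
  (forall x, 0 <= f x)%E -> (\int[m]_x f x = \int[l]_x (f x * (h x)%:E))%E.
Proof.
move=> mf f0.
pose f_ := nnsfun_approx measurableT mf.
have f_nd x : {homo (fun n => (f_ n x)%:E) : i j / (i <= j)%N >-> (i <= j)%E}.
  by move=> i j ij; rewrite lee_fin; exact/lefP/nd_nnsfun_approx.
have f_cvg x : (f_ n x)%:E @[n --> \oo] --> f x.
  by apply: cvg_nnsfun_approx => // y _; exact: f0.
transitivity (limn (fun n => \int[m]_x (f_ n x)%:E)%E).
  rewrite -monotone_convergence//.
  - by apply: eq_integral => x _; apply/esym/cvg_lim => //; exact: f_cvg.
  - by move=> n; exact/measurable_EFinP/measurable_funTS.
  - by move=> n x _; rewrite lee_fin.
transitivity (limn (fun n => \int[l]_x ((f_ n x)%:E * (h x)%:E))%E); last first.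
  rewrite -monotone_convergence//.
  - apply: eq_integral => x _; apply/cvg_lim => //.
    apply: cvgeZr => //; exact: f_cvg.
  - by move=> n; apply: emeasurable_funM; exact/measurable_EFinP.
  - by move=> n x _; rewrite -EFinM lee_fin mulr_ge0.
  - by move=> x _ i j ij; rewrite lee_wpmul2r ?lee_fin// -lee_fin; exact: f_nd.
congr (limn _); apply/funext => n.
under eq_integral do rewrite fimfunE -fsumEFin//.
rewrite ge0_integral_fsum//; last 2 first.
- by move=> y; exact/measurable_EFinP/measurable_funM.
- by move=> y x _; rewrite nnfun_muleindic_ge0.
under [RHS]eq_integral => x _.
  rewrite fimfunE -fsumEFin// ge0_mule_fsuml; last first.
    by move=> y; rewrite nnfun_muleindic_ge0.
  over.
rewrite ge0_integral_fsum//; last 2 first.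
- move=> y; apply: emeasurable_funM; apply/measurable_EFinP => //; exact/measurable_funM.
- by move=> y x _; rewrite mule_ge0 ?nnfun_muleindic_ge0 ?lee_fin.
apply: eq_fsbigr => r _.
have mfr : measurable (f_ n @^-1` [set r]) by rewrite -[X in measurable X]setTI; exact: measurable_funP.
(* Negative values have an empty preimage; they are removed before scalars are taken out of the
   integrals. *)
have [r0|r0] := ltP r 0.
  rewrite preimage_nnfun0//.
  by rewrite !integral0_eq// => x _; rewrite indic0 mulr0 ?mul0e.
under eq_integral do rewrite EFinM.
rewrite ge0_integralZl//=; try by apply/measurable_EFinP/measurable_indic.
under [RHS]eq_integral do rewrite EFinM -muleA.
rewrite [RHS]ge0_integralZl//=; try by move=> x _; rewrite mule_ge0 ?lee_fin.
  2: by apply: emeasurable_funM; apply/measurable_EFinP => //; exact/measurable_indic.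
congr (_ * _)%E.
rewrite integral_indic// setIT mE// integral_mkcond.
apply: eq_integral => x _; rewrite patchE indicE; case: ifP => _; first by rewrite mul1e.
by rewrite mul0e.
Qed.

End density.

Section affine.
Variable R : realType.
Notation mu := (@lebesgue_measure R).

(** The image of Lebesgue measure under the affine map, rescaled by [|a|], agrees with Lebesgue
    measure on half-open intervals, hence everywhere. *)
Lemma lebesgue_affine (a b : R) (f : R -> \bar R) : a != 0 ->
  measurable_fun setT f -> (forall x, 0 <= f x)%E ->
  (\int[mu]_x f (a * x + b)%R = (`|a|^-1)%:E * \int[mu]_x f x)%E.
Proof.
move=> a0 mf f0.
have mab : measurable_fun setT (fun x : measurableTypeR R => (a * x + b : measurableTypeR R)).
  by apply: measurable_funD => //; exact: measurable_funM.
have na0 : 0 <= `|a| by [].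
pose p : {measure set (measurableTypeR R) -> \bar R} := pushforward mu (fun x : measurableTypeR R => (a * x + b : measurableTypeR R)).
pose q : {measure set (measurableTypeR R) -> \bar R} := mscale (NngNum na0) (p mab).
have qE A : measurable A -> mu A = q A.
  apply: lebesgue_measure_unique => _ [[u v] _ <-].
  rewrite (_ : q _ = (`|a|%:E * mu ((fun x : R => a * x + b)%R @^-1` `]u, v]%classic))%E)//.
  rewrite lebesgue_measure_itv/= lte_fin.
  have [uv|vu] := ltP u v; last first.
    rewrite set_itv_ge ?preimage_set0 ?measure0 ?mule0//.
    by rewrite -leNgt bnd_simp.
  have := a0; rewrite neq_lt => /orP[aN|aP].
    (* A negative slope reverses the interval and moves the closed end to the left; the length is
       the same. *)
    have -> : (fun x : R => a * x + b) @^-1` `]u, v]%classic = `[(v - b) / a, (u - b)/a[%classic.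
      apply/seteqP; split => x /=; rewrite !in_itv/= ler_ndivrMr// ltr_ndivlMr//; lra.
    rewrite lebesgue_measure_itv/= lte_fin ltr_nM2r ?invr_lt0// ltrBlDr subrK uv.
    by rewrite -!EFinD -EFinM ltr0_norm//; congr EFin; field.
  have -> : (fun x : R => a * x + b) @^-1` `]u, v]%classic = `](u - b) / a, (v - b)/a]%classic.
    apply/seteqP; split => x /=; rewrite !in_itv/= ler_pdivlMr// ltr_pdivrMr//; lra.
  rewrite lebesgue_measure_itv/= lte_fin ltr_pM2r ?invr_gt0// ltrBlDr subrK uv.
  by rewrite -!EFinD -EFinM gtr0_norm//; congr EFin; field.
have -> : (\int[mu]_x f x = \int[q]_x f x)%E.
  by apply: eq_measure_integral => A mA _; exact: qE.
rewrite /q ge0_integral_mscale//= muleA -EFinM mulVf ?normr_eq0// mul1e.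
by rewrite ge0_integral_pushforward.
Qed.

End affine.

Section plane.
Variable R : realType.
Notation mu := (@lebesgue_measure R).
Notation RR := (R * R)%type.

Lemma plane_fubini (f : RR -> \bar R) :
  measurable_fun setT f -> (forall x, 0 <= f x)%E ->
  (\int[mu]_x \int[mu]_y f (x, y) = \int[mu]_y \int[mu]_x f (x, y))%E.
Proof. by move=> mf f0; exact: fubini_tonelli. Qed.

Lemma plane_measF (f : RR -> \bar R) : measurable_fun setT f -> (forall x, 0 <= f x)%E ->
  measurable_fun setT (fun x : R => \int[mu]_y f (x, y))%E.
Proof. by move=> mf f0; exact: (@measurable_fun_fubini_tonelli_F _ _ _ _ _ mu f mf f0). Qed.

Lemma plane_measG (f : RR -> \bar R) : measurable_fun setT f -> (forall x, 0 <= f x)%E ->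
  measurable_fun setT (fun y : R => \int[mu]_x f (x, y))%E.
Proof. by move=> mf f0; exact: (@measurable_fun_fubini_tonelli_G _ _ _ _ _ mu f mf f0). Qed.

(** For [c != 0] a rotation is a succession of two affine changes of a single variable:
    [X = c x - s y] at fixed [y], then [Y = (s X + y) / c] at fixed [X], with Jacobians that cancel;
    Tonelli swaps the variables in between. For [c = 0] it exchanges the coordinates up to signs. *)
Lemma plane_rot (c s : R) (f : RR -> \bar R) : c ^+ 2 + s ^+ 2 = 1 ->
  measurable_fun setT f -> (forall x, 0 <= f x)%E ->
  (\int[mu]_x \int[mu]_y f (c * x - s * y, s * x + c * y)%R =
   \int[mu]_x \int[mu]_y f (x, y))%E.
Proof.
move=> cs mf f0.
have mS d' (S : measurableType d') (g1 g2 : S -> R) : measurable_fun setT g1 ->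
    measurable_fun setT g2 -> measurable_fun setT (fun x => f (g1 x, g2 x)).
  by move=> mg1 mg2; apply: (measurableT_comp mf); apply/measurable_fun_pairP; split.
have m1 : measurable_fun setT (fst : RR -> R) by exact: measurable_fst.
have m2 : measurable_fun setT (snd : RR -> R) by exact: measurable_snd.
have mlin (a b : R) : measurable_fun setT (fun x : RR => a * x.1 + b * x.2).
  by apply: measurable_funD; exact: measurable_funM.
have mlin1 (a b : R) : measurable_fun setT (fun x : R => a * x + b).
  by apply: measurable_funD => //; exact: measurable_funM.
have step1 : (\int[mu]_x \int[mu]_y f (c * x - s * y, s * x + c * y)%R =
   \int[mu]_y \int[mu]_x f (c * x - s * y, s * x + c * y)%R)%E.
  apply: (plane_fubini (f := fun z => f (c * z.1 - s * z.2, s * z.1 + c * z.2)%R)) ; last by [].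
  apply: mS; last exact: mlin.
  by apply: eq_measurable_fun (mlin c (- s)) => x _; rewrite mulNr.
rewrite step1.
have [c0|c0] := eqVneq c 0.
  have s0 : s != 0 by apply/negP => /eqP s0; move: cs; rewrite c0 s0; lra.
  have ns : `|s| = 1.
    apply/eqP; rewrite -sqrp_eq1// real_normK ?num_real//; apply/eqP; move: cs; rewrite c0; lra.
  transitivity (\int[mu]_y (fun Y => \int[mu]_x f (Y, x)) (- s * y + 0)%R)%E.
    apply: eq_integral => y _.
    transitivity (\int[mu]_x (fun X => f (- (s * y), X)%R) (s * x + 0)%R)%E.
      by apply: eq_integral => x _ /=; rewrite c0 !mul0r sub0r.
    apply: (eq_trans (@lebesgue_affine R s 0 (fun X => f (- (s * y), X)%R) s0 _ _)).
    - by apply: mS.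
    - by [].
    by rewrite ns invr1 mul1e addr0 mulNr.
  apply: (eq_trans (@lebesgue_affine R (- s) 0 (fun Y => \int[mu]_x f (Y, x))%E _ _ _)).
  - by rewrite oppr_eq0.
  - exact: (plane_measF mf f0).
  - by move=> x; exact: integral_ge0.
  by rewrite normrN ns invr1 mul1e.
have mG : measurable_fun setT (fun z : RR => f (z.1, ((s * z.1 + z.2) / c)%R)).
  apply: mS => //.
  by apply: eq_measurable_fun (mlin (s / c) c^-1) => x _; rewrite mulrDl mulrAC [c^-1 * _]mulrC.
have mGy y : measurable_fun setT (fun X : R => f (X, ((s * X + y) / c)%R)).
  apply: mS => //.
  by apply: eq_measurable_fun (mlin1 (s / c) (y / c)) => x _; rewrite mulrDl mulrAC.
transitivity (\int[mu]_y ((`|c|^-1)%:E * \int[mu]_X f (X, ((s * X + y) / c)%R))%E)%E.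
  apply: eq_integral => y _.
  apply: (eq_trans _ (@lebesgue_affine R c (- (s * y)) (fun X => f (X, ((s * X + y) / c)%R)) c0 (mGy y) _)); last by [].
  apply: eq_integral => x _; congr (f (_, _)).
  have -> : s * (c * x - s * y) + y = s * c * x + y * (1 - s ^+ 2) by ring.
  by rewrite -cs; field.
pose G z := f (z.1, ((s * z.1 + z.2) / c)%R).
have nc0 : (0 <= `|c|^-1)%R by rewrite invr_ge0.
have IG0 (y : R) : (0 <= \int[mu]_X G (X, y))%E by apply: integral_ge0 => ? _; exact: f0.
have IF0 (x : R) : (0 <= \int[mu]_Y G (x, Y))%E by apply: integral_ge0 => ? _; exact: f0.
have G0 z : (0 <= G z)%E by exact: f0.
have mIG : measurable_fun setT (fun y : R => \int[mu]_X G (X, y))%E.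
  exact: (plane_measG mG G0).
have mIF : measurable_fun setT (fun x : R => \int[mu]_Y G (x, Y))%E.
  exact: (plane_measF mG G0).
apply: (eq_trans (ge0_integralZl_EFin mu measurableT (fun y _ => IG0 y) mIG nc0)).
apply: (eq_trans (f_equal (fun z => (`|c|^-1)%:E * z)%E (esym (plane_fubini mG G0)))).
apply: (eq_trans (esym (ge0_integralZl_EFin mu measurableT (fun y _ => IF0 y) mIF nc0))).
apply: eq_integral => x _.
transitivity (`|c|^-1%:E * \int[mu]_y f (x, (c^-1 * y + s * x / c)%R))%E.
  by congr (_ * _)%E; apply: eq_integral => y _; congr (f (_, _)); rewrite mulrDl addrC [y / c]mulrC.
have H := @lebesgue_affine R c^-1 (s * x / c) (fun y => f (x, y)).
rewrite H ?invr_eq0//; last by apply: mS.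
by rewrite muleA -EFinM normfV invrK mulVf ?mul1e// normr_eq0.
Qed.

End plane.

(** * Polar integration *)

Section radial.
Variable R : realType.
Notation mu := (@lebesgue_measure R).
Notation RR := (R * R)%type.

Definition sqnorm (x : RR) := x.1 ^+ 2 + x.2 ^+ 2.

Lemma measurable_sqnorm : measurable_fun setT sqnorm.
Proof.
by apply: measurable_funD; apply: measurable_funX; [exact: measurable_fst|exact: measurable_snd].
Qed.

(** Area of the disc of squared radius [r]. It turns out to be linear in [r]; the constant [D 1]
    stays unknown until [radial_aux]. *)
Let D (r : R) : \bar R := (mu \x mu)%E [set x : RR | sqnorm x <= r].

Let mD (r : R) : measurable [set x : RR | sqnorm x <= r].
Proof.
rewrite (_ : [set x | _] = sqnorm @^-1` `]-oo, r]%classic).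
  by rewrite -[X in measurable X]setTI; apply: measurable_sqnorm.
by apply/seteqP; split => x /=; rewrite in_itv.
Qed.

Let DE (r : R) : D r = (\int[mu]_x \int[mu]_y (\1_[set x : RR | sqnorm x <= r] (x, y))%:E)%E.
Proof.
rewrite /D /product_measure1; apply: eq_integral => x _ /=.
have mX := measurable_xsection x (mD r).
transitivity (\int[mu]_y (\1_(xsection [set x : RR | sqnorm x <= r] x) y)%:E)%E.
  by rewrite integral_indic// setIT.
by apply: eq_integral => y _; rewrite !indicE /xsection /= mem_setE.
Qed.

Let D_scale (r : R) : 0 < r -> D r = (r%:E * D 1%R)%E.
Proof.
move=> r0; rewrite !DE.
have t0 : Num.sqrt r != 0 by rewrite gt_eqF// sqrtr_gt0.
have m1 : measurable_fun setT (\1_[set x : RR | sqnorm x <= r] : RR -> R) by exact: measurable_indic.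
have mi x : measurable_fun setT (fun y => (\1_[set x : RR | sqnorm x <= r] (x, y) : R)%:E).
  apply/measurable_EFinP.
  have mX := measurable_indic (R := R) (D := setT) (measurable_xsection x (mD r)).
  by apply: eq_measurable_fun mX => y _; rewrite !indicE /xsection /= mem_setE.
pose G z : \bar R := ((\1_[set x : RR | sqnorm x <= r] z : R)%:E).
have G0 z : (0 <= G z)%E by rewrite lee_fin.
have mG : measurable_fun setT G by exact/measurable_EFinP.
have IF0 (x : R) : (0 <= \int[mu]_Y G (x, Y))%E by apply: integral_ge0 => ? _; exact: G0.
have mIF : measurable_fun setT (fun x : R => \int[mu]_Y G (x, Y))%E.
  exact: (plane_measF mG G0).
have nc0 : (0 <= `|Num.sqrt r|^-1)%R by rewrite invr_ge0.
have -> : (\int[mu]_x \int[mu]_y (\1_[set x : RR | sqnorm x <= 1] (x, y))%:E =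
  \int[mu]_x (`|Num.sqrt r|^-1%:E * \int[mu]_y G (Num.sqrt r * x + 0, y)%R))%E.
  apply: eq_integral => x _.
  apply: (eq_trans _ (@lebesgue_affine R (Num.sqrt r) 0 (fun y => G (Num.sqrt r * x + 0, y)) t0 (mi _) (fun y => G0 _))).
  apply: eq_integral => y _; congr EFin; rewrite !indicE; congr (nat_of_bool _)%:R.
  have E : sqnorm (Num.sqrt r * x + 0, Num.sqrt r * y + 0) = r * sqnorm (x, y).
    by rewrite /sqnorm /= !addr0 !exprMn sqr_sqrtr ?ltW// -mulrDr.
  have H : (r * sqnorm (x, y) <= r) = (sqnorm (x, y) <= 1) by rewrite -{2}(mulr1 r) ler_pM2l.
  by rewrite !mem_setE; exact: (etrans (esym H) (f_equal (fun z => z <= r) (esym E))).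
apply/esym; apply: (eq_trans (f_equal (fun z => r%:E * z)%E (@lebesgue_affine R (Num.sqrt r) 0 (fun x => (`|Num.sqrt r|^-1%:E * \int[mu]_y G (x, y)))%E t0 _ _))).
- by apply: measurable_funeM.
- by move=> x; rewrite mule_ge0 ?lee_fin.
apply: (eq_trans (f_equal (fun z => r%:E * (`|Num.sqrt r|^-1%:E * z))%E (ge0_integralZl_EFin mu measurableT (fun y _ => IF0 y) mIF nc0))).
rewrite !muleA -!EFinM -mulrA -invfM ger0_norm ?sqrtr_ge0// -expr2 sqr_sqrtr ?ltW// mulfV ?gt_eqF//.
by rewrite mul1e.
Qed.

Let D1_fin : D 1 \is a fin_num.
Proof.
have sq1 (z : R) : z ^+ 2 <= 1 -> -1 <= z <= 1 by move=> z2; apply/andP; split; nra.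
have D0 : (0 <= D 1)%E by exact: measure_ge0.
rewrite ge0_fin_numE//.
have I1 : measurable (`[-1, 1]%classic : set R) by [].
apply: (@le_lt_trans _ _ ((mu \x mu)%E (`[-1, 1]%classic `*` `[-1, 1]%classic))).
  apply: le_measure; rewrite ?inE//; first exact: mD.
    exact: measurableX.
  move=> [x y]; rewrite /sqnorm /= !in_itv /= => h.
  have hx : x ^+ 2 <= 1 by have := sqr_ge0 y; lra.
  have hy : y ^+ 2 <= 1 by have := sqr_ge0 x; lra.
  by split; exact: sq1.
apply: le_lt_trans (ltry 4); rewrite [leLHS]product_measure1E//.
have I2 : mu `[-1, 1]%classic = 2%:E.
  have h : (-1 : R) < 1 by lra.
  by rewrite lebesgue_measure_itv/= lte_fin h -EFinD; congr EFin; lra.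
rewrite [leLHS](_ : _ = (2%:E * 2%:E)%E); last by congr (_ * _)%E; exact: I2.
by rewrite -EFinM lee_fin; lra.
Qed.

(** Discs of small radius have arbitrarily small area by scaling. The summand 1 in the denominator
    below keeps the quotient meaningful before [D 1] is known to be positive. *)
Let D_0 : D 0 = 0%E.
Proof.
have D0 : (0 <= D 0)%E by exact: measure_ge0.
apply/eqP; rewrite eq_le D0 andbT; apply/lee_addgt0Pr => e e0.
rewrite add0e.
have F1 : 0 <= fine (D 1) by rewrite fine_ge0// measure_ge0.
have e1 : 0 < e / (1 + fine (D 1)) by rewrite divr_gt0// ltr_wpDr.
apply: (@le_trans _ _ (D (e / (1 + fine (D 1))))).
  apply: le_measure; rewrite ?inE; [exact: mD|exact: mD|].
  by move=> x /= /le_trans; apply; exact: ltW.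
rewrite (D_scale e1) -(fineK D1_fin) -EFinM lee_fin mulrAC ler_pdivrMr ?ltr_wpDr//.
by rewrite ler_pM2l// lerDr.
Qed.

Let p0 := pushforward (mu \x mu)%E (sqnorm : RR -> measurableTypeR R).

Let mrs : measurable_fun setT (sqnorm : RR -> measurableTypeR R).
Proof. exact: measurable_sqnorm. Qed.

Variable p : {measure set (measurableTypeR R) -> \bar R}.
Hypothesis pE : forall A, p A = p0 A.

Let pitv (u v : R) : u <= v -> p `]u, v]%classic = (fine (D 1) * (Num.max v 0 - Num.max u 0))%:E.
Proof.
have Dmax w : D w = (fine (D 1) * Num.max w 0)%:E.
  have [w0|w0] := ltP 0 w; first by rewrite (D_scale w0) -(fineK D1_fin) -EFinM mulrC.
  rewrite mulr0; apply/eqP; rewrite eq_le; apply/andP; split; last exact: measure_ge0.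
  apply: (@le_trans _ _ (D 0)); last by rewrite D_0.
  apply: le_measure; rewrite ?inE; [exact: mD|exact: mD|].
  by move=> x /= /le_trans; apply.
move=> uv; rewrite pE /p0 /pushforward.
have -> : sqnorm @^-1` `]u, v]%classic = [set x : RR | sqnorm x <= v] `\` [set x : RR | sqnorm x <= u].
  apply/seteqP; split => x /=; rewrite in_itv /=.
    by move=> /andP[h1 h2]; split => //; apply/negP; rewrite -ltNge.
  by move=> [-> /negP]; rewrite -ltNge => ->.
have fin w : ((mu \x mu)%E [set x : RR | (sqnorm x <= w)%R] < +oo)%E.
  by have := Dmax w; rewrite /D => ->; rewrite ltry.
rewrite measureD//; last exact: fin.
rewrite (_ : _ `&` _ = [set x : RR | sqnorm x <= u]); last first.
  by apply/setIidr => x /= /le_trans; apply.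
apply: (etrans (f_equal2 (fun a b => a - b)%E (Dmax v) (Dmax u))).
by rewrite -EFinB mulrBr.
all: exact: mD.
Qed.

Let q0 := mrestr mu (measurable_itv `[0%R : R, +oo[).
Let F1 : 0 <= fine (D 1). Proof. by rewrite fine_ge0// measure_ge0. Qed.
Let q : {measure set (measurableTypeR R) -> \bar R} := mscale (NngNum F1) q0.

(** The law of [sqnorm] under area is [D 1] times Lebesgue measure on the half-line: both measures
    agree on half-open intervals and are finite on []- n, n]]. *)
Let pq A : measurable A -> p A = q A.
Proof.
have qE u v : u <= v -> q `]u, v]%classic = (fine (D 1) * (Num.max v 0 - Num.max u 0))%:E.
  move=> uv; rewrite (_ : q _ = (fine (D 1))%:E * mu (`]u, v] `&` `[0%R, +oo[)%classic)%E//.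
  rewrite EFinM; congr (_ * _)%E.
  have [v0|v0] := ltP v 0.
    rewrite (max_r (ltW (le_lt_trans uv v0))) subrr.
    rewrite (_ : _ `&` _ = set0) ?measure0//; apply/seteqP; split => x //=.
    by rewrite !in_itv/= andbT => -[/andP[_ xv] x0]; move: v0; rewrite ltNge (le_trans x0 xv).
  have [u0|u0] := ltP u 0.
    rewrite (_ : _ `&` _ = `[0, v]%classic).
      by rewrite lebesgue_measure_itv/= lte_fin; case: ltP => v0'; [rewrite -EFinD|congr EFin; lra].
    apply/seteqP; split => x /=; rewrite !in_itv/= andbT; first by move=> [/andP[_ ->] ->].
    by move=> /andP[x0 ->]; rewrite x0 (lt_le_trans u0 x0).
  rewrite (_ : _ `&` _ = `]u, v]%classic).
    by rewrite lebesgue_measure_itv/= lte_fin; case: ltP => vu; [rewrite -EFinD|congr EFin; lra].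
  apply/setIidl => x /=; rewrite !in_itv/= andbT => /andP[ux _]; exact: le_trans (ltW ux).
apply: (@measure_unique _ R (measurableTypeR R) (@ocitv R) (fun n => `]- n%:R, n%:R]%classic) _ _ _ _ p q).
- by [].
- exact: ocitvI.
- by move=> n; exact: is_ocitv.
- apply/seteqP; split => // x _; exists (Num.bound `|x|) => //=.
  have := archi_boundP (normr_ge0 x); rewrite in_itv/= ltr_norml => /andP[-> h]; exact: ltW.
- move=> _ [[u v] _ <-] /=.
  have [uv|vu] := leP u v; first by rewrite pitv// qE.
  by rewrite set_itv_ge ?measure0// -leNgt bnd_simp ltW.
- move=> n; have h : - (n%:R : R) <= n%:R by have := ler0n R n; lra.
  by rewrite (pitv h) ltry.
Qed.

Let radialC (f : R -> \bar R) : measurable_fun setT f -> (forall x, 0 <= f x)%E ->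
  (\int[mu]_x \int[mu]_y f (x ^+ 2 + y ^+ 2)%R = (fine (D 1))%:E * \int[mu]_(r in `[0%R, +oo[) f r)%E.
Proof.
move=> mf f0.
transitivity (\int[p]_r f r)%E.
  transitivity (\int[p0]_r f r)%E; last by apply: eq_measure_integral => A _ _.
  rewrite ge0_integral_pushforward//=.
  rewrite preimage_setT (@fubini_tonelli1 _ _ _ _ _ mu mu (f \o sqnorm))//.
    by apply: measurableT_comp => //; exact: measurable_sqnorm.
  by move=> x; exact: f0.
transitivity (\int[q]_r f r)%E.
  by apply: eq_measure_integral => A mA _; exact: pq.
rewrite /q ge0_integral_mscale//=; congr (_ * _)%E.
have mI : measurable_fun setT (\1_`[0%R, +oo[ : R -> R) by exact: measurable_indic.
rewrite (@ge0_integral_density _ _ _ mu q0 _ mI)//; last first.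
  move=> A mA; rewrite integral_indic//; first by rewrite setIC.
rewrite [RHS]integral_mkcond; apply: eq_integral => x _; rewrite patchE indicE.
by case: ifP => _; rewrite ?mule1 ?mule0.
Qed.

(** For the function [expR (- r)] the right-hand side of [radialC] is [D 1] and the left-hand side
    is the square of the Gauss integral; this identifies [D 1] with [pi]. *)
Lemma radial_aux (f : R -> \bar R) : measurable_fun setT f -> (forall x, 0 <= f x)%E ->
  (\int[mu]_x \int[mu]_y f (x ^+ 2 + y ^+ 2)%R = pi%:E * \int[mu]_(r in `[0%R, +oo[) f r)%E.
Proof.
move=> mf f0; rewrite radialC//; congr (_ * _)%E.
have mE : measurable_fun setT (fun r : R => expR (- r)) by apply: measurableT_comp.
have := @radialC (fun r => (expR (- r))%:E) _ _; rewrite (_ : \int[mu]_(r in `[0%R, +oo[) (expR (- r))%:E = 1)%E; last first.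
  rewrite -(@integral_exponential_pdf R 1 ltr01) [LHS]integral_mkcond.
  apply: eq_integral => x _; rewrite /exponential_pdf !patchE.
  by case: ifP => // _; rewrite mul1r mulN1r.
rewrite mule1 => <-.
- transitivity (\int[mu]_x ((gauss_fun x)%:E * (Num.sqrt pi)%:E))%E.
    apply: eq_integral => x _; rewrite -integralT_gauss -ge0_integralZl_EFin//.
    + by apply: eq_integral => y _; rewrite -EFinM /gauss_fun opprD expRD.
    + by move=> y _; rewrite lee_fin gauss_fun_ge0.
    + by apply/measurable_EFinP; exact: measurable_gauss_fun.
    + exact: gauss_fun_ge0.
  rewrite ge0_integralZr//.
  + by rewrite integralT_gauss -EFinM -expr2 sqr_sqrtr// pi_ge0.
  + by apply/measurable_EFinP; exact: measurable_gauss_fun.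
  + by move=> y _; rewrite lee_fin gauss_fun_ge0.
- exact/measurable_EFinP.
- by move=> x; rewrite lee_fin expR_ge0.
Qed.

End radial.

(** * The normal law of variance one half *)

Section halfgauss.
Variable R : realType.
Notation mu := (@lebesgue_measure R).
Notation RR := (R * R)%type.

Lemma radial (f : R -> \bar R) : measurable_fun setT f -> (forall x, 0 <= f x)%E ->
  (\int[mu]_x \int[mu]_y f (x ^+ 2 + y ^+ 2)%R = pi%:E * \int[mu]_(r in `[0%R, +oo[) f r)%E.
Proof.
have [p pE] := pushforward_measure_ex (mu \x mu)%E (@measurable_sqnorm R : measurable_fun setT (@sqnorm R : RR -> measurableTypeR R)).
exact: (radial_aux pE).
Qed.

Lemma measurable_comp2 d (S : measurableType d) d' (V : measurableType d') (f : RR -> V)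
  (g1 g2 : S -> R) : measurable_fun setT f -> measurable_fun setT g1 ->
  measurable_fun setT g2 -> measurable_fun setT (fun x => f (g1 x, g2 x)).
Proof.
by move=> mf mg1 mg2; apply: (measurableT_comp mf); apply/measurable_fun_pairP; split.
Qed.

Notation hg := (normal_prob (0 : R) (Num.sqrt (2^-1))).
Notation g := (normal_pdf (0 : R) (Num.sqrt (2^-1))).

(** Variance one half gives the exponent [- x ^+ 2] without a factor, so the density of a complex
    entry decays as the exponential of minus its squared modulus. *)
Lemma hg_pdfE x : g x = (Num.sqrt pi)^-1 * expR (- x ^+ 2).
Proof.
have s2 : Num.sqrt (2^-1 : R) ^+ 2 = 2^-1 by rewrite sqr_sqrtr// invr_ge0.
rewrite normal_pdfE; last by rewrite gt_eqF// sqrtr_gt0 invr_gt0.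
rewrite /normal_peak /normal_fun s2 subr0.
have -> : (2^-1 *+ 2 : R) = 1 by lra.
have -> : 2^-1 * pi *+ 2 = pi :> R by lra.
by rewrite invr1 mulr1.
Qed.

Lemma measurable_g : measurable_fun setT g. Proof. exact: measurable_normal_pdf. Qed.

Lemma hg_int (f : R -> \bar R) : measurable_fun setT f -> (forall x, 0 <= f x)%E ->
  (\int[hg]_x f x = \int[mu]_x (f x * (g x)%:E))%E.
Proof.
move=> mf f0; apply: ge0_integral_density => //; first exact: measurable_g.
by move=> x; exact: normal_pdf_ge0.
Qed.

Lemma hg_plane_int (f : RR -> \bar R) : measurable_fun setT f -> (forall x, 0 <= f x)%E ->
  (\int[hg]_x \int[hg]_y f (x, y) = \int[mu]_x \int[mu]_y (f (x, y) * (g x * g y)%:E))%E.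
Proof.
move=> mf f0.
have mfx x : measurable_fun setT (fun y => f (x, y)).
  by apply: measurable_comp2.
rewrite hg_int; last 2 first.
- exact: (@measurable_fun_fubini_tonelli_F _ _ _ _ _ hg f mf f0).
- by move=> x; apply: integral_ge0.
apply: eq_integral => x _; rewrite hg_int// muleC -ge0_integralZl_EFin//.
- by apply: eq_integral => y _; rewrite muleCA -EFinM.
- by move=> y _; rewrite mule_ge0// lee_fin normal_pdf_ge0.
- have mg : measurable_fun setT (fun y => (g y)%:E) by apply/measurable_EFinP; exact: measurable_g.
  exact: (emeasurable_funM (mfx x) mg).
- exact: normal_pdf_ge0.
Qed.

Lemma hg_plane (E : set RR) : measurable E ->
  ((hg \x hg) E = \int[hg]_x \int[hg]_y (\1_E (x, y))%:E)%E.
Proof.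
move=> mE; rewrite /product_measure1; apply: eq_integral => x _ /=.
transitivity (\int[hg]_y (\1_(xsection E x) y)%:E)%E.
  by rewrite integral_indic ?setIT//; exact: measurable_xsection.
by apply: eq_integral => y _; rewrite !indicE /xsection /= mem_setE.
Qed.

(** The joint density depends on [x ^+ 2 + y ^+ 2] only, so the invariance reduces to that of the
    plane integral. *)
Lemma hg_rot (c s : R) (E : set RR) : c ^+ 2 + s ^+ 2 = 1 -> measurable E ->
  (hg \x hg)%E [set x | E (c * x.1 - s * x.2, s * x.1 + c * x.2)] = (hg \x hg)%E E.
Proof.
move=> cs mE.
have mR : measurable_fun setT (fun x : RR => (c * x.1 - s * x.2, s * x.1 + c * x.2)).
  apply/measurable_fun_pairP; split => /=.
    by apply: measurable_funB; apply: measurable_funM => //; (exact: measurable_fst || exact: measurable_snd).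
  by apply: measurable_funD; apply: measurable_funM => //; (exact: measurable_fst || exact: measurable_snd).
have mE' : measurable [set x : RR | E (c * x.1 - s * x.2, s * x.1 + c * x.2)].
  by rewrite -[X in measurable X]setTI; exact: mR.
have mI (A : set RR) : measurable A -> measurable_fun setT (fun x : RR => ((\1_A x : R)%:E)).
  by move=> mA; apply/measurable_EFinP; exact: measurable_indic.
have I0 (A : set RR) x : (0 <= (\1_A x : R)%:E)%E by rewrite lee_fin.
apply: (etrans (etrans (hg_plane mE') (hg_plane_int (mI _ mE') (I0 _)))).
apply/esym; apply: (etrans (etrans (hg_plane mE) (hg_plane_int (mI _ mE) (I0 _)))); apply/esym.
have gg x y : g x * g y = pi^-1 * expR (- (x ^+ 2 + y ^+ 2)).
  rewrite !hg_pdfE mulrACA -invfM -expr2 sqr_sqrtr ?pi_ge0//.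
  by rewrite opprD expRD.
pose F (x : RR) : \bar R := ((\1_E x : R)%:E * (pi^-1 * expR (- (x.1 ^+ 2 + x.2 ^+ 2)))%:E)%E.
apply: (etrans _ (etrans (@plane_rot R c s F cs _ _) _)).
- apply: eq_integral => x _; apply: eq_integral => y _; rewrite /F gg.
  by congr (_%:E * (_ * expR (- _))%:E)%E; rewrite /= -[LHS]mul1r -cs; ring.
- apply: emeasurable_funM; first exact: mI.
  apply/measurable_EFinP; apply: measurable_funM => //; apply: measurableT_comp => //.
  by apply: measurableT_comp => //; exact: measurable_sqnorm.
- by move=> x; rewrite mule_ge0// lee_fin mulr_ge0 ?invr_ge0 ?pi_ge0 ?expR_ge0.
- by apply: eq_integral => x _; apply: eq_integral => y _; rewrite /F gg.
Qed.

(** The sum of two squares is a standard exponential variable: the factor [pi] of polar integration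
    cancels the normalisation of the density. *)
Lemma hg_radial (f : R -> \bar R) : measurable_fun setT f -> (forall x, 0 <= f x)%E ->
  (\int[hg]_x \int[hg]_y f (x ^+ 2 + y ^+ 2)%R = \int[mu]_(r in `[0%R, +oo[) (f r * (expR (- r))%:E))%E.
Proof.
move=> mf f0.
have mfs : measurable_fun setT (fun x : RR => f (x.1 ^+ 2 + x.2 ^+ 2)).
  by apply: measurableT_comp => //; exact: measurable_sqnorm.
rewrite (hg_plane_int mfs)//=.
have gg x y : g x * g y = pi^-1 * expR (- (x ^+ 2 + y ^+ 2)).
  rewrite !hg_pdfE mulrACA -invfM -expr2 sqr_sqrtr ?pi_ge0//.
  by rewrite opprD expRD.
have me : measurable_fun setT (fun r : R => (expR (- r))%:E).
  by apply/measurable_EFinP; apply: measurableT_comp.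
have mF : measurable_fun setT (fun r => pi^-1%:E * (f r * (expR (- r))%:E))%E.
  by apply: measurable_funeM; apply: emeasurable_funM.
have pi0 : (0 <= pi^-1 :> R) by rewrite invr_ge0 pi_ge0.
have F0 r : (0 <= f r * (expR (- r))%:E)%E by rewrite mule_ge0// lee_fin expR_ge0.
have := @radial (fun r => pi^-1%:E * (f r * (expR (- r))%:E))%E mF _.
rewrite ge0_integralZl_EFin//; last first.
  by apply: measurable_funTS; apply: emeasurable_funM.
rewrite muleA -EFinM mulfV ?mul1e; last by rewrite gt_eqF// pi_gt0.
move=> <-; last by move=> r; rewrite mule_ge0.
by apply: eq_integral => x _; apply: eq_integral => y _; rewrite gg EFinM muleCA.
Qed.

End halfgauss.

(** * Families of independent variables *)

(* A family of real variables is a measure on [I -> R] with the sigma-algebra generated by the finite-dimensional cylinders. *)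
Section rvec.
Variables (R : realType) (I : choiceType).

Definition cyl (s : seq I) (B : I -> set R) : set (I -> R) :=
  [set w | forall i, i \in s -> B i (w i)].

Definition cylsys : set (set (I -> R)) :=
  [set A | exists s B, [/\ uniq s, forall i, measurable (B i) & A = cyl s B]].

Local Notation rvec := (g_sigma_algebraType cylsys).

Lemma measurable_cyl s B : (forall i, measurable (B i)) ->
  measurable (cyl s B : set rvec).
Proof.
move=> mB; apply: sub_sigma_algebra; exists (undup s), B; split => //.
- exact: undup_uniq.
- by apply/seteqP; split => w /= h i; have := h i; rewrite mem_undup.
Qed.

Lemma measurable_coord i : measurable_fun setT (fun w : rvec => w i).
Proof.
move=> _ B mB; rewrite setTI.
have -> : (fun w : rvec => w i) @^-1` B = cyl [:: i] (fun=> B).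
  apply/seteqP; split => w /=; first by move=> h j; rewrite inE => /eqP ->.
  by apply; rewrite inE.
exact: measurable_cyl.
Qed.

Lemma measurable_rvecP d (S : measurableType d) (f : S -> rvec) :
  (forall i, measurable_fun setT (fun x => f x i)) -> measurable_fun setT f.
Proof.
move=> mf.
apply: (@measurability _ _ _ _ setT f cylsys) => //.
move=> _ [_ [s [B [us mB ->]]] <-]; rewrite setTI.
have -> : f @^-1` cyl s B = \big[setI/setT]_(i <- s) ((fun x => f x i) @^-1` B i).
  apply/seteqP; split => x /=; rewrite -bigcap_seq //=.
by apply: bigsetI_measurable => i _; rewrite -[X in measurable X]setTI; exact: mf.
Qed.

Lemma cylsys_setI : setI_closed cylsys.
Proof.
move=> _ _ [s [B [us mB ->]]] [s' [B' [us' mB' ->]]].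
exists (undup (s ++ s')), (fun i => (if i \in s then B i else setT) `&`
   (if i \in s' then B' i else setT)); split.
- exact: undup_uniq.
- by move=> i; apply: measurableI; case: ifP.
- apply/seteqP; split => w /=.
    move=> [h h'] i; rewrite mem_undup mem_cat => _.
    by split; case: ifP => // ?; [exact: h|exact: h'].
  move=> h; split => i si; have := h i; rewrite mem_undup mem_cat si ?orbT => /(_ isT).
    by case.
  by case.
Qed.

(** Cylinders form a pi-system that contains the whole space, as the cylinder over the empty
    list. *)
Lemma rvec_measure_unique (m1 m2 : {measure set rvec -> \bar R}) :
  (m1 setT < +oo)%E ->
  (forall s B, uniq s -> (forall i, measurable (B i)) -> m1 (cyl s B) = m2 (cyl s B)) ->
  forall A, measurable A -> m1 A = m2 A.
Proof.
move=> m1T m12 A mA.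
apply: (@measure_unique _ R rvec cylsys (fun=> setT) _ _ _ _ m1 m2) => //.
- exact: cylsys_setI.
- by move=> _; exists [::], (fun=> setT); split => //; apply/seteqP; split.
- by apply/seteqP; split => // x _; exists 0%N.
- by move=> _ [s [B [us mB ->]]]; exact: m12.
Qed.

End rvec.

Notation rvec R I := (g_sigma_algebraType (@cylsys R I)).

(** * Resampling part of the coordinates *)

Section mix.
Variables (R : realType) (I : choiceType).
Implicit Types (J : pred I).

(** The coordinates in [J] are kept and the others taken from a second point. Conditioning is
    expressed in this way throughout, which avoids splitting the index set into two factors. *)
Definition mix J (w w' : rvec R I) : rvec R I := fun i => if J i then w i else w' i.

Lemma measurable_mix J :
  measurable_fun setT (fun x : rvec R I * rvec R I => mix J x.1 x.2 : rvec R I).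
Proof.
apply: measurable_rvecP => i; rewrite /mix; case: (J i).
- by apply: (measurableT_comp (measurable_coord i)); exact: measurable_fst.
- by apply: (measurableT_comp (measurable_coord i)); exact: measurable_snd.
Qed.

(** The image of the product of [k] with itself under [mix] agrees with [k] on cylinders because
    these factor along [J]. Only the independence of the two halves enters, so the statement serves
    for Gaussian families and also for the pair formed by the points and the fading. *)
Lemma mix_law (k : probability (rvec R I) R) J :
  (forall s B, uniq s -> (forall i, measurable (B i)) ->
    k (cyl s B) = (k (cyl [seq i <- s | J i] B) * k (cyl [seq i <- s | ~~ J i] B))%E) ->
  forall E, measurable E -> k E = (\int[k]_w k [set w' | E (mix J w w')])%E.
Proof.
move=> kJ E mE.
have mm := @measurable_mix J.
have [m2 m2E'] := pushforward_measure_ex (k \x k)%E mm.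
have m2E A : m2 A = (k \x k)%E [set x | A (mix J x.1 x.2)] by rewrite m2E'.
have m2T : (m2 setT < +oo)%E by rewrite m2E'; apply: le_lt_trans (ltry 1); rewrite [leLHS]prod_setT.
have km2 A : measurable A -> m2 A = k A.
  apply: rvec_measure_unique => // s B us mB.
  apply/esym; apply: (eq_trans (kJ _ _ us mB)); rewrite m2E'.
  apply: (eq_trans (esym (prod_rect k k (measurable_cyl _ mB) (measurable_cyl _ mB)))).
  congr (product_measure1 _ _ _); apply/seteqP; split => -[w w'] /=.
    move=> [h h'] i si; rewrite /mix; case: ifP => Ji.
      by apply: h; rewrite mem_filter si Ji.
    by apply: h'; rewrite mem_filter /= si Ji.
  by move=> h; split => i; rewrite mem_filter /= => /andP[Ji si]; have := h i si;
      rewrite /mix ?Ji ?(negbTE Ji).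
apply: (eq_trans (esym (km2 _ mE))); rewrite m2E' /product_measure1; apply: eq_integral => w _ /=.
by congr (k _); apply/seteqP; split => w' /=; rewrite /xsection /= in_setE.
Qed.

Lemma measurable_mixr J w : measurable_fun setT (mix J w : rvec R I -> rvec R I).
Proof.
apply: measurable_rvecP => i; rewrite /mix; case: (J i) => //.
exact: measurable_coord.
Qed.

Lemma measurable_mix_section E J w : measurable E -> measurable [set w' | E (mix J w w')].
Proof.
by move=> mE; rewrite -[X in measurable X]setTI; exact: measurable_mixr.
Qed.

End mix.

Section iid.
Variables (R : realType) (I : choiceType) (mu : probability (measurableTypeR R) R).
Variable (nu : probability (rvec R I) R).

Definition iid := forall s B, uniq s -> (forall i, measurable (B i)) ->
  nu (cyl s B) = (\prod_(i <- s) mu (B i))%E.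

Hypothesis nuI : iid.

(* Fubini: the coordinates outside [J] are integrated first, those in [J] being frozen. *)
Lemma iid_mix J E : measurable E -> nu E = (\int[nu]_w nu [set w' | E (mix J w w')])%E.
Proof.
apply: mix_law => s B us mB.
apply: (eq_trans (nuI us mB)); apply/esym.
apply: (eq_trans (f_equal2 _ (nuI (filter_uniq _ us) mB) (nuI (filter_uniq _ us) mB))).
by rewrite !big_filter [RHS](bigID J).
Qed.

Lemma iid_coord i B : measurable B -> nu [set w | B (w i)] = mu B.
Proof.
move=> mB.
have -> : [set w : rvec R I | B (w i)] = cyl [:: i] (fun=> B).
  apply/seteqP; split => w /=; first by move=> Bw j; rewrite inE => /eqP ->.
  by apply; rewrite inE.
by apply: (eq_trans (nuI (s := [:: i]) _ (fun=> mB))) => //; rewrite big_seq1.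
Qed.

Lemma measurable_coord2 i j : measurable_fun setT (fun w : rvec R I => (w i, w j)).
Proof. by apply/measurable_fun_pairP; split; exact: measurable_coord. Qed.

Lemma iid_pair i j E : i != j -> measurable E ->
  nu [set w | E (w i, w j)] = (mu \x mu)%E E.
Proof.
move=> ij mE.
have mc : measurable_fun setT (fun w : rvec R I => (w i, w j) : measurableTypeR R * measurableTypeR R).
  by apply/measurable_fun_pairP; split; exact: measurable_coord.
have [m' m'E] := pushforward_measure_ex nu mc.
rewrite (product_measure_unique (m' := m')) ?m'E// => A B mA mB.
rewrite m'E.
have -> : (fun w : rvec R I => (w i, w j)) @^-1` (A `*` B) =
   cyl [:: i; j] (fun k => if k == i then A else B).
  apply/seteqP; split => w /=.
    by move=> [Aw Bw] k; rewrite !inE => /orP[] /eqP ->; rewrite ?eqxx // eq_sym (negbTE ij).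
  move=> h; split; first by have := h i; rewrite inE eqxx => /(_ isT).
  by have := h j; rewrite !inE eqxx orbT eq_sym (negbTE ij) => /(_ isT).
apply: (eq_trans (nuI _ _)); first by rewrite /= inE ij.
  by move=> k; case: ifP.
by rewrite !big_cons big_nil eqxx eq_sym (negbTE ij) mule1.
Qed.

Lemma iid_pair_int i j (f : R * R -> \bar R) : i != j -> measurable_fun setT f ->
  (forall x, 0 <= f x)%E ->
  (\int[nu]_w f (w i, w j) = \int[mu]_x \int[mu]_y f (x, y))%E.
Proof.
move=> ij mf f0.
have mc : measurable_fun setT (fun w : rvec R I => (w i, w j) : measurableTypeR R * measurableTypeR R).
  by apply/measurable_fun_pairP; split; exact: measurable_coord.
transitivity (\int[pushforward nu (fun w : rvec R I => (w i, w j) : measurableTypeR R * measurableTypeR R)]_x f x)%E.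
  by rewrite ge0_integral_pushforward.
transitivity (\int[(mu \x mu)%E]_x f x)%E; last exact: fubini_tonelli1.
apply: eq_measure_integral => A mA _.
exact: iid_pair.
Qed.

Definition pres (phi : rvec R I -> rvec R I) := measurable_fun setT phi /\
  forall E, measurable E -> nu (phi @^-1` E) = nu E.

Lemma pres_comp f g : pres f -> pres g -> pres (f \o g).
Proof.
move=> [mf fE] [mg gE]; split; first exact: measurableT_comp.
move=> E mE; rewrite comp_preimage gE ?fE//.
by rewrite -[X in measurable X]setTI; exact: mf.
Qed.

Definition rot (i j : I) (c s : R) (w : rvec R I) : rvec R I := fun k =>
  if k == i then c * w i - s * w j else if k == j then s * w i + c * w j else w k.

Lemma measurable_rot i j c s : measurable_fun setT (rot i j c s).
Proof.
apply: measurable_rvecP => k; rewrite /rot; have mc := @measurable_coord R I.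
case: (k == i); first by apply: measurable_funB; apply: measurable_funM => //.
case: (k == j); first by apply: measurable_funD; apply: measurable_funM => //.
exact: mc.
Qed.

Lemma measurable_rot2 i j c s :
  measurable_fun setT (fun w : rvec R I => (c * w i - s * w j, s * w i + c * w j)).
Proof.
have mc := @measurable_coord R I; apply/measurable_fun_pairP; split => /=.
  by apply: measurable_funB; apply: measurable_funM => //.
by apply: measurable_funD; apply: measurable_funM => //.
Qed.

(** Cylinders suffice. Once [i] and [j] are frozen, a cylinder splits into a condition [F] on this
    pair and a cylinder on the remaining coordinates, and the rotation acts on the former only. *)
Lemma pres_rot (i j : I) (c s : R) : i != j ->
  (forall E : set (R * R), measurable E -> (mu \x mu)%E
      [set x | E (c * x.1 - s * x.2, s * x.1 + c * x.2)] = (mu \x mu)%E E) ->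
  pres (rot i j c s).
Proof.
move=> ij rotE; split; first exact: measurable_rot.
have [m' m'E] := pushforward_measure_ex nu (measurable_rot i j c s).
move=> E mE; rewrite -m'E; apply: rvec_measure_unique mE.
  by rewrite m'E preimage_setT; apply: le_lt_trans (ltry 1); rewrite [leLHS]probability_setT.
move=> S B uS mB; rewrite m'E.
apply: (eq_trans (@iid_mix (pred2 i j) _ _)).
  by rewrite -[X in measurable X]setTI; apply: measurable_rot => //; exact: measurable_cyl.
apply/esym; apply: (eq_trans (@iid_mix (pred2 i j) _ _)).
  exact: measurable_cyl.
pose S' := [seq k <- S | predC (pred2 i j) k].
pose F := [set x : R * R | (i \in S -> B i x.1) /\ (j \in S -> B j x.2)].
have mF : measurable F.
  have -> : F = (if i \in S then B i else setT) `*` (if j \in S then B j else setT).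
    by apply/seteqP; split => x; rewrite /F /=; case: (i \in S); case: (j \in S) => /=;
      move=> [h h']; split => //; (exact: h || exact: h' || idtac).
  by apply: measurableX; case: ifP.
(* Used for the rotation and for the identity: the two integrals become products with the same
   second factor. *)
have key (f : rvec R I -> R * R) (phi : rvec R I -> rvec R I) :
   (forall w w', cyl S B (phi (mix (pred2 i j) w w')) <-> F (f w) /\ cyl S' B w') ->
   measurable (f @^-1` F) ->
   (\int[nu]_w nu [set w' | (phi @^-1` cyl S B) (mix (pred2 i j) w w')])%E =
   (nu (f @^-1` F) * nu (cyl S' B))%E.
  move=> h mfF.
  have -> : (fun w => nu [set w' | (phi @^-1` cyl S B) (mix (pred2 i j) w w')]) =
     (fun w => (\1_(f @^-1` F) w)%:E * nu (cyl S' B))%E.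
    apply/funext => w; rewrite indicE.
    have [/set_mem fF|/negP fF] := boolP (w \in f @^-1` F).
      by rewrite mul1e; congr (nu _); apply/seteqP; split => w' /=; [move/h => []|move=> ?; apply/h].
    rewrite mul0e -(measure0 nu); congr (nu _); apply/seteqP; split => w' //= /h [Ff _].
    by apply: fF; exact/mem_set.
  rewrite ge0_integralZr//; last exact/measurable_EFinP/measurable_indic.
  by rewrite integral_indic// setIT.
have hS' w w' : cyl S' B w' -> forall k, k != i -> k != j -> k \in S -> B k (mix (pred2 i j) w w' k).
  move=> h k ki kj kS; rewrite /mix /= (negbTE ki) (negbTE kj) /=.
  by apply: h; rewrite mem_filter /= (negbTE ki) (negbTE kj).
rewrite (key (fun w => (w i, w j)) id).
- rewrite (key (fun w => (c * w i - s * w j, s * w i + c * w j)) (rot i j c s)).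
  + congr (_ * _)%E; apply: (eq_trans (iid_pair ij mF)); apply: (eq_trans (esym (rotE _ mF))).
    apply/esym; apply: (iid_pair (E := [set x | F (c * x.1 - s * x.2, s * x.1 + c * x.2)])) => //.
    rewrite -[X in measurable X]setTI.
    have mR : measurable_fun setT (fun x : R * R => (c * x.1 - s * x.2, s * x.1 + c * x.2)).
      apply/measurable_fun_pairP; split => /=.
        by apply: measurable_funB; apply: measurable_funM => //; exact: measurable_fst || exact: measurable_snd.
      by apply: measurable_funD; apply: measurable_funM => //; exact: measurable_fst || exact: measurable_snd.
    exact: mR.
  + move=> w w'; rewrite /cyl /rot /F /=; split.
      move=> h; split; first split.
      * by move=> iS; have := h i iS; rewrite eqxx /mix /= !eqxx orbT.
      * by move=> jS; have := h j jS; rewrite (eq_sym j) (negbTE ij) eqxx /mix /= !eqxx orbT.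
      * move=> k; rewrite mem_filter /= negb_or => /andP[/andP[ki kj] kS].
        by have := h k kS; rewrite (negbTE ki) (negbTE kj) /mix /= (negbTE ki) (negbTE kj).
    move=> [[h1 h2] h3] k kS; rewrite /mix /= !eqxx orbT.
    have [ki|ki] := eqVneq k i; first by subst k; exact: h1.
    have [kj|kj] := eqVneq k j; first by subst k; exact: h2.
    by apply: h3; rewrite mem_filter /= (negbTE ki) (negbTE kj).
  + have mR := measurable_rot2 i j c s.
    by rewrite -[X in measurable X]setTI; exact: mR.
- move=> w w'; split => /=.
    move=> h; split; first split => /=.
    * by move=> iS; have := h i iS; rewrite /mix /= eqxx.
    * by move=> jS; have := h j jS; rewrite /mix /= eqxx orbT.
    * move=> k; rewrite mem_filter /= negb_or => /andP[/andP[ki kj] kS].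
      by have := h k kS; rewrite /mix /= (negbTE ki) (negbTE kj).
  move=> [[h1 h2] h3] k kS; rewrite /mix /=.
  have [ki|ki] := eqVneq k i; first by subst k; exact: h1.
  have [kj|kj] := eqVneq k j; first by subst k; exact: h2.
  by apply: h3; rewrite mem_filter /= (negbTE ki) (negbTE kj).
- by rewrite -[X in measurable X]setTI; exact: measurable_coord2.
Qed.

End iid.

(** A subfamily of an i.i.d. family is i.i.d.; the applications discard an antenna or an
    interferer. *)
Lemma iid_reindex (R : realType) (I I' : choiceType) (f : I' -> I) mu
  (nu : probability (rvec R I) R) : injective f -> iid mu nu ->
  exists nu' : probability (rvec R I') R, iid mu nu' /\
    forall A, nu' A = nu ((fun w : rvec R I => (w \o f : rvec R I')) @^-1` A).
Proof.
move=> fI nuI.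
have mf : measurable_fun setT (fun w : rvec R I => (w \o f : rvec R I')).
  by apply: measurable_rvecP => i; exact: measurable_coord.
have [nu' nu'E] := pushforward_probability_ex nu mf.
exists nu'; split => // s B us mB; rewrite nu'E.
(* [B] transported along [f], and the whole line at indices outside the image. *)
pose B' i : set R := [set x | forall i', f i' = i -> B i' x].
have B'f i : B' (f i) = B i.
  by apply/seteqP; split => x /=; [apply|move=> Bx i' /fI ->].
have mB' i : measurable (B' i).
  have [[i' <-]|h] := pselect (exists i', f i' = i); first by rewrite B'f.
  rewrite (_ : B' i = setT)//; apply/seteqP; split => // x _ i' fi.
  by exfalso; apply: h; exists i'.
have -> : (fun w : rvec R I => (w \o f : rvec R I')) @^-1` cyl s B = cyl (map f s) B'.
  apply/seteqP; split => w /= h.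
    by move=> _ /mapP[i si ->]; rewrite B'f; exact: h.
  by move=> i si; rewrite -B'f; apply: h; exact: map_f.
apply: (eq_trans (nuI _ _ _ mB')); first by rewrite map_inj_uniq.
by rewrite big_map; apply: eq_bigr => i _; rewrite B'f.
Qed.

(** * Hermitian forms *)

Section lin.
Variable R : realType.
Notation C := R[i].
Notation Re := complex.Re.
Notation Im := complex.Im.

Lemma ctransM m n p (A : 'M[C]_(m, n)) (B : 'M[C]_(n, p)) :
  ctrans (A *m B) = ctrans B *m ctrans A.
Proof. by rewrite /ctrans trmx_mul map_mxM. Qed.

Lemma ctransD m n (A B : 'M[C]_(m, n)) : ctrans (A + B) = ctrans A + ctrans B.
Proof. by rewrite /ctrans linearD map_mxD. Qed.

Lemma ctransZ m n (a : C) (A : 'M[C]_(m, n)) : ctrans (a *: A) = (conjc a) *: ctrans A.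
Proof. by rewrite /ctrans linearZ map_mxZ. Qed.

Lemma ctransK m n (A : 'M[C]_(m, n)) : ctrans (ctrans A) = A.
Proof. by apply/matrixP => i j; rewrite !mxE conjcK. Qed.

Lemma ctrans_scalar n (a : C) : ctrans (a%:M : 'M[C]_n) = (conjc a)%:M.
Proof. by rewrite /ctrans tr_scalar_mx map_scalar_mx. Qed.

Lemma ctrans0 m n : ctrans (0 : 'M[C]_(m, n)) = 0.
Proof. by apply/matrixP => i j; rewrite !mxE conjc0. Qed.

Lemma ctrans_eq0 m n (A : 'M[C]_(m, n)) : (ctrans A == 0) = (A == 0).
Proof.
apply/eqP/eqP => [h|->]; last exact: ctrans0.
by rewrite -(ctransK A) h ctrans0.
Qed.

Lemma ctrans_inv n (A : 'M[C]_n) : ctrans (invmx A) = invmx (ctrans A).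
Proof. by rewrite /ctrans trmx_inv map_invmx. Qed.

Lemma ctrans11 (A : 'M[C]_1) : (ctrans A) 0 0 = conjc (A 0 0).
Proof. by rewrite !mxE. Qed.

Section pd.
Variable n : nat.
Implicit Types (A U : 'M[C]_n) (x y c v : 'cV[C]_n).

Definition sform A x y : C := (ctrans x *m A *m y) 0 0.

(** In the order of [R[i]] a positive number is real, so the second clause asks for positive real
    values. *)
Definition pd A := ctrans A = A /\ forall v, v != 0 -> 0 < sform A v v.

Lemma sformJ A x y : ctrans A = A -> conjc (sform A x y) = sform A y x.
Proof. by move=> hA; rewrite /sform -ctrans11 !ctransM ctransK hA mulmxA. Qed.

Lemma sformDr A x y z : sform A x (y + z) = sform A x y + sform A x z.
Proof. by rewrite /sform mulmxDr mxE. Qed.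

Lemma sformDl A x y z : sform A (x + y) z = sform A x z + sform A y z.
Proof. by rewrite /sform ctransD !mulmxDl mxE. Qed.

Lemma sformZr A a x y : sform A x (a *: y) = a * sform A x y.
Proof. by rewrite /sform -scalemxAr mxE. Qed.

Lemma sformZl A a x y : sform A (a *: x) y = conjc a * sform A x y.
Proof. by rewrite /sform ctransZ -!scalemxAl mxE. Qed.

Lemma sformDm A B x y : sform (A + B) x y = sform A x y + sform B x y.
Proof. by rewrite /sform mulmxDr mulmxDl mxE. Qed.

Lemma sformZm A a x y : sform (a *: A) x y = a * sform A x y.
Proof. by rewrite /sform -scalemxAr -scalemxAl mxE. Qed.

Lemma sform_rank1 c x y :
  sform (c *m ctrans c) x y = conjc (sform 1%:M c x) * sform 1%:M c y.
Proof.
rewrite /sform !mulmx1 -ctrans11 ctransM ctransK !mulmxA -[_ *m _ *m _]mulmxA.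
by rewrite mxE big_ord1.
Qed.

Lemma sform_unitary U A x y : sform (U *m A *m ctrans U) x y = sform A (ctrans U *m x) (ctrans U *m y).
Proof. by rewrite /sform ctransM ctransK !mulmxA. Qed.

Lemma sform1_ge0 x : 0 <= sform 1%:M x x.
Proof.
rewrite /sform mulmx1 mxE sumr_ge0// => i _; rewrite !mxE mulrC; exact: mulcJ_ge0.
Qed.

Lemma sform1_gt0 x : x != 0 -> 0 < sform 1%:M x x.
Proof.
move=> x0; rewrite lt_neqAle sform1_ge0 andbT eq_sym.
apply: contra x0; rewrite /sform mulmx1 mxE psumr_eq0; last first.
  by move=> i _; rewrite !mxE mulrC; exact: mulcJ_ge0.
move/allP => h; apply/eqP/matrixP => i j; rewrite ord1 mxE.
have := h i (mem_index_enum _); rewrite !mxE mulf_eq0 conjc_eq0.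
by move=> /orP[] /eqP.
Qed.

Lemma pd_scalar (s : R) : 0 < s -> pd (s%:C%C)%:M.
Proof.
move=> s0; split; first by rewrite ctrans_scalar conjc_real.
move=> v v0; rewrite -scalemx1 sformZm mulr_gt0// ?sform1_gt0//.
by rewrite ltcR.
Qed.

Lemma pd_rank1 A c (p : R) : pd A -> 0 <= p -> pd (A + p%:C%C *: (c *m ctrans c)).
Proof.
move=> [hA pA] p0; split; first by rewrite ctransD ctransZ ctransM ctransK hA conjc_real.
move=> v v0; rewrite sformDm sformZm ltr_wpDr ?pA// mulr_ge0 ?ler0c//.
by rewrite sform_rank1 mulrC mulcJ_ge0.
Qed.

Lemma pd_unit A : pd A -> A \in unitmx.
Proof.
move=> [hA pA]; rewrite -row_free_unit -kermx_eq0; apply/negP => /negP h.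
have [i ri] : exists i, row i (kermx A) != 0.
  apply/existsP; rewrite -negb_forall; apply: contra h => /forallP h.
  by apply/eqP/row_matrixP => i; rewrite (eqP (h i)) row0.
have := pA (ctrans (row i (kermx A))); rewrite ctrans_eq0 => /(_ ri).
by rewrite /sform ctransK -row_mul mulmx_ker row0 mul0mx mxE ltxx.
Qed.

Lemma pd_inv A : pd A -> pd (invmx A).
Proof.
move=> pA; have uA := pd_unit pA; case: (pA) => hA pA'.
split; first by rewrite ctrans_inv hA.
move=> v v0; have -> : sform (invmx A) v v = sform A (invmx A *m v) (invmx A *m v).
  by rewrite /sform ctransM ctrans_inv hA -!mulmxA (mulmxA A) mulmxV// mul1mx.
apply: pA'; apply: contra v0 => /eqP h.
by rewrite -[v]mul1mx -(mulmxV uA) -mulmxA h mulmx0.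
Qed.

Definition iform A x y := sform (invmx A) x y.

(** The candidate inverse [B] is verified by multiplication: [ctrans c *m invmx A *m c] is a scalar
    matrix, which collapses the product of two rank-one terms to a multiple of one of them. *)
Lemma sherman_morrison A c (p : C) x y : A \in unitmx -> 1 + p * iform A c c != 0 ->
  iform (A + p *: (c *m ctrans c)) x y =
  iform A x y - p * iform A x c * iform A c y / (1 + p * iform A c c).
Proof.
move=> uA h; set b := iform A c c in h *.
pose B := invmx A - (p / (1 + p * b)) *: (invmx A *m c *m (ctrans c *m invmx A)).
have cc : ctrans c *m invmx A *m c = b%:M.
  by apply/matrixP => i j; rewrite !ord1 [RHS]mxE eqxx mulr1n.
have BE : (A + p *: (c *m ctrans c)) *m B = 1%:M.
  rewrite /B mulmxBr !mulmxDl -!scalemxAr mulmxV// -!scalemxAl !mulmxA mulmxV// mul1mx.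
  have -> : c *m ctrans c *m invmx A *m c *m ctrans c *m invmx A =
      b *: (c *m ctrans c *m invmx A).
    rewrite -!mulmxA [ctrans c *m (_ *m _)]mulmxA [_ *m (c *m _)]mulmxA cc.
    by rewrite mul_scalar_mx -scalemxAr.
  rewrite -addrA -[RHS]addr0; congr (_ + _).
  rewrite !scalerA -scalerDl -scalerBl.
  have -> : p - (p / (1 + p * b) + p / (1 + p * b) * p * b) = 0 by field.
  by rewrite scale0r.
have /mulmx1_unit[uB _] := BE.
have -> : iform (A + p *: (c *m ctrans c)) x y = sform B x y.
  by rewrite /iform /sform -[invmx _]mulmx1 -BE mulKmx.
have MM : sform (invmx A *m c *m (ctrans c *m invmx A)) x y = iform A x c * iform A c y.
  rewrite /iform /sform.
  have -> : ctrans x *m (invmx A *m c *m (ctrans c *m invmx A)) *m y =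
    (ctrans x *m invmx A *m c) *m (ctrans c *m invmx A *m y) by rewrite !mulmxA.
  by rewrite [LHS]mxE big_ord1.
rewrite /B -scaleNr sformDm sformZm MM -/(iform A x y).
by field.
Qed.

Lemma iform_unitary U A x y : ctrans U *m U = 1%:M -> A \in unitmx ->
  iform (U *m A *m ctrans U) (U *m x) (U *m y) = iform A x y.
Proof.
move=> UU uA; have [uU' uU] := mulmx1_unit UU.
have iU : invmx U = ctrans U by rewrite -[LHS]mul1mx -UU mulmxK.
have E : invmx (U *m A *m ctrans U) = U *m invmx A *m ctrans U.
  have h : (U *m A *m ctrans U) *m (U *m invmx A *m ctrans U) = 1%:M.
    rewrite -!mulmxA (mulmxA (ctrans U) U) UU mul1mx (mulmxA A) mulmxV// mul1mx.
    by rewrite -iU mulmxV.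
  have [uX _] := mulmx1_unit h.
  by rewrite -[LHS]mulmx1 -h mulKmx.
rewrite /iform E sform_unitary !(mulmxA (ctrans U)) UU !mul1mx //.
Qed.

Definition normsq (z : C) : R := Re z ^+ 2 + Im z ^+ 2.

Lemma normsq_ge0 z : 0 <= normsq z.
Proof. by rewrite addr_ge0 ?sqr_ge0. Qed.

Lemma normsqE z : (normsq z)%:C%C = z * conjc z.
Proof. by case: z => a b; apply/eqP; rewrite eq_complex /normsq /=; apply/andP; split; apply/eqP; ring. Qed.

Lemma normsqJ z : normsq (conjc z) = normsq z.
Proof. by case: z => a b; rewrite /normsq /= sqrrN. Qed.

Lemma normsq_eq0 z : (normsq z == 0) = (z == 0).
Proof. by rewrite -(inj_eq (@complexI R)) normsqE mulf_eq0 conjc_eq0 orbb. Qed.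

(** A real number, to be compared with thresholds; for positive definite [A] the form is real and
    nothing is lost. *)
Definition gram A x : R := Re (iform A x x).

Lemma gramE A x : pd A -> iform A x x = (gram A x)%:C%C.
Proof.
move=> /pd_inv[hA _]; have := sformJ x x hA; rewrite -/(iform A x x) /gram.
case: (iform A x x) => a b /= [] h; apply/eqP; rewrite eq_complex /= eqxx /=; apply/eqP; lra.
Qed.

Lemma iformJ A x y : pd A -> conjc (iform A x y) = iform A y x.
Proof. by move=> /pd_inv[hA _]; exact: sformJ. Qed.

Lemma gram_gt0 A x : pd A -> x != 0 -> 0 < gram A x.
Proof.
move=> pA x0; rewrite -ltcR -gramE//; have [_ h] := pd_inv pA; exact: h.
Qed.

Lemma gram0 A : gram A 0 = 0.
Proof. by rewrite /gram /iform /sform mulmx0 mxE. Qed.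

Lemma gram_ge0 A x : pd A -> 0 <= gram A x.
Proof. by move=> pA; have [->|x0] := eqVneq x 0; rewrite ?gram0// ltW// gram_gt0. Qed.

Lemma gram_CS A x y : pd A -> normsq (iform A x y) <= gram A x * gram A y.
Proof.
move=> pA; have [->|y0] := eqVneq y 0.
  by rewrite gram0 mulr0 /iform /sform mulmx0 mxE /normsq /= !expr0n addr0.
have b0 := gram_gt0 pA y0.
(* The coefficient that makes [x + t *: y] orthogonal to [y] for [invmx A]. *)
pose t := - (iform A y x / iform A y y).
have := gram_ge0 (x + t *: y) pA.
rewrite -lecR -gramE// /iform sformDr !sformDl !sformZr !sformZl -!/(iform _ _ _).
have nb : iform A y y != 0 by rewrite gramE// (inj_eq (@complexI R) _ 0) gt_eqF.
have ct : conjc t = - (iform A x y / iform A y y).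
  by rewrite /t rmorphN rmorphM /= conjc_inv !iformJ.
rewrite ct /t.
have F (a z z' b : C) : b != 0 ->
  a + - (z / b) * z' + (- (z' / b) * z + - (z' / b) * (- (z / b) * b)) = a - z * z' / b.
  by move=> ?; field.
rewrite F//.
rewrite -(iformJ x y pA) -normsqE !gramE//.
have -> : (gram A x)%:C%C - (normsq (iform A x y))%:C%C / (gram A y)%:C%C =
   (gram A x - normsq (iform A x y) / gram A y)%:C%C.
  by rewrite rmorphB rmorphM fmorphV.
by rewrite lecR subr_ge0 ler_pdivrMr.
Qed.

Lemma RC_frac (a p k b : R) : a%:C%C - p%:C%C * k%:C%C / (1 + p%:C%C * b%:C%C) =
  (a - p * k / (1 + p * b))%:C%C.
Proof. by rewrite rmorphB rmorphM rmorphM fmorphV rmorphD rmorphM rmorph1. Qed.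

Lemma gram_update A x c (p g : R) : pd A -> 0 < p ->
  (g < gram (A + p%:C%C *: (c *m ctrans c)) x) =
  (normsq (iform A x c) < (gram A x - g) * (gram A c + p^-1)).
Proof.
move=> pA p0; have b0 := gram_ge0 c pA.
have d0 : 0 < 1 + p * gram A c by rewrite ltr_pwDl// mulr_ge0// ltW.
rewrite /gram sherman_morrison ?pd_unit//; last first.
  by rewrite gramE// -(rmorphM (real_complex R)) -(rmorph1 (real_complex R)) -(rmorphD (real_complex R)) (inj_eq (@complexI R) _ 0) gt_eqF.
rewrite -(iformJ x c pA) -[p%:C%C * _ * _]mulrA -normsqE (gramE x pA) (gramE c pA).
have -> : (gram A x)%:C%C - p%:C%C * (normsq (iform A x c))%:C%C / (1 + p%:C%C * (gram A c)%:C%C) =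
  (gram A x - p * normsq (iform A x c) / (1 + p * gram A c))%:C%C.
  exact: RC_frac.
rewrite /=.
rewrite ltrBrDl addrC -ltrBrDl ltr_pdivrMr//.
have -> : (gram A x - g) * (1 + p * gram A c) = p * ((gram A x - g) * (gram A c + p^-1)).
  by field; rewrite gt_eqF.
by rewrite ltr_pM2l.
Qed.

End pd.

Section slice.
Variable m : nat.
Implicit Types (A : 'M[C]_(1 + m)) (x c : 'cV[C]_(1 + m)).

Lemma pd_slice A : pd A -> pd (drsubmx A).
Proof.
move=> [hA pA]; split.
  by rewrite -[in RHS]hA /ctrans; apply/matrixP => i j; rewrite !mxE.
move=> v v0.
have -> : sform (drsubmx A) v v = sform A (col_mx 0 v) (col_mx 0 v).
  rewrite /sform -{2}(submxK A) /ctrans tr_col_mx map_row_mx mul_row_block mul_row_col.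
  by rewrite trmx0 map_mx0 !mul0mx !add0r mulmx0 add0r.
apply: pA; apply: contra v0 => /eqP; rewrite -(col_mx0 R[i] 1 m 1) => /eq_col_mx[_ ->] //.
Qed.

(** The vector [col_mx 0 u] equals [invmx A *m (x + k *: c)]. Pairing it with [c], supported on the
    first coordinate, shows that [x + k *: c] is orthogonal to [c] for [invmx A]; pairing it with
    [x] gives the form of the lower block. So the Gram determinant is [gram A c] times the squared
    distance from [x] to the line of [c]. *)
Lemma gram_slice A x c : pd A -> dsubmx c = 0 -> c != 0 ->
  gram A x * gram A c - normsq (iform A x c) = gram A c * gram (drsubmx A) (dsubmx x).
Proof.
move=> pA dc c0; have pB := pd_slice pA.
pose u := invmx (drsubmx A) *m dsubmx x.
pose c1 := (usubmx c) 0 0.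
have cE : c = col_mx c1%:M 0.
  by rewrite -[LHS]vsubmxK dc; congr col_mx; apply/matrixP => i j; rewrite !ord1 [RHS]mxE eqxx.
have c10 : c1 != 0.
  by apply: contra c0 => /eqP h; rewrite cE h raddf0 col_mx0.
pose s := (ursubmx A *m u) 0 0.
(* Chosen so that the first coordinate of [x + k *: c] is that of [A *m col_mx 0 u]. *)
pose k := (s - (usubmx x) 0 0) / c1.
have Au : A *m col_mx 0 u = x + k *: c.
  rewrite -{1}(submxK A) mul_block_col !mulmx0 !add0r.
  have -> : drsubmx A *m u = dsubmx x by rewrite /u mulmxA mulmxV ?pd_unit// mul1mx.
  rewrite -[in RHS](vsubmxK x) cE scale_col_mx add_col_mx scaler0 addr0; congr col_mx.
  apply/matrixP => i j; rewrite !ord1 !mxE eqxx mulr1n /k divfK// -/s.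
  by rewrite (_ : usubmx x 0 0 = x (lshift m 0) 0) ?mxE// [RHS]addrC subrK /s mxE.
have uE : col_mx 0 u = invmx A *m x + k *: (invmx A *m c).
  by rewrite -[LHS]mul1mx -(mulVmx (pd_unit pA)) -mulmxA Au mulmxDr scalemxAr.
have hc : iform A c x + k * iform A c c = 0.
  transitivity ((ctrans c *m col_mx 0 u) 0 0).
    by rewrite uE mulmxDr -scalemxAr !mulmxA [RHS]mxE [X in _ = _ + X]mxE.
  rewrite cE /ctrans tr_col_mx map_row_mx mul_row_col mulmx0 add0r trmx0 map_mx0 mul0mx.
  by rewrite mxE.
have hx : iform A x x + k * iform A x c = iform (drsubmx A) (dsubmx x) (dsubmx x).
  transitivity ((ctrans x *m col_mx 0 u) 0 0).
    by rewrite uE mulmxDr -scalemxAr !mulmxA [RHS]mxE [X in _ = _ + X]mxE.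
  rewrite -{1}(vsubmxK x) /ctrans tr_col_mx map_row_mx mul_row_col mulmx0 add0r.
  by rewrite /u mulmxA.
apply: (@complexI R); rewrite rmorphB !rmorphM /= -!gramE// normsqE -hx iformJ//.
have -> : iform A c x = - (k * iform A c c) by apply/eqP; rewrite -addr_eq0 hc.
ring.
Qed.

End slice.
End lin.

(** * Measurability of complex matrices *)

Section cmeas.
Context d (T : measurableType d) (R : realType).
Notation C := R[i].
Notation Re := complex.Re.
Notation Im := complex.Im.
Implicit Types f g : T -> C.

Definition cmeas f := measurable_fun setT (fun x => Re (f x)) /\
  measurable_fun setT (fun x => Im (f x)).

Lemma cmeas_cst (z : C) : cmeas (fun=> z).
Proof. by split; exact: measurable_cst. Qed.

Lemma cmeas_real (h : T -> R) : measurable_fun setT h -> cmeas (fun x => (h x)%:C%C).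
Proof. by move=> mh; split => //=; exact: measurable_cst. Qed.

Lemma cmeas_complex (h k : T -> R) : measurable_fun setT h -> measurable_fun setT k ->
  cmeas (fun x => (h x +i* k x)%C).
Proof. by move=> mh mk; split. Qed.

Lemma cmeas_ext f g : (forall x, f x = g x) -> cmeas f -> cmeas g.
Proof. by move=> fg; rewrite (_ : g = f)//; apply/funext => x; rewrite fg. Qed.

Lemma cmeasD f g : cmeas f -> cmeas g -> cmeas (fun x => f x + g x).
Proof.
move=> [f1 f2] [g1 g2]; split.
- apply: eq_measurable_fun (measurable_funD f1 g1) => x _ /=.
  by case: (f x) => a b; case: (g x) => u v.
- apply: eq_measurable_fun (measurable_funD f2 g2) => x _ /=.
  by case: (f x) => a b; case: (g x) => u v.
Qed.

Lemma cmeasM f g : cmeas f -> cmeas g -> cmeas (fun x => f x * g x).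
Proof.
move=> [f1 f2] [g1 g2]; split.
- apply: eq_measurable_fun (measurable_funB (measurable_funM f1 g1) (measurable_funM f2 g2)) => x _ /=.
  by case: (f x) => a b; case: (g x) => u v.
- apply: eq_measurable_fun (measurable_funD (measurable_funM f1 g2) (measurable_funM f2 g1)) => x _ /=.
  by case: (f x) => a b; case: (g x) => u v.
Qed.

Lemma cmeasJ f : cmeas f -> cmeas (fun x => conjc (f x)).
Proof.
move=> [f1 f2]; split.
- by apply: eq_measurable_fun f1 => x _ /=; case: (f x).
- by apply: eq_measurable_fun (measurableT_comp (@oppr_measurable R setT) f2) => x _ /=; case: (f x).
Qed.

Lemma cmeas_sum (I : Type) (s : seq I) (P : pred I) (F : I -> T -> C) :
  (forall i, cmeas (F i)) -> cmeas (fun x => \sum_(i <- s | P i) F i x).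
Proof.
move=> mF; elim: s => [|i s IH].
  by apply: cmeas_ext (cmeas_cst 0) => x; rewrite big_nil.
have [Pi|Pi] := boolP (P i).
  by apply: cmeas_ext (cmeasD (mF i) IH) => x; rewrite big_cons Pi.
by apply: cmeas_ext IH => x; rewrite big_cons (negbTE Pi).
Qed.

Lemma cmeas_prod (I : Type) (s : seq I) (P : pred I) (F : I -> T -> C) :
  (forall i, cmeas (F i)) -> cmeas (fun x => \prod_(i <- s | P i) F i x).
Proof.
move=> mF; elim: s => [|i s IH].
  by apply: cmeas_ext (cmeas_cst 1) => x; rewrite big_nil.
have [Pi|Pi] := boolP (P i).
  by apply: cmeas_ext (cmeasM (mF i) IH) => x; rewrite big_cons Pi.
by apply: cmeas_ext IH => x; rewrite big_cons (negbTE Pi).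
Qed.

Lemma measurable_normsq f : cmeas f -> measurable_fun setT (fun x => normsq (f x)).
Proof. by move=> [f1 f2]; apply: measurable_funD; exact: measurable_funX. Qed.

Lemma cmeasV f : cmeas f -> cmeas (fun x => (f x)^-1).
Proof.
move=> mf; have mN := measurable_normsq mf.
have mV : measurable_fun setT (fun x => (normsq (f x))^-1).
  have mP : measurable_fun setT (fun z : R => z `^ (-1)) by exact: measurable_powR.
  apply: eq_measurable_fun (measurableT_comp mP mN) => x _ /=.
  by rewrite -powR_inv1 ?normsq_ge0.
apply: cmeas_ext (cmeasM (cmeasJ mf) (cmeas_real mV)) => x.
have [->|z0] := eqVneq (f x) 0; first by rewrite conjc0 mul0r invr0.
apply: (mulfI z0); rewrite mulfV// mulrA -normsqE -rmorphM mulfV ?rmorph1//.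
by rewrite normsq_eq0.
Qed.

Lemma measurable_ceq0 f : cmeas f -> measurable_fun setT (fun x => f x == 0).
Proof.
move=> mf; apply: eq_measurable_fun (measurable_fun_eqr (measurable_normsq mf) (@measurable_cst _ _ _ _ setT (0 : R))) => x _.
by rewrite normsq_eq0.
Qed.

Lemma cmeas_if (b : T -> bool) f g : measurable_fun setT b -> cmeas f -> cmeas g ->
  cmeas (fun x => if b x then f x else g x).
Proof.
move=> mb [f1 f2] [g1 g2]; split.
- by apply: eq_measurable_fun (measurable_fun_ifT mb f1 g1) => x _; case: (b x).
- by apply: eq_measurable_fun (measurable_fun_ifT mb f2 g2) => x _; case: (b x).
Qed.

Definition mmeas m n (F : T -> 'M[C]_(m, n)) := forall i j, cmeas (fun x => F x i j).

Lemma mmeas_cst m n (A : 'M[C]_(m, n)) : mmeas (fun=> A).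
Proof. by move=> i j; exact: cmeas_cst. Qed.

Lemma mmeas_ext m n (F G : T -> 'M[C]_(m, n)) : (forall x, F x = G x) -> mmeas F -> mmeas G.
Proof. by move=> FG mF i j; apply: cmeas_ext (mF i j) => x; rewrite FG. Qed.

Lemma mmeasD m n (F G : T -> 'M[C]_(m, n)) : mmeas F -> mmeas G -> mmeas (fun x => F x + G x).
Proof. by move=> mF mG i j; apply: cmeas_ext (cmeasD (mF i j) (mG i j)) => x; rewrite !mxE. Qed.

Lemma mmeasM m n p (F : T -> 'M[C]_(m, n)) (G : T -> 'M[C]_(n, p)) :
  mmeas F -> mmeas G -> mmeas (fun x => F x *m G x).
Proof.
move=> mF mG i j.
apply: (@cmeas_ext (fun x => \sum_k F x i k * G x k j)); first by move=> x; rewrite mxE.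
by apply: cmeas_sum => k; exact: cmeasM.
Qed.

Lemma mmeasZ m n (f : T -> C) (F : T -> 'M[C]_(m, n)) :
  cmeas f -> mmeas F -> mmeas (fun x => f x *: F x).
Proof. by move=> mf mF i j; apply: cmeas_ext (cmeasM mf (mF i j)) => x; rewrite mxE. Qed.

Lemma mmeas_ctrans m n (F : T -> 'M[C]_(m, n)) : mmeas F -> mmeas (fun x => ctrans (F x)).
Proof. by move=> mF i j; apply: cmeas_ext (cmeasJ (mF j i)) => x; rewrite !mxE. Qed.

Lemma mmeas_sum m n (I : Type) (s : seq I) (P : pred I) (F : I -> T -> 'M[C]_(m, n)) :
  (forall i, mmeas (F i)) -> mmeas (fun x => \sum_(i <- s | P i) F i x).
Proof.
move=> mF i j; apply: (@cmeas_ext (fun x => \sum_(k <- s | P k) F k x i j)).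
  by move=> x; rewrite summxE.
by apply: cmeas_sum => k; exact: mF.
Qed.

Lemma cmeas_det n (F : T -> 'M[C]_n) : mmeas F -> cmeas (fun x => \det (F x)).
Proof.
move=> mF; apply: cmeas_sum => s; apply: cmeasM; first exact: cmeas_cst.
by apply: cmeas_prod => i; exact: mF.
Qed.

(** Cofactor formula where the determinant does not vanish; on the measurable event where it does,
    [invmx] returns its argument. *)
Lemma mmeas_inv n (F : T -> 'M[C]_n) : mmeas F -> mmeas (fun x => invmx (F x)).
Proof.
move=> mF; have mdet := cmeas_det mF.
apply: (@mmeas_ext _ _ (fun x => if \det (F x) == 0 then F x else (\det (F x))^-1 *: \adj (F x))).
  by move=> x; rewrite /invmx unitmxE unitfE; case: eqP.
move=> i j.
apply: (@cmeas_ext (fun x => if \det (F x) == 0 then F x i j else (\det (F x))^-1 * (\adj (F x)) i j)).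
  by move=> x; case: (\det (F x) == 0); rewrite ?mxE.
apply: cmeas_if; first exact: measurable_ceq0.
  exact: mF.
apply: cmeasM; first exact: cmeasV.
apply: (@cmeas_ext (fun x => (-1) ^+ (j + i) * \det (row' j (col' i (F x))))).
  by move=> x; rewrite mxE.
apply: cmeasM; first exact: cmeas_cst.
by apply: cmeas_det => a b; apply: cmeas_ext (mF (lift j a) (lift i b)) => x; rewrite !mxE.
Qed.

Lemma cmeas_iform n (A : T -> 'M[C]_n) (x y : T -> 'cV[C]_n) :
  mmeas A -> mmeas x -> mmeas y -> cmeas (fun w => iform (A w) (x w) (y w)).
Proof.
move=> mA mx my.
exact: (mmeasM (mmeasM (mmeas_ctrans mx) (mmeas_inv mA)) my).
Qed.

Lemma measurable_gram n (A : T -> 'M[C]_n) (x : T -> 'cV[C]_n) :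
  mmeas A -> mmeas x -> measurable_fun setT (fun w => gram (A w) (x w)).
Proof. by move=> mA mx; have [] := cmeas_iform mA mx mx. Qed.

End cmeas.

(** * Unitary invariance of complex Gaussian vectors *)

Notation hgauss R := (normal_prob (0 : R) (Num.sqrt (2^-1)) : probability (measurableTypeR R) R).

Section gaussmaps.
Variables (R : realType) (L : nat).
Notation C := R[i].
Notation Re := complex.Re.
Notation Im := complex.Im.
Notation I := (nat * 'I_L * bool)%type.
Notation Om := (rvec R I).
Implicit Types (w : Om) (k : nat) (q : nat * 'I_L).

(* The coordinate [((k, a), b)] is the real ([b = false]) or imaginary part of the entry at antenna [a] of vector [k]; vector [0] is the desired channel, vector [k.+1] the k-th interferer. *)
Definition cz (w : I -> R) q : C := (w (q, false) +i* w (q, true))%C.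
Definition vec (w : I -> R) k : 'cV[C]_L := \col_j cz w (k, j).

Lemma cmeas_cz q : cmeas (fun w : Om => cz w q).
Proof. by apply: cmeas_complex; exact: measurable_coord. Qed.

Lemma mmeas_vec k : mmeas (fun w : Om => vec w k).
Proof. by move=> i j; apply: cmeas_ext (cmeas_cz (k, i)) => w; rewrite mxE. Qed.

Variable nu : probability Om R.
Hypothesis nuI : iid (hgauss R) nu.

Lemma pres_hrot (i j : I) (c s : R) : i != j -> c ^+ 2 + s ^+ 2 = 1 -> pres nu (rot i j c s).
Proof. by move=> ij cs; apply: (pres_rot nuI ij) => E mE; exact: hg_rot. Qed.

(** Multiplying one entry by a unit complex number rotates its real and imaginary parts. *)
Lemma phase_ex q (e : C) : normsq e = 1 -> exists Phi, pres nu Phi /\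
  forall w q', cz (Phi w) q' = if q' == q then e * cz w q else cz w q'.
Proof.
move=> e1; exists (rot (q, false) (q, true) (Re e) (Im e)); split.
  by apply: pres_hrot => //; rewrite xpair_eqE andbF.
move=> w q'; rewrite /cz /rot !xpair_eqE !andbT !andbF /=.
case: (q' == q) => //; case: e e1 => a b _ /=.
by apply/eqP; rewrite eq_complex /= eqxx /= addrC eqxx.
Qed.

(** The same plane rotation acts on the two real parts and on the two imaginary parts. *)
Lemma realrot_ex q1 q2 (c s : R) : q1 != q2 -> c ^+ 2 + s ^+ 2 = 1 -> exists Phi, pres nu Phi /\
  forall w q, cz (Phi w) q = if q == q1 then c%:C%C * cz w q1 - s%:C%C * cz w q2
    else if q == q2 then s%:C%C * cz w q1 + c%:C%C * cz w q2 else cz w q.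
Proof.
move=> q12 cs; exists (rot (q1, false) (q2, false) c s \o rot (q1, true) (q2, true) c s); split.
  by apply: pres_comp; apply: pres_hrot => //; rewrite xpair_eqE andbT.
move=> w q; rewrite /cz /rot /= !xpair_eqE !andbT !andbF /=.
case: eqP => _; first by apply/eqP; rewrite eq_complex /=; apply/andP; split; apply/eqP; ring.
by case: eqP => _ //; apply/eqP; rewrite eq_complex /=; apply/andP; split; apply/eqP; ring.
Qed.

Lemma normsqM (a b : C) : normsq (a * b) = normsq a * normsq b.
Proof. by case: a b => a b [u v]; rewrite /normsq /=; ring. Qed.

Lemma normsqN (a : C) : normsq (- a) = normsq a.
Proof. by case: a => a b; rewrite /normsq /=; ring. Qed.

Lemma cjM (a b : C) : conjc (a * b) = conjc a * conjc b.
Proof. exact: rmorphM. Qed.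

Lemma cjN (a : C) : conjc (- a) = - conjc a.
Proof. exact: rmorphN. Qed.

Lemma normsq_real (r : R) : normsq r%:C%C = r ^+ 2.
Proof. by rewrite /normsq /= expr0n addr0. Qed.

Lemma polar_ex (u : C) : exists r e, u = r%:C%C * e /\ normsq e = 1.
Proof.
have [->|u0] := eqVneq u 0.
  by exists 0, 1; split; rewrite ?mul0r//; rewrite /normsq /= expr1n expr0n addr0.
have n0 : 0 < normsq u by rewrite lt_neqAle normsq_ge0 andbT eq_sym normsq_eq0.
have s0 : Num.sqrt (normsq u) != 0 by rewrite gt_eqF// sqrtr_gt0.
exists (Num.sqrt (normsq u)), ((Num.sqrt (normsq u))^-1%:C%C * u); split.
  by rewrite mulrA -(rmorphM (real_complex R)) /= mulfV// mul1r.
by rewrite normsqM normsq_real exprVn sqr_sqrtr ?ltW// mulVf// gt_eqF.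
Qed.

(** Factorisation of SU(2): with [u1 = r1 e1] and [u2 = r2 e2], the matrix is diag(e1, e2) times the
    real rotation of cosine [r1] and sine [r2] times diag(1, conj(e1 e2)). *)
Lemma givens_ex q1 q2 (u1 u2 : C) : q1 != q2 -> normsq u1 + normsq u2 = 1 ->
  exists Phi, pres nu Phi /\
  forall w q, cz (Phi w) q = if q == q1 then u1 * cz w q1 - conjc u2 * cz w q2
    else if q == q2 then u2 * cz w q1 + conjc u1 * cz w q2 else cz w q.
Proof.
move=> q12; have [r1 [e1 [-> e11]]] := polar_ex u1; have [r2 [e2 [-> e21]]] := polar_ex u2.
rewrite !normsqM !normsq_real e11 e21 !mulr1 => rr.
have ce1 : e1 * conjc e1 = 1 by rewrite -normsqE e11.
have ce2 : e2 * conjc e2 = 1 by rewrite -normsqE e21.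
have [P1 [pP1 P1E]] := phase_ex q1 e11.
have [P2 [pP2 P2E]] := phase_ex q2 e21.
have e31 : normsq (conjc (e1 * e2)) = 1 by rewrite normsqJ normsqM e11 e21 mulr1.
have [P3 [pP3 P3E]] := phase_ex q2 e31.
have [Q [pQ QE]] := realrot_ex q12 rr.
exists (P1 \o P2 \o Q \o P3); split; first by do 3 apply: pres_comp => //.
move=> w q /=; rewrite P1E !P2E !QE !P3E !eqxx (negbTE q12) (eq_sym q2) (negbTE q12).
have [_|qq1] := eqVneq q q1.
  rewrite !cjM !conjc_real mulrBr; congr (_ - _); first by rewrite mulrCA mulrA.
  transitivity (r2%:C%C * (e1 * conjc e1) * conjc e2 * cz w q2); first by ring.
  by rewrite ce1 mulr1.
have [_|qq2] := eqVneq q q2; last by [].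
rewrite !cjM !conjc_real mulrDr; congr (_ + _); first by rewrite mulrCA mulrA.
transitivity (r1%:C%C * (e2 * conjc e2) * conjc e1 * cz w q2); first by ring.
by rewrite ce2 mulr1.
Qed.

(** Two vectors are mixed by a Givens rotation of their entries at each antenna in turn. *)
Lemma mixcol_ex k1 k2 (u1 u2 : C) : k1 != k2 -> normsq u1 + normsq u2 = 1 ->
  exists Phi, pres nu Phi /\
  forall w k, vec (Phi w) k = if k == k1 then u1 *: vec w k1 - conjc u2 *: vec w k2
    else if k == k2 then u2 *: vec w k1 + conjc u1 *: vec w k2 else vec w k.
Proof.
move=> k12 uu.
have H (s : seq 'I_L) : uniq s -> exists Phi, pres nu Phi /\
  forall w k j, cz (Phi w) (k, j) = if j \in s then
    (if k == k1 then u1 * cz w (k1, j) - conjc u2 * cz w (k2, j)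
    else if k == k2 then u2 * cz w (k1, j) + conjc u1 * cz w (k2, j) else cz w (k, j)) else cz w (k, j).
  elim: s => [_|j0 s IH /= /andP[j0s us]].
    by exists idfun; split => //; split => //; exact: measurable_id.
  have [Phi [pPhi PhiE]] := IH us.
  have kj : (k1, j0) != (k2, j0) by rewrite xpair_eqE eqxx andbT.
  have [G [pG GE]] := givens_ex kj uu.
    exists (G \o Phi); split; first exact: pres_comp.
    move=> w k j /=; rewrite GE !PhiE (negbTE j0s) !xpair_eqE inE.
    have [->|jj0] := eqVneq j j0; first by rewrite !andbT (negbTE j0s).
    by rewrite !andbF.
have [Phi [pPhi PhiE]] := H _ (enum_uniq 'I_L).
exists Phi; split => // w k; apply/matrixP => i j; rewrite mxE PhiE mem_enum.
by case: eqP => [_|_]; [rewrite !mxE|case: eqP => _; rewrite !mxE].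
Qed.

(** The transposed situation: two antennas are mixed, in the same way for every vector listed in
    [K]. *)
Lemma antgiv_ex (i j : 'I_L) (u1 u2 : C) (K : seq nat) : i != j -> normsq u1 + normsq u2 = 1 ->
  uniq K -> exists Phi, pres nu Phi /\
  forall w k a, cz (Phi w) (k, a) = if k \in K then
    (if a == i then u1 * cz w (k, i) - conjc u2 * cz w (k, j)
    else if a == j then u2 * cz w (k, i) + conjc u1 * cz w (k, j) else cz w (k, a)) else cz w (k, a).
Proof.
move=> ij uu; elim: K => [_|k0 s IH /= /andP[k0s us]].
  by exists idfun; split => //; split => //; exact: measurable_id.
have [Phi [pPhi PhiE]] := IH us.
have kj : (k0, i) != (k0, j) by rewrite xpair_eqE eqxx.
have [G [pG GE]] := givens_ex kj uu.
  exists (G \o Phi); split; first exact: pres_comp.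
  move=> w k a /=; rewrite GE !PhiE (negbTE k0s) !xpair_eqE inE.
  have [->|kk0] := eqVneq k k0; first by rewrite /= (negbTE k0s).
  by [].
Qed.

(* Unitary matrices that may be applied to any finite set of the vectors at once. All unitary matrices qualify; products of Givens rotations are enough here. *)
Definition law_preserving (U : 'M[C]_L) := ctrans U *m U = 1%:M /\
  forall K : seq nat, uniq K -> exists Phi, pres nu Phi /\
    forall w k, vec (Phi w) k = if k \in K then U *m vec w k else vec w k.

Lemma law_preserving1 : law_preserving 1%:M.
Proof.
split; first by rewrite mulmx1 -(rmorph1 (real_complex R)) ctrans_scalar conjc_real.
move=> K uK; exists idfun; split; last by move=> w k; rewrite mul1mx; case: ifP.
by split => //; exact: measurable_id.
Qed.

Lemma law_preservingM U V : law_preserving U -> law_preserving V -> law_preserving (U *m V).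
Proof.
move=> [UU gU] [VV gV]; split.
  by rewrite ctransM -mulmxA (mulmxA _ U) UU mul1mx.
move=> K uK; have [P [pP PE]] := gU K uK; have [Q [pQ QE]] := gV K uK.
exists (P \o Q); split; first exact: pres_comp.
by move=> w k /=; rewrite PE !QE; case: (k \in K); rewrite ?mulmxA.
Qed.

Definition givmx (i j : 'I_L) (u1 u2 : C) : 'M[C]_L := \matrix_(a, b)
  if a == i then (if b == i then u1 else if b == j then - conjc u2 else 0)
  else if a == j then (if b == i then u2 else if b == j then conjc u1 else 0)
  else (a == b)%:R.

Lemma givmxE i j u1 u2 (v : 'cV[C]_L) a : i != j -> (givmx i j u1 u2 *m v) a 0 =
  if a == i then u1 * v i 0 - conjc u2 * v j 0
  else if a == j then u2 * v i 0 + conjc u1 * v j 0 else v a 0.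
Proof.
move=> ij; rewrite mxE.
have H (x y : C) : \sum_b (if b == i then x else if b == j then y else 0) * v b 0 = x * v i 0 + y * v j 0.
  have ji : j != i by rewrite eq_sym.
  rewrite (bigD1 i)//= eqxx (bigD1 j)//= (negbTE ji) eqxx big1 ?addr0//.
  by move=> b /andP[/negbTE -> /negbTE ->]; rewrite mul0r.
under eq_bigr do rewrite mxE.
case: eqP => _; first by rewrite H mulNr.
case: eqP => _; first by rewrite H.
rewrite (bigD1 a)//= eqxx mul1r big1 ?addr0// => b; rewrite eq_sym => /negbTE ->.
by rewrite mul0r.
Qed.

Lemma law_preserving_givmx i j u1 u2 : i != j -> normsq u1 + normsq u2 = 1 -> law_preserving (givmx i j u1 u2).
Proof.
move=> ij uu.
have uuC : u1 * conjc u1 + u2 * conjc u2 = 1 by rewrite -!normsqE -rmorphD uu.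
split.
  (* The adjoint is a Givens matrix again, so [givmxE] computes the product column by column. *)
  have -> : ctrans (givmx i j u1 u2) = givmx i j (conjc u1) (- u2).
    have ji : (j == i) = false by rewrite eq_sym (negbTE ij).
    apply/matrixP => a b; rewrite !mxE cjN opprK.
    case: (eqVneq a i) => [ai|ai]; case: (eqVneq a j) => [aj|aj];
    case: (eqVneq b i) => [bi|bi]; case: (eqVneq b j) => [bj|bj];
    rewrite ?cjN ?conjcK ?conjc0 //; do ?[by move: ij; rewrite -ai -aj eqxx];
    do ?[by move: ij; rewrite -bi -bj eqxx]; do ?[by rewrite ai (negbTE bi) conjc0];
    do ?[by rewrite aj (negbTE bj) conjc0]; do ?[by rewrite bi (negbTE ai)];
    do ?[by rewrite bj (negbTE aj)].
    by rewrite eq_sym conjc_nat.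
  apply/matrixP => a b.
  have -> : (givmx i j (conjc u1) (- u2) *m givmx i j u1 u2) a b =
      (givmx i j (conjc u1) (- u2) *m col b (givmx i j u1 u2)) a 0.
    by rewrite [LHS]mxE [RHS]mxE; apply: eq_bigr => k _; congr (_ * _); rewrite [RHS]mxE.
  have colE c : col b (givmx i j u1 u2) c 0 = (givmx i j u1 u2 *m (delta_mx b 0 : 'cV[C]_L)) c 0.
    by rewrite -colE.
  rewrite givmxE// !colE !givmxE// eqxx (eq_sym j) (negbTE ij) eqxx cjN conjcK.
  set ei := (delta_mx b 0 : 'cV[C]_L) i 0; set ej := (delta_mx b 0 : 'cV[C]_L) j 0.
  have -> : (1%:M : 'M[C]_L) a b = (delta_mx b 0 : 'cV[C]_L) a 0.
    by rewrite !mxE eqxx andbT.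
  have [->|ai] := eqVneq a i.
    transitivity ((u1 * conjc u1 + u2 * conjc u2) * ei); first by ring.
    by rewrite uuC mul1r.
  have [->|aj] := eqVneq a j.
    transitivity ((u1 * conjc u1 + u2 * conjc u2) * ej); first by ring.
    by rewrite uuC mul1r.
  by [].
move=> K uK; have [P [pP PE]] := antgiv_ex ij uu uK.
exists P; split => // w k; apply/matrixP => a b; rewrite !ord1 mxE PE.
by case: ifP => _; [rewrite givmxE// !mxE|rewrite mxE].
Qed.

End gaussmaps.

Section elim.
Variables (R : realType) (m : nat).
Notation C := R[i].
Variable nu : probability (rvec R (nat * 'I_m.+1 * bool)%type) R.
Hypothesis nuI : iid (hgauss R) nu.

(** Elimination by Givens rotations in the planes of [ord0] and [a0]: each one gathers the entry at
    [a0] into position [ord0] and leaves the entries already cancelled at zero. *)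
Lemma elim_ex (c : 'cV[C]_m.+1) : exists U, law_preserving nu U /\ forall a, a != ord0 -> (U *m c) a 0 = 0.
Proof.
have H (s : seq 'I_m.+1) : all (fun a => a != ord0) s ->
    exists U, law_preserving nu U /\ forall a, a \in s -> (U *m c) a 0 = 0.
  elim: s => [_|a0 s IH /= /andP[a00 s0]].
    by exists 1%:M; split => //; exact: law_preserving1.
  have [U [gU UE]] := IH s0.
  set y := U *m c in UE *.
  have [ya|ya] := eqVneq (y a0 0) 0.
    by exists U; split => // a; rewrite inE => /orP[/eqP ->|/UE].
  have N0 : 0 < normsq (y ord0 0) + normsq (y a0 0).
    by rewrite ltr_wpDl ?normsq_ge0// lt_neqAle normsq_ge0 andbT eq_sym normsq_eq0.
  pose N := Num.sqrt (normsq (y ord0 0) + normsq (y a0 0)).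
  have NE : N ^+ 2 = normsq (y ord0 0) + normsq (y a0 0) by rewrite sqr_sqrtr// ltW.
  (* Chosen so that [u2 * y ord0 0 + conjc u1 * y a0 0] vanishes. *)
  pose u1 := N^-1%:C%C * conjc (y ord0 0); pose u2 := - (N^-1%:C%C * y a0 0).
  have uu : normsq u1 + normsq u2 = 1.
    rewrite /u1 /u2 normsqN !normsqM normsqJ normsq_real.
    by rewrite -mulrDr exprVn NE mulVf// gt_eqF.
  have a00' : ord0 != a0 by rewrite eq_sym.
  exists (givmx ord0 a0 u1 u2 *m U); split.
    by apply: law_preservingM => //; apply: law_preserving_givmx.
  move=> a; rewrite inE -mulmxA -/y => aS; rewrite givmxE//.
  have [aE|aa0] := eqVneq a a0.
    rewrite aE (negbTE a00) /u1 /u2 cjM conjc_real conjcK; ring.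
  have as_ : a \in s by move: aS; rewrite (negbTE aa0).
  by rewrite (negbTE (allP s0 _ as_)) UE.
have [|U [gU UE]] := H [seq a <- enum 'I_m.+1 | a != ord0].
  by apply/allP => a; rewrite mem_filter => /andP[].
by exists U; split => // a a0; apply: UE; rewrite mem_filter a0 mem_enum.
Qed.

End elim.

(** * Squared moduli of Gaussian entries *)

Section twoexp.
Variables (R : realType) (L : nat).
Notation C := R[i].
Notation Re := complex.Re.
Notation Im := complex.Im.
Notation I := (nat * 'I_L * bool)%type.
Notation Om := (rvec R I).
Notation mu := (@lebesgue_measure R).
Variable nu : probability Om R.
Hypothesis nuI : iid (hgauss R) nu.
Implicit Types (q : nat * 'I_L).

Definition nsq (w : I -> R) q : R := normsq (cz w q).

Lemma cz_mix (P : pred (nat * 'I_L)) (w w' : Om) q :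
  cz (mix (fun i => P i.1) w w') q = if P q then cz w q else cz w' q.
Proof. by rewrite /cz /mix /=; case: (P q). Qed.

Lemma nsq_mix (P : pred (nat * 'I_L)) (w w' : Om) q :
  nsq (mix (fun i => P i.1) w w') q = if P q then nsq w q else nsq w' q.
Proof. by rewrite /nsq cz_mix; case: (P q). Qed.

Lemma nsq_ge0 w q : 0 <= nsq w q. Proof. exact: normsq_ge0. Qed.

Lemma measurable_nsq q : measurable_fun setT (fun w : Om => nsq w q).
Proof. by apply: measurable_normsq; exact: cmeas_cz. Qed.

Lemma nsq_int q (h : R -> \bar R) : measurable_fun setT h -> (forall x, 0 <= h x)%E ->
  (\int[nu]_w h (nsq w q) = \int[mu]_(r in `[0%R, +oo[) (h r * (expR (- r))%:E))%E.
Proof.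
move=> mh h0.
have q01 : (q, false) != (q, true) by rewrite xpair_eqE andbF.
have mf : measurable_fun setT (fun x : R * R => h (x.1 ^+ 2 + x.2 ^+ 2)).
  by apply: measurableT_comp => //; exact: measurable_sqnorm.
apply: (etrans (iid_pair_int nuI q01 mf (fun=> h0 _))).
exact: hg_radial.
Qed.

(* [nsq w q] is a standard exponential variable. *)
Lemma nsq_tail q x : 0 <= x -> nu [set w | x < nsq w q] = (expR (- x))%:E.
Proof.
move=> x0.
have mB : measurable (`]x, +oo[%classic : set R) by [].
have -> : [set w : Om | x < nsq w q] = (fun w => nsq w q) @^-1` `]x, +oo[%classic.
  by apply/seteqP; split => w /=; rewrite in_itv/= andbT.
have mE : measurable ((fun w : Om => nsq w q) @^-1` `]x, +oo[%classic).
  by rewrite -[X in measurable X]setTI; apply: measurable_nsq.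
transitivity (\int[nu]_w (\1_(`]x, +oo[%classic) (nsq w q) : R)%:E)%E.
  by rewrite -[X in nu X]setIT -integral_indic.
rewrite (@nsq_int q (fun r => (\1_(`]x, +oo[%classic) r : R)%:E)); last 2 first.
- exact/measurable_EFinP/measurable_indic.
- by move=> r; rewrite lee_fin.
transitivity (\int[mu]_(r in setT) ((\1_(`]0, +oo[%classic) (1 * r + - x) * expR (- (1 * r + - x)) : R)%:E * (expR (- x))%:E))%E.
  rewrite integral_mkcond; apply: eq_integral => r _; rewrite patchE !indicE mul1r.
  have -> : (r - x \in `]0, +oo[%classic) = (x < r) by rewrite mem_setE in_itv/= andbT subr_gt0.
  have -> : (r \in `]x, +oo[%classic) = (x < r) by rewrite mem_setE in_itv/= andbT.
  have -> : (r \in `[0, +oo[%classic) = (0 <= r) by rewrite mem_setE in_itv/= andbT.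
  case: (ltP x r) => xr; last by rewrite mul0r mul0e; case: ifP => // _; rewrite mul0e.
  rewrite (le_trans x0 (ltW xr)) mul1r mul1e -EFinM -expRD; congr (expR _)%:E; ring.
have mG : measurable_fun setT (fun r : R => (\1_(`]0, +oo[%classic) r * expR (- r) : R)%:E).
  apply/measurable_EFinP; apply: measurable_funM; first exact: measurable_indic.
  exact: measurableT_comp.
have := @lebesgue_affine R 1 (- x) (fun r => (\1_(`]0, +oo[%classic) r * expR (- r) : R)%:E * (expR (- x))%:E)%E.
rewrite oner_eq0 /= => ->//; last by apply: emeasurable_funM.
rewrite normr1 invr1 mul1e ge0_integralZr//.
rewrite [X in (X * _)%E](_ : _ = 1%E) ?mul1e// -(@integral_exponential_pdf R 1 ltr01).
have -> : (\int[mu]_x (exponential_pdf 1 x)%:E = \int[mu]_(x in `]0%R, +oo[) (expR (- x))%:E)%E.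
  transitivity (\int[mu]_(x in `[0%R, +oo[) (expR (- x))%:E)%E.
    rewrite [RHS]integral_mkcond; apply: eq_integral => r _; rewrite /exponential_pdf !patchE.
    by case: ifP => //; rewrite mul1r mulN1r.
  by rewrite integral_itv_obnd_cbnd//; apply/measurable_funTS/measurable_EFinP; exact: measurableT_comp.
rewrite [RHS]integral_mkcond; apply: eq_integral => r _; rewrite patchE indicE.
by case: ifP => _; rewrite ?mul1r ?mul0r.
Qed.

Lemma nsq_laplace q k : 0 <= k -> (\int[nu]_w (expR (- (k * nsq w q)))%:E = ((1 + k)^-1)%:E)%E.
Proof.
move=> k0.
have k1 : 0 < 1 + k by rewrite ltr_wpDr.
have mE a : measurable_fun setT (fun r : R => (expR (- (a * r)))%:E).
  apply/measurable_EFinP; apply: measurableT_comp => //; apply: measurableT_comp => //.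
rewrite (@nsq_int q (fun r => (expR (- (k * r)))%:E))//.
transitivity (\int[mu]_x (((1 + k)^-1)%:E * (exponential_pdf (1 + k) x)%:E))%E.
  rewrite integral_mkcond; apply: eq_integral => r _; rewrite /exponential_pdf !patchE.
  case: ifP => _; last by rewrite mule0.
  rewrite -!EFinM mulrA mulVf ?gt_eqF// mul1r -expRD; congr (expR _)%:E; ring.
rewrite ge0_integralZl_EFin//.
- by rewrite integral_exponential_pdf// mule1.
- by move=> x _; rewrite lee_fin exponential_pdf_ge0// ltW.
- by apply/measurable_EFinP; exact: measurable_exponential_pdf.
- by rewrite invr_ge0 ltW.
Qed.

Lemma nsq0_null q : nu [set w | nsq w q = 0] = 0%E.
Proof.
have -> : [set w : Om | nsq w q = 0] = ~` [set w | 0 < nsq w q].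
  apply/seteqP; split => w /=; first by move=> ->; rewrite ltxx.
  by move/negP; rewrite -leNgt => h; apply/eqP; rewrite eq_le h nsq_ge0.
have mE : measurable [set w : Om | 0 < nsq w q].
  have -> : [set w : Om | 0 < nsq w q] = (fun w => nsq w q) @^-1` `]0, +oo[%classic.
    by apply/seteqP; split => w /=; rewrite in_itv/= andbT.
  by rewrite -[X in measurable X]setTI; apply: measurable_nsq.
by rewrite probability_setC// nsq_tail// oppr0 expR0 subee.
Qed.

Lemma measurable_ltf d (T : measurableType d) (f g : T -> R) : measurable_fun setT f -> measurable_fun setT g ->
  measurable [set w | f w < g w].
Proof.
move=> mf mg; have h := measurable_fun_ltr mf mg.
by rewrite -[X in measurable X]setTI; exact: (h measurableT [set true]). Qed.

(** Freezing the second variable leaves an exponential tail, whose mean is a Laplace transform. In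
    other words, the share of one of two independent exponentials in their sum is uniform. *)
Lemma nsq_ratio q1 q2 a b : q1 != q2 -> 0 < a -> 0 <= b ->
  nu [set w | b * nsq w q2 < a * nsq w q1] = (a / (a + b))%:E.
Proof.
move=> q12 a0 b0.
pose J : pred I := fun i => pred1 q2 i.1.
have mE : measurable [set w : Om | b * nsq w q2 < a * nsq w q1].
  by apply: measurable_ltf; apply: measurable_funM => //; exact: measurable_nsq.
rewrite (iid_mix nuI J mE).
transitivity (\int[nu]_w (expR (- ((b / a) * nsq w q2)))%:E)%E.
  apply: eq_integral => w _; rewrite -(@nsq_tail q1); last first.
    by rewrite mulr_ge0 ?nsq_ge0// divr_ge0// ltW.
  congr (nu _); apply/seteqP; split => w' /=; rewrite !nsq_mix /= eqxx (negbTE q12).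
    by rewrite mulrAC ltr_pdivrMr// [nsq _ _ * a]mulrC.
  by rewrite mulrAC ltr_pdivrMr// [nsq _ _ * a]mulrC.
rewrite nsq_laplace ?divr_ge0 ?(ltW a0)//; congr EFin; field.
by rewrite !gt_eqF// ltr_wpDr.
Qed.

End twoexp.

(** * Mixing two vectors *)

Section fform.
Variable R : realType.
Notation C := R[i].
Notation Re := complex.Re.
Notation Im := complex.Im.

(** The Hermitian form with diagonal [a], [b] and off-diagonal entry [z]. For the Gram entries of
    [x] and [c] it is the form of [w1 *: x + w2 *: c], see [gram_mix]. *)
Definition fform (a b : R) (z w1 w2 : C) : R :=
  a * normsq w1 + b * normsq w2 + 2 * Re (conjc w1 * w2 * z).

Lemma fformZ a b z (c : R) w1 w2 : fform a b z (c%:C%C * w1) (c%:C%C * w2) = c ^+ 2 * fform a b z w1 w2.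
Proof.
by case: z w1 w2 => x y [p q] [s t]; rewrite /fform /normsq /=; ring.
Qed.

Lemma normsq_mix2 (u1 u2 w1 w2 : C) : normsq u1 + normsq u2 = 1 ->
  normsq (u1 * w1 - conjc u2 * w2) + normsq (u2 * w1 + conjc u1 * w2) = normsq w1 + normsq w2.
Proof.
move=> uu; rewrite -[RHS]mul1r -uu.
by case: u1 u2 w1 w2 {uu} => x y [x' y'] [p q] [s t]; rewrite /normsq /=; ring.
Qed.

Lemma diag2_aux (a k : R) (z w1 w2 : C) : k != 0 ->
  fform a (k + a - normsq z / k) z (z * w1 - k%:C%C * w2) (k%:C%C * w1 + conjc z * w2) =
  (normsq z + k ^+ 2) * ((a + k) * normsq w1 + (k + a - normsq z / k - k) * normsq w2).
Proof.
by move=> k0; case: z w1 w2 => x y [p q] [s t]; rewrite /fform /normsq /=; field.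
Qed.

(** The eigenvalues are [a + k] and [b - k], where [k] is the larger root of
    [k (k + a - b) = normsq z], and [(z, k)] is an eigenvector for the first. The case [z = 0] is
    apart because this vector may then vanish. *)
Lemma diag2 a b z : exists u1 u2 g1 g2, [/\ normsq u1 + normsq u2 = 1, g2 <= g1,
  g1 + g2 = a + b, g1 * g2 = a * b - normsq z &
  forall w1 w2, fform a b z (u1 * w1 - conjc u2 * w2) (u2 * w1 + conjc u1 * w2) =
    g1 * normsq w1 + g2 * normsq w2].
Proof.
have [z0|z0] := eqVneq z 0.
  have [ba|ab] := leP b a.
    exists 1, 0, a, b; split => //.
    - by rewrite /normsq /=; ring.
    - by rewrite z0 /normsq /=; ring.
    - by move=> [p q] [s t]; rewrite z0 /fform /normsq /=; ring.
  exists 0, 1, b, a; split => //.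
  - by rewrite /normsq /=; ring.
  - exact: ltW.
  - by rewrite addrC.
  - by rewrite z0 /normsq /=; ring.
  - by move=> [p q] [s t]; rewrite z0 /fform /normsq /=; ring.
have n0 : 0 < normsq z by rewrite lt_neqAle normsq_ge0 andbT eq_sym normsq_eq0.
pose r := Num.sqrt ((a - b) ^+ 2 + 4 * normsq z).
have r2 : r ^+ 2 = (a - b) ^+ 2 + 4 * normsq z by rewrite sqr_sqrtr// addr_ge0 ?sqr_ge0// mulr_ge0// normsq_ge0.
have r0 : 0 <= r by exact: sqrtr_ge0.
pose k := (b - a + r) / 2.
have kE : normsq z = k * (k + a - b) by rewrite /k; lra.
have k0 : k != 0 by apply/eqP => k0; move: n0; rewrite kE k0 mul0r ltxx.
pose N2 := normsq z + k ^+ 2.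
have N20 : 0 < N2 by rewrite ltr_wpDr// sqr_ge0.
pose c := (Num.sqrt N2)^-1.
have c2 : c ^+ 2 = N2^-1 by rewrite exprVn sqr_sqrtr// ltW.
exists (c%:C%C * z), (c * k)%:C%C, (a + k), (b - k); split.
- by rewrite normsqM !normsq_real exprMn -mulrDr c2 mulVf// gt_eqF.
- by rewrite /k; lra.
- by ring.
- by rewrite kE; ring.
- move=> w1 w2; rewrite cjM !conjc_real.
  have -> : c%:C%C * z * w1 - (c * k)%:C%C * w2 = c%:C%C * (z * w1 - k%:C%C * w2).
    by rewrite rmorphM /=; ring.
  have -> : (c * k)%:C%C * w1 + c%:C%C * conjc z * w2 = c%:C%C * (k%:C%C * w1 + conjc z * w2).
    by rewrite rmorphM /=; ring.
  rewrite fformZ c2; apply: (@mulfI _ N2); first by rewrite gt_eqF.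
  rewrite mulrA mulfV ?gt_eqF// mul1r /N2.
  have -> : b = k + a - normsq z / k by rewrite kE; field.
  exact: diag2_aux.
Qed.

End fform.

Section form_law.
Variables (R : realType) (L : nat).
Notation C := R[i].
Notation Re := complex.Re.
Notation I := (nat * 'I_L * bool)%type.
Notation Om := (rvec R I).
Variable nu : probability Om R.
Hypothesis nuI : iid (hgauss R) nu.
Variables (q1 q2 : nat * 'I_L).
Hypothesis q12 : q1 != q2.

(** Tail at [s] of the form at a uniform unit vector of C^2, realised as a normalised Gaussian
    vector; multiplying by the squared norm avoids the division. *)
Definition form_law a b z s := nu [set w | s * (nsq w q1 + nsq w q2) < fform a b z (cz w q1) (cz w q2)].

Lemma measurable_fform d (T : measurableType d) (a b : T -> R) (z w1 w2 : T -> C) :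
  measurable_fun setT a -> measurable_fun setT b -> cmeas z -> cmeas w1 -> cmeas w2 ->
  measurable_fun setT (fun w => fform (a w) (b w) (z w) (w1 w) (w2 w)).
Proof.
move=> ma mb mz m1 m2; rewrite /fform.
apply: measurable_funD; first apply: measurable_funD.
- by apply: measurable_funM => //; exact: measurable_normsq.
- by apply: measurable_funM => //; exact: measurable_normsq.
- apply: measurable_funM => //.
  by have [] := cmeasM (cmeasM (cmeasJ m1) m2) mz.
Qed.

(* [form_law] for a form diagonalised with eigenvalues [g2 <= g1]: the form divided by the squared norm is uniform on [[g2, g1]], hence piecewise linear tails. *)
Definition diag_law g1 g2 s := nu [set w | s * (nsq w q1 + nsq w q2) < g1 * nsq w q1 + g2 * nsq w q2].

Lemma measurable_diag_law g1 g2 s :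
  measurable [set w : Om | s * (nsq w q1 + nsq w q2) < g1 * nsq w q1 + g2 * nsq w q2].
Proof.
have m1 := @measurable_nsq R L q1; have m2 := @measurable_nsq R L q2.
apply: measurable_ltf; first by apply: measurable_funM => //; exact: measurable_funD.
by apply: measurable_funD; exact: measurable_funM.
Qed.

(** The law of the two Gaussian entries is invariant under the unitary matrix that diagonalises the
    form. *)
Lemma form_law_diag a b z : exists g1 g2, [/\ g2 <= g1, g1 + g2 = a + b, g1 * g2 = a * b - normsq z &
  forall s, form_law a b z s = diag_law g1 g2 s].
Proof.
have [u1 [u2 [g1 [g2 [uu g21 gs gp gE]]]]] := diag2 a b z.
exists g1, g2; split => // s.
have [Phi [[mPhi pPhi] PhiE]] := givens_ex nuI q12 uu.
have mE : measurable [set w : Om | s * (nsq w q1 + nsq w q2) < fform a b z (cz w q1) (cz w q2)].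
  apply: measurable_ltf.
    apply: measurable_funM => //; apply: measurable_funD; exact: measurable_nsq.
  apply: (@measurable_fform _ Om (fun=> a) (fun=> b) (fun=> z) (fun w : Om => cz w q1) (fun w : Om => cz w q2));
    [exact: measurable_cst|exact: measurable_cst|exact: cmeas_cst|exact: cmeas_cz|exact: cmeas_cz].
rewrite /form_law -(pPhi _ mE); congr (nu _); apply/seteqP; split => w /=;
  by rewrite /nsq !PhiE !eqxx (eq_sym q2) (negbTE q12) gE normsq_mix2.
Qed.

Lemma diag_law_eq0 g1 g2 s : g2 <= g1 -> g1 <= s -> diag_law g1 g2 s = 0%E.
Proof.
move=> g21 gs; rewrite /diag_law (_ : [set w | _] = set0) ?measure0//.
apply/seteqP; split => w //=; apply/negP; rewrite -leNgt.
have := nsq_ge0 w q1; have := nsq_ge0 w q2; nra.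
Qed.

Lemma diag_law_mid g1 g2 s : g2 <= s -> s < g1 -> diag_law g1 g2 s = ((g1 - s) / (g1 - g2))%:E.
Proof.
move=> gs sg; have a0 : 0 < g1 - s by rewrite subr_gt0.
have b0 : 0 <= s - g2 by rewrite subr_ge0.
have -> : g1 - g2 = (g1 - s) + (s - g2) by ring.
rewrite -(nsq_ratio nuI q12 a0 b0); congr (nu _); apply/seteqP; split => w /=; lra.
Qed.

Lemma diag_law_eq1 g1 g2 s : g2 <= g1 -> s < g2 -> diag_law g1 g2 s = 1%E.
Proof.
move=> g21 sg; apply/eqP; rewrite eq_le probability_le1 ?measurable_diag_law//=.
rewrite -[leLHS](_ : nu [set w | 0 < nsq w q1] = 1%E); last by rewrite nsq_tail// oppr0 expR0.
apply: le_measure; rewrite ?inE.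
- by apply: measurable_ltf => //; exact: measurable_nsq.
- exact: measurable_diag_law.
- move=> w /= w0; have := nsq_ge0 w q2; nra.
- exact: measurable_diag_law.
Qed.

(** With [st] the threshold on the left and [s0] the last one, [(g + t) st = t g + g s0], so the
    identity holds wherever the tail is affine. Moreover [s0 - g2 = g1 (g - g2) / g] and
    [g1 - s0 = g2 (g1 - g) / g]: the threshold [s0] lies on the same side of each eigenvalue as [g],
    and so does [st], which is between them. *)
Lemma diag_law_lin g1 g2 g t : 0 <= g2 -> g2 <= g1 -> 0 < g -> 0 < t ->
  ((g + t)%:E * diag_law g1 g2 ((g * t + g * (g1 + g2) - g1 * g2) / (g + t)) =
   t%:E * diag_law g1 g2 g + g%:E * diag_law g1 g2 ((g * (g1 + g2) - g1 * g2) / g))%E.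
Proof.
move=> g20 g21 g0 t0; have gt0 : 0 < g + t by rewrite addr_gt0.
set st := _ / (g + t); set s0 := _ / g.
have stE : st * (g + t) = g * t + g * (g1 + g2) - g1 * g2 by rewrite divfK// gt_eqF.
have s0E : s0 * g = g * (g1 + g2) - g1 * g2 by rewrite divfK// gt_eqF.
have [gg1|gg1] := leP g1 g.
  have h0 : g1 <= s0 by rewrite -(ler_pM2r g0) s0E; nra.
  have ht : g1 <= st by rewrite -(ler_pM2r gt0) stE; nra.
  by rewrite !diag_law_eq0// !mule0 adde0.
have [gg2|gg2] := ltP g g2.
  have h0 : s0 < g2 by rewrite -(ltr_pM2r g0) s0E; nra.
  have ht : st < g2 by rewrite -(ltr_pM2r gt0) stE; nra.
  by rewrite !diag_law_eq1// !mule1 addrC.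
have hm s : g2 <= s -> s <= g1 -> diag_law g1 g2 s = ((g1 - s) / (g1 - g2))%:E.
  move=> h1; rewrite le_eqVlt => /orP[/eqP ->|h2]; last exact: diag_law_mid.
  by rewrite diag_law_eq0// subrr mul0r.
have g12 : g2 < g1 by exact: le_lt_trans gg1.
have h01 : g2 <= s0 by rewrite -(ler_pM2r g0) s0E; nra.
have h02 : s0 <= g1 by rewrite -(ler_pM2r g0) s0E; nra.
have ht1 : g2 <= st by rewrite -(ler_pM2r gt0) stE; nra.
have ht2 : st <= g1 by rewrite -(ler_pM2r gt0) stE; nra.
rewrite !hm// ?(ltW gg1)// -!EFinM -EFinD; congr EFin.
rewrite !mulrA -mulrDl; congr (_ / _).
have : st * (g + t) = t * g + s0 * g by rewrite stE s0E; ring.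
lra.
Qed.

(** The hypotheses on the entries make the sum and the product of the eigenvalues nonnegative, hence
    both eigenvalues. *)
Lemma form_law_lin a b z g t : 0 <= a -> 0 <= b -> normsq z <= a * b -> 0 < g -> 0 < t ->
  ((g + t)%:E * form_law a b z ((g * t + g * (a + b) - (a * b - normsq z)) / (g + t)) =
   t%:E * form_law a b z g + g%:E * form_law a b z ((g * (a + b) - (a * b - normsq z)) / g))%E.
Proof.
move=> a0 b0 zab g0 t0; have [g1 [g2 [g21 gs gp gE]]] := form_law_diag a b z.
rewrite !gE -gs -gp; apply: diag_law_lin => //.
have p0 : 0 <= g1 * g2 by rewrite gp subr_ge0.
have s0 : 0 <= g1 + g2 by rewrite gs addr_ge0.
rewrite leNgt; apply/negP => g20; nra.
Qed.

Lemma measurable_form_law d (T : measurableType d) (a b s : T -> R) (z : T -> C) :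
  measurable_fun setT a -> measurable_fun setT b -> measurable_fun setT s -> cmeas z ->
  measurable_fun setT (fun x => form_law (a x) (b x) (z x) (s x)).
Proof.
move=> ma mb ms [mz1 mz2].
pose S := [set y : T * Om | s y.1 * (nsq y.2 q1 + nsq y.2 q2) <
  fform (a y.1) (b y.1) (z y.1) (cz y.2 q1) (cz y.2 q2)].
have m1 : measurable_fun setT (fst : T * Om -> T) by exact: measurable_fst.
have m2 : measurable_fun setT (snd : T * Om -> Om) by exact: measurable_snd.
have mc q : cmeas (fun y : T * Om => cz y.2 q).
  have [h1 h2] := @cmeas_cz R L q.
  by split; [exact: (measurableT_comp h1 m2)|exact: (measurableT_comp h2 m2)].
have mS : measurable S.
  apply: measurable_ltf.
    apply: measurable_funM; first exact: (measurableT_comp ms m1).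
    apply: measurable_funD.
      exact: (measurableT_comp (@measurable_nsq R L q1) m2).
    exact: (measurableT_comp (@measurable_nsq R L q2) m2).
  apply: measurable_fform => //.
  - exact: (measurableT_comp ma m1).
  - exact: (measurableT_comp mb m1).
  - by split; [exact: (measurableT_comp mz1 m1)|exact: (measurableT_comp mz2 m1)].
have h := measurable_fun_xsection nu mS.
apply: (eq_measurable_fun _ _ h) => x _ /=; rewrite /form_law; congr (nu _).
by apply/seteqP; split => y; rewrite /xsection /= inE.
Qed.

End form_law.

Section gramlaws.
Variables (R : realType) (n : nat).
Notation C := R[i].
Implicit Types (A : 'M[C]_n) (x c : 'cV[C]_n).

Lemma iform_mix A x c (a b a' b' : C) : pd A ->
  iform A (a *: x + b *: c) (a' *: x + b' *: c) =
  conjc a * a' * (gram A x)%:C%C + conjc a * b' * iform A x c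
  + conjc b * a' * conjc (iform A x c) + conjc b * b' * (gram A c)%:C%C.
Proof.
move=> pA; rewrite -!gramE// iformJ//.
rewrite /iform sformDr !sformDl !sformZr !sformZl -!/(iform _ _ _); ring.
Qed.

Lemma gram_mix A x c (a b : C) : pd A ->
  gram A (a *: x + b *: c) = fform (gram A x) (gram A c) (iform A x c) a b.
Proof.
move=> pA; rewrite {1}/gram iform_mix//.
move: (gram A x) (gram A c) (iform A x c) => X Y [u v].
by case: a b => p q [s t]; rewrite /fform /normsq /=; ring.
Qed.

Lemma gram_mix_tr A x c (u1 u2 : C) : pd A -> normsq u1 + normsq u2 = 1 ->
  gram A (u1 *: x - conjc u2 *: c) + gram A (u2 *: x + conjc u1 *: c) = gram A x + gram A c.
Proof.
move=> pA uu; rewrite -scaleNr !gram_mix// -[RHS]mul1r -uu.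
move: (gram A x) (gram A c) (iform A x c) => X Y [u v].
by case: u1 u2 {uu} => p q [s t]; rewrite /fform /normsq /=; ring.
Qed.

Lemma gram_mix_det A x c (u1 u2 : C) : pd A -> normsq u1 + normsq u2 = 1 ->
  gram A (u1 *: x - conjc u2 *: c) * gram A (u2 *: x + conjc u1 *: c) -
    normsq (iform A (u1 *: x - conjc u2 *: c) (u2 *: x + conjc u1 *: c)) =
  gram A x * gram A c - normsq (iform A x c).
Proof.
move=> pA uu; rewrite -scaleNr !gram_mix// iform_mix// -[RHS]mul1r.
(* This factor makes both sides homogeneous of the same degree in the mixing coefficients, hence a
   polynomial identity. *)
have -> : 1 = (normsq u1 + normsq u2) ^+ 2 by rewrite uu expr1n.
move: (gram A x) (gram A c) (iform A x c) => X Y [u v].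
by case: u1 u2 {uu} => p q [s t]; rewrite /fform /normsq /=; ring.
Qed.

End gramlaws.

Section Amat.
Variables (R : realType) (L : nat).
Notation C := R[i].
Notation I := (nat * 'I_L * bool)%type.
Notation Om := (rvec R I).
Variables (s : R) (p : nat -> R).
Hypothesis s0 : 0 < s.
Hypothesis p0 : forall k, 0 <= p k.

Definition Amat n (w : I -> R) : 'M[C]_L := (s%:C%C)%:M +
  \sum_(k < n) (p k)%:C%C *: (vec w k.+1 *m ctrans (vec w k.+1)).

Lemma AmatS n w : Amat n.+1 w = Amat n w + (p n)%:C%C *: (vec w n.+1 *m ctrans (vec w n.+1)).
Proof. by rewrite /Amat big_ord_recr /= addrA. Qed.

Lemma pd_Amat n w : pd (Amat n w).
Proof.
elim: n => [|n IH]; first by rewrite /Amat big_ord0 addr0; exact: pd_scalar.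
by rewrite AmatS; apply: pd_rank1.
Qed.

Lemma mmeas_Amat n : mmeas (fun w : Om => Amat n w).
Proof.
apply: mmeasD; first exact: mmeas_cst.
apply: mmeas_sum => k; apply: mmeasZ; first exact: cmeas_cst.
by apply: mmeasM; [|apply: mmeas_ctrans]; exact: mmeas_vec.
Qed.

Lemma Amat_ext n w w' : (forall k, (k < n)%N -> vec w k.+1 = vec w' k.+1) -> Amat n w = Amat n w'.
Proof. by move=> h; rewrite /Amat; congr (_ + _); apply: eq_bigr => k _; rewrite h. Qed.

Lemma Amat_unitary n w w' U : ctrans U *m U = 1%:M ->
  (forall k, (k < n)%N -> vec w' k.+1 = U *m vec w k.+1) -> Amat n w' = U *m Amat n w *m ctrans U.
Proof.
move=> UU h; have [uU' uU] := mulmx1_unit UU.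
have iU : U *m ctrans U = 1%:M.
  have -> : ctrans U = invmx U by rewrite -[RHS]mul1mx -UU mulmxK.
  exact: mulmxV.
rewrite /Amat mulmxDr mulmxDl -scalemx1 -scalemxAr -scalemxAl mulmx1 iU; congr (_ + _).
rewrite mulmx_sumr mulmx_suml; apply: eq_bigr => k _.
by rewrite h// ctransM -scalemxAr -scalemxAl !mulmxA.
Qed.

End Amat.

Section thr.
Variables (R : realType) (L : nat).
Notation C := R[i].
Notation Re := complex.Re.
Notation I := (nat * 'I_L * bool)%type.
Notation Om := (rvec R I).
Variable nu : probability Om R.
Hypothesis nuI : iid (hgauss R) nu.
Variables (s : R) (p : nat -> R) (n : nat) (j0 : 'I_L).
Hypothesis s0 : 0 < s.
Hypothesis p0 : forall k, 0 <= p k.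
Local Notation A := (@Amat R L s p n).
Local Notation q1 := (n.+2, j0).
Local Notation q2 := (n.+3, j0).
(* Entries, trace and determinant of the Gram matrix of [x] and [c_n] for the inverse of [A_n]. *)
Definition gram_x (w : Om) := gram (A w) (vec w 0).
Definition gram_c (w : Om) := gram (A w) (vec w n.+1).
Definition gram_xc (w : Om) := iform (A w) (vec w 0) (vec w n.+1).
Definition gram_tr w := gram_x w + gram_c w.
Definition gram_det w := gram_x w * gram_c w - normsq (gram_xc w).

Let pA w : pd (A w). Proof. exact: pd_Amat. Qed.

Lemma cmeas_gram_xc : cmeas gram_xc.
Proof. by apply: cmeas_iform; [exact: mmeas_Amat|exact: mmeas_vec|exact: mmeas_vec]. Qed.

Lemma measurable_gram_x : measurable_fun setT gram_x.
Proof. by apply: measurable_gram; [exact: mmeas_Amat|exact: mmeas_vec]. Qed.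

Lemma measurable_gram_c : measurable_fun setT gram_c.
Proof. by apply: measurable_gram; [exact: mmeas_Amat|exact: mmeas_vec]. Qed.

Lemma measurable_gram_tr : measurable_fun setT gram_tr.
Proof. by apply: measurable_funD; [exact: measurable_gram_x|exact: measurable_gram_c]. Qed.

Lemma measurable_gram_det : measurable_fun setT gram_det.
Proof.
apply: measurable_funB; last by apply: measurable_normsq; exact: cmeas_gram_xc.
by apply: measurable_funM; [exact: measurable_gram_x|exact: measurable_gram_c].
Qed.

Lemma vec_mix (P : pred nat) (w w' : Om) k :
  vec (mix (fun i : I => P i.1.1) w w') k = if P k then vec w k else vec w' k.
Proof.
by apply/matrixP => i j; rewrite mxE /cz /mix /=; case: (P k); rewrite mxE.
Qed.

Lemma cz_mixP (P : pred nat) (w w' : Om) (q : nat * 'I_L) :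
  cz (mix (fun i : I => P i.1.1) w w') q = if P q.1 then cz w q else cz w' q.
Proof. by rewrite /cz /mix /=; case: (P q.1). Qed.

Lemma gram_entries_ext (w w' : Om) : (forall k, (k <= n.+1)%N -> vec w k = vec w' k) ->
  [/\ gram_x w = gram_x w', gram_c w = gram_c w' & gram_xc w = gram_xc w'].
Proof.
move=> h; have AE : A w = A w' by apply: Amat_ext => k kn; rewrite h// ltnS ltnW.
by split; rewrite /gram_x /gram_c /gram_xc AE !h.
Qed.

(** A threshold that is a function of trace and determinant is unchanged by the mixing of [x] and
    [c_n]. *)
Variable th : R -> R -> R.
Hypothesis mth : measurable_fun setT (fun w : Om => th (gram_tr w) (gram_det w)).
Local Notation thw w := (th (gram_tr w) (gram_det w)).
Local Notation nn w := (nsq w q1 + nsq w q2).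
Local Notation ff w w' := (fform (gram_x w) (gram_c w) (gram_xc w) (cz w' q1) (cz w' q2)).

(* [E'] is [E] after mixing [x] and [c_n] by the unit vector proportional to the Gaussian vector read off the unused vectors [n.+2] and [n.+3]; the branch of null norm has probability 0 and keeps [nu E' = nu E] exact. *)
Let E : set Om := [set w | thw w < gram_x w].
Let E' : set Om := [set w | if nn w == 0 then thw w < gram_x w else thw w * nn w < ff w w].

Let mE : measurable E.
Proof. by apply: measurable_ltf => //; exact: measurable_gram_x. Qed.

Let mE' : measurable E'.
Proof.
rewrite -[X in measurable X]setTI.
have mn : measurable_fun setT (fun w : Om => nn w).
  by apply: measurable_funD; exact: measurable_nsq.
have mb : measurable_fun setT (fun w : Om => if nn w == 0 then thw w < gram_x w else thw w * nn w < ff w w).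
  apply: measurable_fun_ifT.
  - by apply: measurable_fun_eqr.
  - by apply: measurable_fun_ltr => //; exact: measurable_gram_x.
  - apply: measurable_fun_ltr; first exact: measurable_funM.
    apply: measurable_fform; [exact: measurable_gram_x|exact: measurable_gram_c|exact: cmeas_gram_xc|exact: cmeas_cz|exact: cmeas_cz].
exact: (mb measurableT [set true]).
Qed.

Let P : pred nat := fun k => (k == n.+2) || (k == n.+3).

Let PN k : (k <= n.+1)%N -> P k = false.
Proof. by move=> kn; rewrite /P !ltn_eqF// ltnS (leq_trans kn). Qed.

Let nn_ge0 (w : Om) : 0 <= nn w. Proof. by rewrite addr_ge0 ?nsq_ge0. Qed.

(** With the spare vectors frozen, mixing has constant coefficients: it preserves [nu] and carries
    [E] to the section of [E']. *)
Let EE' : nu E' = nu E.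
Proof.
rewrite (iid_mix nuI (fun i : I => P i.1.1) mE').
rewrite (_ : (fun w => _) = (fun=> nu E)); last first.
  apply/funext => w.
  have mixE w' : [/\ gram_x (mix (fun i : I => P i.1.1) w w') = gram_x w',
      gram_c (mix (fun i : I => P i.1.1) w w') = gram_c w', gram_xc (mix (fun i : I => P i.1.1) w w') = gram_xc w',
      cz (mix (fun i : I => P i.1.1) w w') q1 = cz w q1 & cz (mix (fun i : I => P i.1.1) w w') q2 = cz w q2].
    have [-> -> ->] : [/\ gram_x (mix (fun i : I => P i.1.1) w w') = gram_x w',
      gram_c (mix (fun i : I => P i.1.1) w w') = gram_c w' & gram_xc (mix (fun i : I => P i.1.1) w w') = gram_xc w'].
      by apply: gram_entries_ext => k kn; rewrite vec_mix PN.
    by split => //; rewrite cz_mixP /P /= eqxx ?orbT.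
  have [n0|n0] := eqVneq (nn w) 0.
    congr (nu _); apply/seteqP; split => w' /=; rewrite /E' /E /=;
      have [a1 a2 a3 a4 a5] := mixE w'; by rewrite /nsq a4 a5 -!/(nsq _ _) n0 eqxx /gram_tr /gram_det a1 a2 a3.
  have N0 : 0 < nn w by rewrite lt_neqAle nn_ge0 andbT eq_sym.
  pose N := Num.sqrt (nn w); have NE : N ^+ 2 = nn w by rewrite sqr_sqrtr// nn_ge0.
  have N1 : (N^-1) ^+ 2 = (nn w)^-1 by rewrite exprVn NE.
  (* Up to the norm [N] the mixed first vector is [cz w q1 *: x + cz w q2 *: c_n]; the sign and the
     conjugate undo those of [mixcol_ex]. *)
  pose u1 := N^-1%:C%C * cz w q1; pose u2 := - conjc (N^-1%:C%C * cz w q2).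
  have uu : normsq u1 + normsq u2 = 1.
    by rewrite normsqN normsqJ !normsqM normsq_real N1 -mulrDr mulVf// gt_eqF.
  have k01 : 0%N != n.+1 by [].
  have [Phi [[mPhi pPhi] PhiE]] := mixcol_ex nuI k01 uu.
  rewrite -(pPhi _ mE); congr (nu _); apply/seteqP.
  have key w' : (thw (Phi w') < gram_x (Phi w')) = (thw w' * nn w < fform (gram_x w') (gram_c w') (gram_xc w') (cz w q1) (cz w q2)).
    have AE : A (Phi w') = A w'.
      by apply: Amat_ext => k kn; rewrite PhiE /= eqSS (ltn_eqF kn).
    have x' : vec (Phi w') 0 = u1 *: vec w' 0 - conjc u2 *: vec w' n.+1 by rewrite PhiE.
    have c' : vec (Phi w') n.+1 = u2 *: vec w' 0 + conjc u1 *: vec w' n.+1 by rewrite PhiE /= eqxx.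
    have gtE : gram_tr (Phi w') = gram_tr w' by rewrite /gram_tr /gram_x /gram_c AE x' c' gram_mix_tr.
    have gDE : gram_det (Phi w') = gram_det w' by rewrite /gram_det /gram_x /gram_c /gram_xc AE x' c' gram_mix_det.
    rewrite gtE gDE {1}/gram_x AE x' -scaleNr gram_mix// cjN conjcK opprK fformZ N1.
    by rewrite ltr_pdivlMl// mulrC.
  by split => w' /=; rewrite /E' /E /=; have [a1 a2 a3 a4 a5] := mixE w';
    rewrite /nsq a4 a5 -!/(nsq _ _) (negbTE n0) /gram_tr /gram_det a1 a2 a3 -/(gram_tr w') -/(gram_det w') key.
by rewrite -[nu E]fineK ?fin_num_measure// integral_cst//= probability_setT mule1.
Qed.

(** The opposite conditioning: everything but the spare vectors is frozen, and the section of [E']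
    is the event of [form_law] up to the null set where the entry [q1] vanishes. *)
Lemma threshold_law : nu [set w | thw w < gram_x w] = (\int[nu]_w form_law nu q1 q2 (gram_x w) (gram_c w) (gram_xc w) (thw w))%E.
Proof.
rewrite -/E -EE' (iid_mix nuI (fun i : I => predC P i.1.1) mE').
apply: eq_integral => w _; rewrite /form_law.
have mixE w' : [/\ gram_x (mix (fun i : I => predC P i.1.1) w w') = gram_x w,
      gram_c (mix (fun i : I => predC P i.1.1) w w') = gram_c w, gram_xc (mix (fun i : I => predC P i.1.1) w w') = gram_xc w,
      cz (mix (fun i : I => predC P i.1.1) w w') q1 = cz w' q1 & cz (mix (fun i : I => predC P i.1.1) w w') q2 = cz w' q2].
  have [-> -> ->] : [/\ gram_x (mix (fun i : I => predC P i.1.1) w w') = gram_x w,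
      gram_c (mix (fun i : I => predC P i.1.1) w w') = gram_c w & gram_xc (mix (fun i : I => predC P i.1.1) w w') = gram_xc w].
    by apply: gram_entries_ext => k kn; rewrite vec_mix /= PN.
  by split => //; rewrite cz_mixP /P /= eqxx ?orbT.
pose F : set Om := [set w' | thw w * nn w' < ff w w'].
pose G : set Om := [set w' | E' (mix (fun i : I => predC P i.1.1) w w')].
have GE w' : G w' <-> if nn w' == 0 then thw w < gram_x w else thw w * nn w' < ff w w'.
  have [a1 a2 a3 a4 a5] := mixE w'.
  set M := mix _ w w' in a1 a2 a3 a4 a5.
  have n1 : nsq M q1 = nsq w' q1 by rewrite /nsq a4.
  have n2 : nsq M q2 = nsq w' q2 by rewrite /nsq a5.
  have e1 : gram_tr M = gram_tr w by rewrite /gram_tr a1 a2.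
  have e2 : gram_det M = gram_det w by rewrite /gram_det a1 a2 a3.
  change (G w') with (is_true (if nsq M q1 + nsq M q2 == 0 then th (gram_tr M) (gram_det M) < gram_x M
    else th (gram_tr M) (gram_det M) * (nsq M q1 + nsq M q2) < fform (gram_x M) (gram_c M) (gram_xc M) (cz M q1) (cz M q2))).
  clearbody M.
  move: n1 n2 e1 e2 a1 a2 a3 a4 a5.
  move: (nsq M q1) (nsq M q2) (gram_tr M) (gram_det M) (gram_x M) (gram_c M) (gram_xc M) (cz M q1) (cz M q2).
  by move=> ? ? ? ? ? ? ? ? ? -> -> -> -> -> -> -> -> ->.
have mF : measurable F.
  apply: measurable_ltf.
    by apply: measurable_funM => //; apply: measurable_funD; exact: measurable_nsq.
  apply: (@measurable_fform _ _ Om (fun=> gram_x w) (fun=> gram_c w) (fun=> gram_xc w) (fun w : Om => cz w q1) (fun w : Om => cz w q2));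
    [exact: measurable_cst|exact: measurable_cst|exact: cmeas_cst|exact: cmeas_cz|exact: cmeas_cz].
have mG : measurable G by exact: measurable_mix_section.
pose Z : set Om := [set w' | nsq w' q1 = 0].
have mZ : measurable Z.
  rewrite -[X in measurable X]setTI.
  exact: (measurable_nsq q1 measurableT (measurable_set1 0)).
have Z0 : nu Z = 0%E by exact: nsq0_null.
have FG w' : ~ Z w' -> (F w' <-> G w').
  move=> Zw; have nz : nn w' != 0.
    apply/negP => /eqP h; apply: Zw; rewrite /Z /=.
    by have := nsq_ge0 w' q1; have := nsq_ge0 w' q2; lra.
  by split; rewrite GE (negbTE nz).
apply/eqP; rewrite eq_le; apply/andP; split.
  rewrite -[leRHS]adde0 -Z0; apply: le_trans (_ : nu (F `|` Z) <= _)%E; last exact: measureU2.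
  apply: le_measure; rewrite ?inE//; first exact: measurableU.
  by move=> w' Gw; have [Zw|Zw] := pselect (Z w'); [right|left; apply/FG].
rewrite -[leRHS]adde0 -Z0; apply: le_trans (_ : nu (G `|` Z) <= _)%E; last exact: measureU2.
apply: le_measure; rewrite ?inE//; first exact: measurableU.
by move=> w' Gw; have [Zw|Zw] := pselect (Z w'); [right|left; apply/FG].
Qed.

End thr.

Lemma integral_lin3 d (T : measurableType d) (R : realType) (mu : {measure set T -> \bar R})
  (f1 f2 f3 : T -> \bar R) (a b c : R) :
  measurable_fun setT f1 -> measurable_fun setT f2 -> measurable_fun setT f3 ->
  (forall x, 0 <= f1 x)%E -> (forall x, 0 <= f2 x)%E -> (forall x, 0 <= f3 x)%E ->
  0 <= a -> 0 <= b -> 0 <= c ->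
  (forall x, a%:E * f1 x = b%:E * f2 x + c%:E * f3 x)%E ->
  (a%:E * \int[mu]_x f1 x = b%:E * \int[mu]_x f2 x + c%:E * \int[mu]_x f3 x)%E.
Proof.
move=> m1 m2 m3 p1 p2 p3 a0 b0 c0 h.
rewrite -!ge0_integralZl_EFin// -ge0_integralD//; first by apply: eq_integral => x _; exact: h.
- by move=> x _; rewrite mule_ge0.
- exact: measurable_funeM.
- by move=> x _; rewrite mule_ge0.
- exact: measurable_funeM.
Qed.

Section step.
Variables (R : realType) (L : nat).
Notation C := R[i].
Notation I := (nat * 'I_L * bool)%type.
Notation Om := (rvec R I).
Variable nu : probability Om R.
Hypothesis nuI : iid (hgauss R) nu.
Variables (s g : R) (p : nat -> R) (n : nat) (j0 : 'I_L).
Hypothesis s0 : 0 < s.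
Hypothesis g0 : 0 < g.
Hypothesis p0 : forall k, 0 <= p k.
Hypothesis pn0 : 0 < p n.
Local Notation A := (@Amat R L s p n).
Local Notation a := (@gram_x R L s p n).
Local Notation b := (@gram_c R L s p n).
Local Notation z := (@gram_xc R L s p n).
Local Notation t := (@gram_tr R L s p n).
Local Notation D := (@gram_det R L s p n).

Let pA w : pd (A w). Proof. exact: pd_Amat. Qed.

(* By Sherman-Morrison the three events are of the form [th (gram_tr w) (gram_det w) < gram_x w], which reduces the claim to [form_law_lin]. *)
Lemma gram_step :
  ((g + (p n)^-1)%:E * nu [set w | (g < gram (Amat s p n.+1 w) (vec w 0))%R] =
   ((p n)^-1)%:E * nu [set w | (g < gram (A w) (vec w 0))%R] +
   g%:E * nu [set w | (g * b w < D w)%R])%E.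
Proof.
pose tau := (p n)^-1; have tau0 : 0 < tau by rewrite invr_gt0.
have gt0 : 0 < g + tau by rewrite addr_gt0.
have mt := @measurable_gram_tr R L s p n.
have mD := @measurable_gram_det R L s p n.
have ma := @measurable_gram_x R L s p n.
have mb := @measurable_gram_c R L s p n.
have mz := @cmeas_gram_xc R L s p n.
(* Each inequality is solved for [gram_x], after eliminating [gram_c] by the trace and
   [normsq gram_xc] by the determinant. *)
pose th1 (t D : R) := (g * tau + g * t - D) / (g + tau).
pose th2 (t D : R) := g.
pose th3 (t D : R) := (g * t - D) / g.
have m1 : measurable_fun setT (fun w : Om => th1 (t w) (D w)).
  apply: measurable_funM => //; apply: measurable_funB => //.
  by apply: measurable_funD => //; apply: measurable_funM.
have m2 : measurable_fun setT (fun w : Om => th2 (t w) (D w)) by [].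
have m3 : measurable_fun setT (fun w : Om => th3 (t w) (D w)).
  apply: measurable_funM => //; apply: measurable_funB => //.
  by apply: measurable_funM.
have q12 : (n.+2, j0) != (n.+3, j0).
  by apply/negP => /eqP [] /eqP; rewrite ltn_eqF.
have E1 : [set w | g < gram (Amat s p n.+1 w) (vec w 0)] = [set w | th1 (t w) (D w) < a w].
  apply/seteqP; suff h (w : Om) : (g < gram (Amat s p n.+1 w) (vec w 0)) = (th1 (t w) (D w) < a w) by split=> w /=; rewrite h.
  rewrite AmatS gram_update// /th1 ltr_pdivrMr// /gram_tr /gram_det -/(gram_x s p n w) -/(gram_c s p n w) -/(gram_xc s p n w) -/tau.
  by apply/idP/idP; move: (gram_x s p n w) (gram_c s p n w) (normsq _) => X Y Z; lra.
have E3 : [set w | g * b w < D w] = [set w | th3 (t w) (D w) < a w].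
  apply/seteqP; suff h (w : Om) : (g * b w < D w) = (th3 (t w) (D w) < a w) by split=> w /=; rewrite h.
  rewrite /th3 ltr_pdivrMr// /gram_tr /gram_det.
  by apply/idP/idP; move: (gram_x s p n w) (gram_c s p n w) (normsq _) => X Y Z; lra.
have e1 := eq_trans (congr1 nu E1) (threshold_law nuI j0 s0 p0 m1).
have e2 := threshold_law nuI j0 s0 p0 m2.
have e3 := eq_trans (congr1 nu E3) (threshold_law nuI j0 s0 p0 m3).
apply: (eq_trans (congr1 (fun u => (g + tau)%:E * u)%E e1)).
apply/esym.
apply: (eq_trans (congr2 (fun u v => tau%:E * u + g%:E * v)%E e2 e3)).
apply/esym.
have h1 := measurable_form_law nu (n.+2, j0) (n.+3, j0) ma mb m1 mz.
have h2 := measurable_form_law nu (n.+2, j0) (n.+3, j0) ma mb m2 mz.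
have h3 := measurable_form_law nu (n.+2, j0) (n.+3, j0) ma mb m3 mz.
have ag w := gram_ge0 (vec w 0) (pA w).
have bg w := gram_ge0 (vec w n.+1) (pA w).
have zg w := gram_CS (vec w 0) (vec w n.+1) (pA w).
have lin w := @form_law_lin R L nu nuI _ _ q12 (a w) (b w) (z w) g tau (ag w) (bg w) (zg w) g0 tau0.
apply: (@integral_lin3 _ Om R nu _ _ _ (g + tau) tau g h1 h2 h3) => [w|w|w||||w]; [exact: measure_ge0|exact: measure_ge0|
  exact: measure_ge0|exact: ltW|exact: ltW|exact: ltW|exact: lin].
Qed.

End step.

(** * Removing an antenna *)

Lemma iid_mix_ae (R : realType) (I : choiceType) mu (nu : probability (rvec R I) R) (J : pred I)
  (E Z : set (rvec R I)) (K : \bar R) :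
  iid mu nu -> measurable E -> measurable Z -> nu Z = 0%E -> K \is a fin_num ->
  (forall w, ~ Z w -> nu [set w' | E (mix J w w')] = K) -> nu E = K.
Proof.
move=> nuI mE mZ Z0 Kf h; rewrite (iid_mix nuI J mE).
have mF : measurable_fun setT (fun w => nu [set w' | E (mix J w w')]).
  pose S := (fun x : rvec R I * rvec R I => mix J x.1 x.2 : rvec R I) @^-1` E.
  have mS : measurable S by rewrite -[S]setTI; exact: (measurable_mix J).
  apply: (eq_measurable_fun _ _ (measurable_fun_xsection nu mS)) => x _ /=.
  by congr (nu _); apply/seteqP; split => y; rewrite /xsection /= inE.
transitivity (\int[nu]_w cst K w)%E.
  apply: ae_eq_integral => //.
  exists Z; split => // w /= mixed_weight; apply: contrapT => Zw; apply: mixed_weight => _.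
  exact: h.
by rewrite -(fineK Kf) integral_cst//= probability_setT mule1.
Qed.

Section slice.
Variables (R : realType) (m : nat).
Notation C := R[i].
Notation I := (nat * 'I_m.+1 * bool)%type.
Notation I' := (nat * 'I_m * bool)%type.
Notation Om := (rvec R I).
Notation Om' := (rvec R I').

Definition drop_antenna (i : I') : I := (i.1.1, lift ord0 i.1.2, i.2).

Lemma drop_antenna_inj : injective drop_antenna.
Proof.
case=> [[k j] b] [[k' j'] b'] e.
have := congr1 snd e; have := congr1 (fun i => i.1.2) e; have := congr1 (fun i => i.1.1) e.
by move=> /= -> /lift_inj -> ->.
Qed.

Lemma cz_drop_antenna (w : I -> R) k j : cz (w \o drop_antenna) (k, j) = cz w (k, rshift 1 j).
Proof. by rewrite /cz /= /drop_antenna /= rshift1. Qed.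

Lemma dsubmx_vec (w : I -> R) k : dsubmx (vec w k : 'cV[C]_(1 + m)) = vec (w \o drop_antenna) k.
Proof. by apply/matrixP => i j; rewrite !mxE cz_drop_antenna. Qed.

Lemma drsubmx_Amat s p n (w : I -> R) :
  drsubmx (Amat s p n w : 'M[C]_(1 + m)) = Amat s p n (w \o drop_antenna).
Proof.
rewrite /Amat; apply/matrixP => i j; rewrite !mxE !summxE (inj_eq (@rshift_inj 1 m)).
congr (_ + _); apply: eq_bigr => k _.
by rewrite !mxE !big_ord1 !mxE !cz_drop_antenna.
Qed.

Variables (nu : probability Om R) (nu' : probability Om' R).
Hypothesis nuI : iid (hgauss R) nu.
Hypothesis nu'E : forall A, nu' A = nu ((fun w : Om => (w \o drop_antenna : Om')) @^-1` A).
Variables (s g : R) (p : nat -> R) (n : nat).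
Hypothesis s0 : 0 < s.
Hypothesis p0 : forall k, 0 <= p k.
Local Notation A := (@Amat R m.+1 s p n).

Let pA w : pd (A w). Proof. exact: pd_Amat. Qed.

Definition slice_event (A : 'M[C]_m.+1) (x c : 'cV[C]_m.+1) : bool :=
  g * gram A c < gram A x * gram A c - normsq (iform A x c).

Let K := nu [set w : Om | g < gram (Amat s p n (w \o drop_antenna)) (vec (w \o drop_antenna) 0)].

Lemma measurable_slice_event c : measurable [set w : Om | slice_event (A w) (vec w 0) c].
Proof.
have m1 := @mmeas_Amat R m.+1 s p n.
have m2 := @mmeas_vec R m.+1 0%N.
have m3 : mmeas (fun _ : Om => c) by exact: mmeas_cst.
apply: measurable_ltf; first by apply: measurable_funM => //; exact: measurable_gram.
apply: measurable_funB; first by apply: measurable_funM; exact: measurable_gram.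
by apply: measurable_normsq; apply: cmeas_iform.
Qed.

(** A unitary change of antennas turns [c] into a multiple of the first basis vector without
    altering the law of the other vectors. The Schur complement then leaves the form of the last [m]
    antennas, the positive factor [gram A c] cancelling. *)
Lemma slice_event_law c : c != 0 -> nu [set w | slice_event (A w) (vec w 0) c] = K.
Proof.
move=> c0; have [U [[UU gU] Uc]] := elim_ex nuI c.
(* The vectors [0] to [n]: the desired one and the interferers present in [A_n]. *)
have [Phi [[mPhi pPhi] PhiE]] := gU (iota 0 n.+1) (iota_uniq _ _).
have [uU' uU] := mulmx1_unit UU.
have TE w : slice_event (A (Phi w)) (vec (Phi w) 0) (U *m c) = slice_event (A w) (vec w 0) c.
  have uA : A w \in unitmx by exact: pd_unit.
  have -> : A (Phi w) = U *m A w *m ctrans U.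
    by apply: Amat_unitary => // k kn; rewrite PhiE mem_iota add0n ltnS kn.
  have -> : vec (Phi w) 0 = U *m vec w 0 by rewrite PhiE mem_iota.
  by rewrite /slice_event /gram !iform_unitary.
have -> : [set w | slice_event (A w) (vec w 0) c] = Phi @^-1` [set w | slice_event (A w) (vec w 0) (U *m c)].
  by apply/funext => w; exact: (esym (congr1 is_true (TE w))).
apply: (eq_trans (pPhi _ (measurable_slice_event _))).
have c1 : U *m c != 0.
  apply: contra c0 => /eqP h.
  by rewrite -[c]mul1mx -UU -mulmxA h mulmx0.
rewrite /K; congr (nu _); apply/seteqP.
suff h w : slice_event (A w) (vec w 0) (U *m c) = (g < gram (Amat s p n (w \o drop_antenna)) (vec (w \o drop_antenna) 0)).
  by split => w /=; rewrite h.
have dc : dsubmx (U *m c : 'cV[C]_(1 + m)) = 0.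
  by apply/matrixP => i j; rewrite !mxE ord1 -[RHS](Uc (rshift 1 i))// mxE.
rewrite /slice_event (@gram_slice R m (A w) _ _ (pA w) dc c1) drsubmx_Amat dsubmx_vec.
by rewrite mulrC ltr_pM2l// gram_gt0.
Qed.

(** Conditioning on the vector [n.+1], almost surely nonzero: the conditional probability does not
    depend on its value. *)
Lemma slice_step : nu [set w : Om | g * gram_c s p n w < gram_det s p n w] =
  nu' [set w | g < gram (Amat s p n w) (vec w 0)].
Proof.
rewrite nu'E; change (nu [set w : Om | g * gram_c s p n w < gram_det s p n w] = K).
pose Z : set Om := [set w | nsq w (n.+1, ord0) = 0].
have mZ : measurable Z.
  rewrite -[X in measurable X]setTI.
  exact: (measurable_nsq (n.+1, ord0) measurableT (measurable_set1 0)).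
have mE : measurable [set w : Om | g * gram_c s p n w < gram_det s p n w].
  apply: measurable_ltf; last exact: measurable_gram_det.
  by apply: measurable_funM => //; exact: measurable_gram_c.
have Kf : K \is a fin_num.
  apply: fin_num_measure; apply: measurable_ltf; first exact: measurable_cst.
  have h := @drsubmx_Amat s p n; have h' := dsubmx_vec.
  have mg := @measurable_gram_x R m s p n.
  have ml : measurable_fun setT (fun w : Om => (w \o drop_antenna : Om')).
    by apply: measurable_rvecP => i; exact: (measurable_coord (drop_antenna i)).
  exact: (measurableT_comp mg ml).
have H := @iid_mix_ae R I (hgauss R) nu (fun i : I => pred1 n.+1 i.1.1) _ Z K nuI mE mZ (nsq0_null nuI _) Kf.
apply: H => w Zw.
have c0 : vec w n.+1 != 0.
  apply/negP => /eqP c0; apply: Zw; rewrite /Z /= /nsq.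
  have -> : cz w (n.+1, ord0) = vec w n.+1 ord0 0 by rewrite mxE.
  by rewrite c0 mxE; apply/eqP; rewrite normsq_eq0.
rewrite -(slice_event_law c0); congr (nu _); apply/seteqP.
suff h w' : (g * gram_c s p n (mix (fun i : I => pred1 n.+1 i.1.1) w w') < gram_det s p n (mix (fun i : I => pred1 n.+1 i.1.1) w w')) =
   slice_event (A w') (vec w' 0) (vec w n.+1) by split => w' /=; rewrite h.
have e1 k : (k <= n)%N -> vec (mix (fun i : I => pred1 n.+1 i.1.1) w w') k = vec w' k.
  by move=> kn; rewrite vec_mix /= ltn_eqF.
have e2 : vec (mix (fun i : I => pred1 n.+1 i.1.1) w w') n.+1 = vec w n.+1.
  by rewrite vec_mix /= eqxx.
have e3 : A (mix (fun i : I => pred1 n.+1 i.1.1) w w') = A w'.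
  by apply: Amat_ext => k kn; exact: e1.
by rewrite /gram_c /gram_det /gram_x /gram_c /gram_xc e3 e2 e1.
Qed.

End slice.

(** * The law for fixed powers *)

(* The probability that a Poisson variable of mean [y] is less than [N]. *)
Definition ptail (R : realType) (N : nat) (y : R) : R :=
  \sum_(i < N) y ^+ i / i`!%:R * expR (- y).

Lemma ptailS (R : realType) N (y : R) : ptail N.+1 y =
  expR (- y) + \sum_(i < N) y ^+ i.+1 / i.+1`!%:R * expR (- y).
Proof. by rewrite /ptail big_ord_recl /= expr0 fact0 divr1 mul1r. Qed.

Lemma ptail_ge0 (R : realType) N (y : R) : 0 <= y -> 0 <= ptail N y.
Proof.
move=> y0; apply: sumr_ge0 => i _.
by rewrite mulr_ge0 ?expR_ge0// divr_ge0 ?exprn_ge0.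
Qed.

Lemma integral_pow (R : realType) (y : R) i : 0 <= y ->
  (\int[@lebesgue_measure R]_(r in `[0%R, y]) ((y - r) ^+ i / i`!%:R)%:E =
   (y ^+ i.+1 / i.+1`!%:R)%:E)%E.
Proof.
rewrite le_eqVlt => /predU1P[<-|y0].
  by rewrite set_itv1 integral_set1 expr0n mul0r.
pose F (r : R) := - ((y - r) ^+ i.+1 / i.+1`!%:R).
have dF (r : R) : is_derive r 1 F ((y - r) ^+ i / i`!%:R).
  have h1 : is_derive r 1 (cst y - id : R -> R) (0 - 1) by apply: is_deriveB.
  have h2 := is_deriveZ (- (i.+1`!%:R)^-1) (is_deriveX i.+1 h1).
  rewrite (_ : F = (- (i.+1`!%:R)^-1) \*: ((cst y - id : R -> R) ^+ i.+1)); last first.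
    by apply/funext => x; rewrite /F fctE /= /GRing.scale /= mulNr mulrC.
  apply: (is_derive_eq h2).
  have n0 : i.+1%:R != 0 :> R by rewrite pnatr_eq0.
  have n1 : i`!%:R != 0 :> R by rewrite pnatr_eq0 -lt0n fact_gt0.
  rewrite factS natrM /= /GRing.scale /= !fctE; field.
  by rewrite n1 -mulrS n0.
have cf : continuous (fun r : R => (y - r) ^+ i / i`!%:R).
  move=> x; apply: cvgM; last exact: cvg_cst.
  have c1 : {for x, continuous (fun r : R => y - r)} by apply: cvgB; [exact: cvg_cst|exact: cvg_id].
  exact: (continuous_comp c1 (@exprn_continuous _ i _)).
rewrite (@continuous_FTC2 _ _ F)//.
- by rewrite -EFinB; congr EFin; rewrite /F subr0 subrr expr0n /= mul0r oppr0 sub0r opprK.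
- by apply: continuous_subspaceT.
- split.
  + by move=> x _; have [] := dF x.
  + apply: cvg_at_right_filter; apply: differentiable_continuous; apply/derivable1_diffP; by have [] := dF 0.
  + apply: cvg_at_left_filter; apply: differentiable_continuous; apply/derivable1_diffP; by have [] := dF y.
- by move=> x _; rewrite derive1E; have [_] := dF x.
Qed.

Lemma measurable_ptail (R : realType) N : measurable_fun setT (@ptail R N).
Proof.
apply: measurable_sum => i; apply: measurable_funM; last first.
  by apply: measurableT_comp => //; exact: measurable_oppr.
by apply: measurable_funM => //; exact: exprn_measurable.
Qed.

Section erlang.
Variables (R : realType) (L : nat).
Notation I := (nat * 'I_L * bool)%type.
Notation Om := (rvec R I).
Variable nu : probability Om R.
Hypothesis nuI : iid (hgauss R) nu.

(** The first variable [r] is frozen: above [y] the event is certain and contributes [expR (- y)],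
    below it the induction hypothesis applies at [y - r]. As [expR (- (y - r)) * expR (- r)] is
    constant in [r], each Poisson weight becomes the integral of a power and moves up by one
    index. *)
Lemma erlang (qs : seq (nat * 'I_L)) y : uniq qs -> 0 <= y ->
  nu [set w | y < \sum_(q <- qs) nsq w q] = (ptail (size qs) y)%:E.
Proof.
elim: qs y => [|q0 qs IH] y /=.
  move=> _ y0; rewrite /ptail big_ord0 (_ : [set _ | _] = set0) ?measure0//.
  by apply/seteqP; split => w //=; rewrite big_nil ltNge y0.
move=> /andP[q0s us] y0.
have msum (s : seq (nat * 'I_L)) : measurable_fun setT (fun w : Om => \sum_(q <- s) nsq w q).
  by apply: measurable_sum => q; exact: measurable_nsq.
have mE : measurable [set w : Om | y < \sum_(q <- q0 :: qs) nsq w q].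
  by apply: measurable_ltf => //; exact: measurable_cst.
pose N := size qs.
pose h2 (r : R) := (ptail N (y - r) * \1_(`[0, y]) r)%:E.
have mh2 : measurable_fun setT h2.
  apply/measurable_EFinP; apply: measurable_funM.
    apply: (measurableT_comp (measurable_ptail N)).
    by apply: measurable_funB => //.
  exact: measurable_indic.
have h20 r : (0 <= h2 r)%E.
  rewrite lee_fin /h2 indicE; have [|] := boolP (r \in _); last by rewrite mulr0.
  rewrite inE/= in_itv/= => /andP[_ ry]; rewrite mulr1.
  by apply: ptail_ge0; rewrite subr_ge0.
have mt : measurable [set w : Om | y < nsq w q0].
  by apply: measurable_ltf; [exact: measurable_cst|exact: measurable_nsq].
rewrite (iid_mix nuI (fun i : I => (pred1 q0) i.1) mE).
transitivity (\int[nu]_w ((\1_[set w : Om | y < nsq w q0] w)%:E + h2 (nsq w q0)))%E.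
  apply: eq_integral => w _.
  have e w' : \sum_(q <- q0 :: qs) nsq (mix (fun i : I => pred1 q0 i.1) w w') q =
      nsq w q0 + \sum_(q <- qs) nsq w' q.
    rewrite big_cons (nsq_mix (pred1 q0)) /= eqxx; congr (_ + _).
    rewrite !big_seq; apply: eq_bigr => q qq.
    rewrite (nsq_mix (pred1 q0)) /=; case: eqP => // qq0; by move: q0s; rewrite -qq0 qq.
  rewrite /h2 !indicE.
  have [yq|yq] := ltP y (nsq w q0).
    have -> : (w \in [set w : Om | y < nsq w q0]) by rewrite inE.
    have -> : (nsq w q0 \in `[0, y]%classic) = false.
      by apply: memNset => /=; rewrite in_itv/= => /andP[_]; rewrite leNgt yq.
    rewrite mulr0 adde0 (_ : [set _ | _] = setT) ?probability_setT//.
    apply/seteqP; split => w' //= _; rewrite e.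
    by rewrite ltr_wpDr// sumr_ge0// => q _; exact: nsq_ge0.
  have -> : (w \in [set w : Om | y < nsq w q0]) = false.
    by apply: memNset => /=; apply/negP; rewrite -leNgt.
  have -> : (nsq w q0 \in `[0, y]%classic).
    by rewrite inE/= in_itv/= nsq_ge0.
  rewrite add0e mulr1 /N -IH ?subr_ge0//; congr (nu _).
  by apply/seteqP; split => w' /=; rewrite e ltrBlDl.
rewrite ge0_integralD//; last 2 first.
- by apply/measurable_EFinP; exact: measurable_indic.
- by apply: (measurableT_comp mh2); exact: measurable_nsq.
have e1 : (\int[nu]_w (\1_[set w : Om | (y < nsq w q0)%R] w)%:E)%E = (expR (- y))%:E.
  apply: (eq_trans (integral_indic _ measurableT mt)); rewrite setIT; exact: nsq_tail.
apply: (eq_trans (f_equal2 (fun u v => (u + v)%E) e1 (nsq_int nuI q0 mh2 h20))).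
rewrite /= -/N ptailS EFinD; congr (_ + _)%E.
transitivity (\int[@lebesgue_measure R]_(r in `[0%R, y])
  \sum_(i < N) ((expR (- y))%:E * ((y - r) ^+ i / i`!%:R)%:E))%E.
  rewrite [LHS]integral_mkcond [RHS]integral_mkcond; apply: eq_integral => r _.
  rewrite /patch /h2 !mem_setE !in_itv/= andbT.
  have [r0|r0] := leP 0 r => //=.
  rewrite indicE mem_setE in_itv/= r0 /=; case: (r <= y) => /=; last by rewrite mulr0 mul0e.
  rewrite mulr1 -EFinM sumEFin; congr EFin.
  rewrite /ptail mulr_suml; apply: eq_bigr => i _.
  have <- : expR (- (y - r)) * expR (- r) = expR (- y) by rewrite -expRD; congr expR; ring.
  by rewrite [RHS]mulrC mulrA.
rewrite ge0_integral_sum//; last 2 first.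
- move=> i; apply/measurable_EFinP => //; apply: measurable_funM => //.
  apply: measurable_funM => //; apply: measurable_funX.
  by apply: measurable_funB => //.
- move=> i r; rewrite /= in_itv/= => /andP[_ ry].
  by rewrite mule_ge0// lee_fin ?expR_ge0// divr_ge0// exprn_ge0// subr_ge0.
rewrite -sumEFin; apply: eq_bigr => i _.
rewrite ge0_integralZl//; last 2 first.
- apply/measurable_EFinP => //;
  apply: measurable_funM => //; apply: measurable_funX.
  by apply: measurable_funB => //.
- move=> r; rewrite /= in_itv/= => /andP[_ ry].
  by rewrite lee_fin divr_ge0// exprn_ge0// subr_ge0.
by rewrite integral_pow// -EFinM mulrC.
Qed.

End erlang.

(* The probability that a Poisson variable of mean [y] plus independent Bernoulli variables of parameters [q k], [k < n], is less than [L]. *)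
Fixpoint pbtail (R : realType) (y : R) (q : nat -> R) (n L : nat) : R :=
  if n is n'.+1 then
    (1 - q n') * pbtail y q n' L + q n' * (if L is L'.+1 then pbtail y q n' L' else 0)
  else ptail L y.

Lemma pbtail0 (R : realType) (y : R) q n : pbtail y q n 0 = 0.
Proof. by elim: n => [|n /= IH]; rewrite /= ?IH ?mulr0 ?addr0// /ptail big_ord0. Qed.

Lemma gram_Amat0 (R : realType) L (s : R) p (w : nat * 'I_L * bool -> R) : 0 < s ->
  gram (Amat s p 0 w) (vec w 0) = s^-1 * \sum_(j < L) nsq w (0%N, j).
Proof.
move=> s0; rewrite /gram /iform /sform /Amat big_ord0 addr0 invmx_scalar.
rewrite -(fmorphV (real_complex R)) mul_mx_scalar -scalemxAl mxE [(_ *m _) 0 0]mxE.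
rewrite (eq_bigr (fun j => (nsq w (0%N, j))%:C%C)) => [|j _]; last first.
  by rewrite !mxE /nsq normsqE mulrC.
by rewrite -rmorph_sum -rmorphM.
Qed.

(** Induction on the number of interferers for all numbers of antennas at once, [nu] varying with
    the latter. Zero antennas give the zero form, and no interferer gives a sum of [L] exponentials.
    A zero power is set aside because the recursion involves [(p n)^-1]. *)
Theorem gram_law (R : realType) (s g : R) (p : nat -> R) n L (nu : probability (rvec R (nat * 'I_L * bool)%type) R) :
  0 < s -> 0 < g -> (forall k, 0 <= p k) -> iid (hgauss R) nu ->
  nu [set w | g < gram (Amat s p n w) (vec w 0)] =
  (pbtail (s * g) (fun k => p k * g / (1 + p k * g)) n L)%:E.
Proof.
move=> s0 g0 p0.
have L0 n' (nu' : probability (rvec R (nat * 'I_0 * bool)%type) R) :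
   nu' [set w | g < gram (Amat s p n' w) (vec w 0)] = 0%E.
  rewrite (_ : [set _ | _] = set0) ?measure0//.
  apply/seteqP; split => w //=.
  by rewrite (_ : vec w 0 = 0) ?gram0 ?ltNge ?ltW//; apply/matrixP => -[].
elim: n L nu => [|n IH] [|m] nu nuI; rewrite ?pbtail0 ?L0//.
  have u : uniq [seq (0%N, j) | j <- enum 'I_m.+1] by rewrite map_inj_uniq ?enum_uniq// => j j' [].
  have sg0 : 0 <= s * g by rewrite mulr_ge0// ltW.
  have := erlang nuI u sg0; rewrite size_map size_enum_ord => <-.
  congr (nu _); apply/seteqP.
  suff h w : (g < gram (Amat s p 0 w) (vec w 0)) =
    (s * g < \sum_(q <- [seq (0%N, j) | j <- enum 'I_m.+1]) nsq w q) by split => w /=; rewrite h.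
  by rewrite gram_Amat0// ltr_pdivlMl// big_map big_enum.
rewrite /=; have := p0 n; rewrite le_eqVlt => /predU1P[pn0|pn0].
  rewrite -pn0 !mul0r subr0 mul1r addr0 -(IH _ nu nuI).
  by congr (nu _); apply/seteqP; split => w /=; rewrite AmatS -pn0 scale0r addr0.
have [nu' [nu'I nu'E]] := iid_reindex (@drop_antenna_inj m) nuI.
have := eq_trans (gram_step nuI ord0 s0 g0 p0 pn0)
  (f_equal2 (fun u v => (((p n)^-1)%:E * u + g%:E * v)%E) (IH _ _ nuI)
    (eq_trans (slice_step nuI nu'E g n s0 p0) (IH _ _ nu'I))).
set x := nu _; set q := fun k => _.
have xf : x \is a fin_num by apply: fin_num_measure; apply: measurable_ltf; [exact: measurable_cst|exact: measurable_gram_x].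
rewrite -(fineK xf) -!EFinM -EFinD => -[xE]; congr EFin.
have pg : 0 < p n * g by exact: mulr_gt0.
have -> : fine x = ((p n)^-1 * pbtail (s * g) q n m.+1 + g * pbtail (s * g) q n m) / (g + (p n)^-1).
  by rewrite -xE mulrC mulKf// gt_eqF// addr_gt0// invr_gt0.
move: (pbtail (s * g) q n m.+1) (pbtail (s * g) q n m) => S1 S2; field.
by rewrite !gt_eqF// ?addr_gt0.
Qed.

(** * The Laplace functional of the Poisson process *)

Section expectation.
Variables (d : measure_display) (T : measurableType d) (R : realType) (P : probability T R).
Implicit Types (f g : T -> R) (k M : R).

Lemma bounded_integrable (f : T -> R) M : measurable_fun setT f ->
  (forall t, `|f t| <= M) -> P.-integrable setT (EFin \o f).
Proof.
move=> mf fM; apply: (@le_integrable _ _ _ P _ measurableT _ (cst M%:E)).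
- exact/measurable_EFinP.
- by move=> x _ /=; rewrite lee_fin (le_trans (fM x))// ler_norm.
- exact: finite_measure_integrable_cst.
Qed.

Definition expect (f : T -> R) : R := (\int[P]_t f t)%R.

Lemma expectE f M : measurable_fun setT f -> (forall t, `|f t| <= M) ->
  (expect f)%:E = (\int[P]_t (f t)%:E)%E.
Proof.
move=> mf fM; rewrite fineK//; apply: integrable_fin_num => //.
exact: (bounded_integrable mf fM).
Qed.

Lemma expect_cst k : expect (fun=> k) = k.
Proof. by rewrite /expect Rintegral_cst//= probability_setT mulr1. Qed.

Lemma expect_le f g M M' : measurable_fun setT f -> measurable_fun setT g ->
  (forall t, `|f t| <= M) -> (forall t, `|g t| <= M') -> (forall t, f t <= g t) -> expect f <= expect g.
Proof. by move=> mf mg fM gM fg; apply: le_Rintegral => //; exact: bounded_integrable. Qed.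

Lemma expectD f g M M' : measurable_fun setT f -> measurable_fun setT g ->
  (forall t, `|f t| <= M) -> (forall t, `|g t| <= M') -> expect (fun t => f t + g t) = expect f + expect g.
Proof. by move=> mf mg fM gM; apply: RintegralD => //; exact: bounded_integrable. Qed.

Lemma expectZ f k M : measurable_fun setT f -> (forall t, `|f t| <= M) ->
  expect (fun t => k * f t) = k * expect f.
Proof. by move=> mf fM; apply: RintegralZl => //; exact: bounded_integrable. Qed.

Lemma expect_cvg (f_ : nat -> T -> R) f M : (forall n, measurable_fun setT (f_ n)) ->
  measurable_fun setT f -> (forall n t, `|f_ n t| <= M) -> (forall t, f_ ^~ t @ \oo --> f t) ->
  (fun n => expect (f_ n)) @ \oo --> expect f.
Proof.
move=> mf_ mf fM cf.
have fM' t : `|f t| <= M.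
  have h : (fun n => `|f_ n t|) @ \oo --> `|f t| by exact: cvg_norm.
  by apply: (cvgr_to_le h); apply: nearW => n; exact: fM.
have c1 : {ae P, forall t, setT t -> (fun n => (f_ n t)%:E) @ \oo --> (f t)%:E}.
  apply: (@aeW _ T R P) => t _; apply: cvg_EFin; [exact: nearW|exact: cf].
have c2 : {ae P, forall t n, setT t -> (`|(f_ n t)%:E| <= (cst M%:E) t)%E}.
  by apply: (@aeW _ T R P) => t n _ /=; rewrite lee_fin.
have m1 n : measurable_fun setT (fun t => (f_ n t)%:E) by exact/measurable_EFinP.
have m2 : measurable_fun setT (fun t => (f t)%:E) by exact/measurable_EFinP.
have [_ _] := dominated_convergence measurableT m1 m2 c1 (finite_measure_integrable_cst P M measurableT) c2.
rewrite -(expectE mf fM').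
exact: fine_cvg.
Qed.

End expectation.
Lemma expR_series (R : realType) (x : R) : 0 <= x ->
  (\sum_(k <oo) (x ^+ k / k`!%:R)%:E = (expR x)%:E)%E.
Proof.
move=> x0; have h := @is_cvg_series_exp_coeff R x.
rewrite /expR -EFin_lim//; congr (limn _); apply/funext => n /=.
by rewrite /series /= sumEFin.
Qed.

(** Generating function of the Poisson law, taken at [1 - a]. *)
Lemma pois_geo (R : realType) (mu a : R) : 0 <= mu -> 0 <= a <= 1 ->
  (\sum_(k <oo) ((1 - a) ^+ k * pois mu k)%:E = (expR (- (mu * a)))%:E)%E.
Proof.
move=> mu0 /andP[a0 a1].
have -> : expR (- (mu * a)) = expR (- mu) * expR ((1 - a) * mu) by rewrite -expRD; congr expR; ring.
have x0 : 0 <= (1 - a) * mu by rewrite mulr_ge0// subr_ge0.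
rewrite EFinM -(expR_series x0) -nneseriesZl; last first.
  by move=> k _; rewrite lee_fin divr_ge0// exprn_ge0.
apply: eq_eseriesr => k _; rewrite -EFinM; congr EFin.
by rewrite /pois exprMn; ring.
Qed.

Section wt.
Variable R : realType.
Implicit Types (h : nat -> R) (x : \bar R).

(* Counts are extended reals, and that they are almost surely integers is not assumed: [wt h] is 0 off the integers. *)
Definition wt h x : R :=
  let m := xget 0%N [set m : nat | x = m%:R%:E] in if x == m%:R%:E then h m else 0.

Lemma wtE h m : wt h m%:R%:E = h m.
Proof.
rewrite /wt; case: xgetP => [k ->/= /eqP|/(_ m)/=]; last by [].
by rewrite eqe => /eqP /(mulrIn (oner_neq0 R)) <-; rewrite eqxx.
Qed.

Lemma wt0 h x : (forall m : nat, x <> m%:R%:E) -> wt h x = 0.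
Proof. by move=> hx; rewrite /wt; case: eqP => // /hx. Qed.

Lemma wt_case x : (exists m : nat, x = m%:R%:E) \/ forall m : nat, x <> m%:R%:E.
Proof. by have [|h] := pselect (exists m : nat, x = m%:R%:E); [left|right=> m e; apply: h; exists m]. Qed.

Definition delta (m k : nat) : R := (k == m)%:R.

Lemma wt_delta m x : wt (delta m) x = (x == m%:R%:E)%:R.
Proof.
have [[k ->]|h] := wt_case x; last by rewrite wt0//; case: eqP => // /h.
by rewrite wtE /delta eqe eqr_nat.
Qed.

Lemma wt_bnd h x : (forall m, 0 <= h m <= 1) -> 0 <= wt h x <= 1.
Proof.
by move=> h01; have [[k ->]|e] := wt_case x; [rewrite wtE|rewrite wt0// lexx ler01].
Qed.

Lemma wt_series h x c : (forall m, 0 <= h m) -> 0 <= c ->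
  (\sum_(m <oo) (h m * (wt (delta m) x * c))%:E = (wt h x * c)%:E)%E.
Proof.
move=> h0 c0; have [[k ->]|e] := wt_case x; last first.
  by rewrite wt0// mul0r eseries0// => m _ _; rewrite wt0// mul0r mulr0.
rewrite wtE (@nneseriesD1 _ _ k)//; last first.
  by move=> m _; rewrite lee_fin wtE /delta !mulr_ge0.
rewrite eseries0 ?adde0; last first.
  by move=> m _ /= mk; rewrite wtE /delta eq_sym (negbTE mk) mul0r mulr0.
by rewrite wtE /delta eqxx mul1r.
Qed.

End wt.

Section counts.
Variables (R : realType) (d : measure_display) (T : measurableType d) (P : probability T R).
Variables (X : nat -> T -> R * R).
Hypothesis mX : forall k, measurable_fun setT (X k).
Local Notation N A t := (ppcount X A t : \bar R).

Lemma ppcount_series A t : N A t = (\sum_(k <oo) (\1_A (X k t))%:E)%E.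
Proof.
rewrite nneseries_esumT// /ppcount esum_mkcond; apply: eq_esum => k _.
rewrite indicE; have [h|h] := boolP (k \in _); have [h'|h'] := boolP (X k t \in A) => //.
  by move: h h'; rewrite inE/= => h /negP; rewrite inE.
by move: h' h; rewrite inE => h' /negP; rewrite inE.
Qed.

Lemma measurable_ppcount A : measurable A -> measurable_fun setT (fun t => N A t).
Proof.
move=> mA; apply: (eq_measurable_fun (fun t => \sum_(k <oo) (\1_A (X k t))%:E)%E).
  by move=> t _; rewrite ppcount_series.
apply: ge0_emeasurable_sum => // k _; apply/measurable_EFinP.
by apply: (measurableT_comp _ (mX k)); exact: measurable_indic.
Qed.

Definition cnt (A : set (R * R)) n t : nat := (\sum_(k < n) (X k t \in A))%N.

(** A convergent sequence of integers is eventually constant. *)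
Lemma cnt_near A m t : N A t = m%:R%:E -> \forall n \near \oo, cnt A n t = m.
Proof.
rewrite ppcount_series => e.
have c : (fun n => ((cnt A n t)%:R : R)%:E) @ \oo --> (m%:R : R)%:E.
  rewrite -e.
  have -> : (fun n => ((cnt A n t)%:R : R)%:E) = (fun n => \sum_(0 <= k < n) (\1_A (X k t))%:E)%E.
    by apply/funext => n; rewrite sumEFin /cnt natr_sum big_mkord.
  by apply: is_cvg_nneseries => k _ _; rewrite lee_fin.
have h0 : (fun n => (cnt A n t)%:R : R) @ \oo --> (m%:R : R) by exact: (fine_cvg c).
move/cvgrPdist_lt: h0 => /(_ 1 ltr01).
apply: filterS => n /=.
rewrite distrC ltr_distl ltrBlDr !natr1 !ltr_nat !ltnS => h.
by apply/eqP; rewrite eqn_leq andbC.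
Qed.

Lemma measurable_wt_delta A m : measurable A -> measurable_fun setT (fun t => wt (delta R m) (N A t)).
Proof.
move=> mA; apply: (eq_measurable_fun (fun t : T => \1_[set t | N A t = m%:R%:E] t : R)).
  move=> t _; rewrite wt_delta indicE; congr (nat_of_bool _)%:R.
  by apply/idP/eqP; rewrite inE.
apply: measurable_indic; rewrite -[X in measurable X]setTI.
exact: (measurable_ppcount mA measurableT (emeasurable_set1 _)).
Qed.

Lemma measurable_wt A h : measurable A -> (forall m, 0 <= h m) -> measurable_fun setT (fun t => wt h (N A t)).
Proof.
move=> mA h0; apply/measurable_EFinP.
apply: (eq_measurable_fun (fun t => \sum_(m <oo) (h m * (wt (delta R m) (N A t) * 1))%:E)%E).
  by move=> t _; rewrite wt_series// mulr1.
apply: ge0_emeasurable_sum => [m t _ _|m _].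
  by rewrite lee_fin wt_delta mulr_ge0// mulr1.
apply/measurable_EFinP; apply: measurable_funM => //; apply: measurable_funM => //.
exact: measurable_wt_delta.
Qed.

End counts.

Section simple.
Variables (R : realType) (d : measure_display) (T : measurableType d) (P : probability T R).
Variables (X : nat -> T -> R * R) (lam : R).
Hypothesis lam0 : 0 <= lam.
Hypothesis hX : is_PPP P X lam.
Variables (M : nat) (A : 'I_M -> set (R * R)) (a : 'I_M -> R).
Hypothesis mA : forall i, measurable (A i).
Hypothesis fA : forall i, (area (A i) < +oo)%E.
Hypothesis dA : forall i j, i != j -> A i `&` A j = set0.
Hypothesis a01 : forall i, 0 <= a i <= 1.
Local Notation N A t := (ppcount X A t : \bar R).
Let mu i := lam * fine (area (A i)).
Let mX := hX.1.

Let mu0 i : 0 <= mu i.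
Proof. by rewrite mulr_ge0// fine_ge0//; exact: measure_ge0. Qed.

(* Geometric weights on the first [j] regions and prescribed counts on the others, for an induction on [j]. *)
Definition mixed_weight (b : 'I_M -> R) j (m : 'I_M -> nat) (i : 'I_M) : nat -> R :=
  if (i < j)%N then fun k => (1 - b i) ^+ k else delta R (m i).

Let mixed_weight01 (b : 'I_M -> R) j m i k : (forall i, 0 <= b i <= 1) -> 0 <= mixed_weight b j m i k <= 1.
Proof.
move=> b01; rewrite /mixed_weight; case: ifP => _; last by rewrite /delta; case: (k == _); rewrite /= ?lexx ?ler01.
have /andP[b0 b1] := b01 i.
by rewrite exprn_ge0 ?exprn_ile1// ?subr_ge0// lerBlDr lerDl.
Qed.

Lemma measurable_prodr (I : finType) (Q : pred I) (f : I -> T -> R) :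
  (forall i, measurable_fun setT (f i)) -> measurable_fun setT (fun t => \prod_(i | Q i) f i t).
Proof.
move=> mf; rewrite unlock /reducebig; elim: (index_enum I) => //= i s IH.
by case: (Q i) => //=; apply: measurable_funM.
Qed.

(** At [j = 0] this is the joint law of the counts. Passing from [j] to [j.+1] sums over the count
    of one region, which turns a Poisson weight into its generating function. *)
Lemma ppcount_weights (b : 'I_M -> R) j m : (forall i, 0 <= b i <= 1) -> (j <= M)%N ->
  (\int[P]_t (\prod_(i < M) wt (mixed_weight b j m i) (N (A i) t))%:E =
  (\prod_(i < M) (if (i < j)%N then expR (- (mu i * b i)) else pois (mu i) (m i)))%:E)%E.
Proof.
move=> b01; elim: j m => [m _|j IH m jM].
  transitivity (\int[P]_t (\1_[set t | forall i, N (A i) t = (m i)%:R%:E] t)%:E)%E.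
    apply: eq_integral => t _; congr EFin; rewrite indicE.
    have [|h] := boolP (t \in _).
      rewrite inE/= => h; apply: big1 => i _; by rewrite /mixed_weight /= wt_delta h eqxx.
    have [i hi] : exists i, N (A i) t <> (m i)%:R%:E.
      apply: contrapT => h'; move: h => /negP; apply; rewrite inE/= => i.
      by apply: contrapT => h''; apply: h'; exists i.
    by rewrite (bigD1 i)//= /mixed_weight wt_delta; case: eqP => //; rewrite mul0r.
  rewrite integral_indic//; last first.
    have -> : [set t | forall i, N (A i) t = (m i)%:R%:E] = \bigcap_(i in [set: 'I_M]) [set t | N (A i) t = (m i)%:R%:E].
      by apply/seteqP; split => t /= h => [i _|i]; [exact: h|exact: (h i Logic.I)].
    apply: fin_bigcap_measurable => // i _; rewrite -[X in measurable X]setTI.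
    exact: (measurable_ppcount mX (mA i) measurableT (emeasurable_set1 _)).
  rewrite setIT; apply: (eq_trans (hX.2 M A m mA fA dA)).
  by rewrite prodEFin.
pose j' := Ordinal jM.
pose mk k i := if i == j' then k else m i.
pose rest t := \prod_(i < M | i != j') wt (mixed_weight b j.+1 m i) (N (A i) t).
have rest0 t : 0 <= rest t.
  by apply: prodr_ge0 => i _; have /andP[] := wt_bnd (N (A i) t) (fun k => mixed_weight01 j.+1 m i k b01).
have nj i : i != j' -> (i < j.+1)%N = (i < j)%N.
  by move=> ij; rewrite ltnS leq_eqVlt; move: ij; rewrite -(inj_eq val_inj) /= => /negbTE ->.
have E k t : wt (delta R k) (N (A j') t) * rest t = \prod_(i < M) wt (mixed_weight b j (mk k) i) (N (A i) t).
  rewrite [RHS](bigD1 j')//= [mixed_weight b j (mk k) j']/mixed_weight ltnn [mk k j']/mk eqxx; congr (_ * _).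
  by apply: eq_bigr => i ij; rewrite /mixed_weight nj// /mk (negbTE ij).
transitivity (\int[P]_t \sum_(k <oo) ((1 - b j') ^+ k * \prod_(i < M) wt (mixed_weight b j (mk k) i) (N (A i) t))%:E)%E.
  apply: eq_integral => t _; rewrite (bigD1 j')//= [mixed_weight b j.+1 m j']/mixed_weight ltnSn -/(rest t).
  rewrite -wt_series//; last by move=> k; rewrite exprn_ge0// subr_ge0; have /andP[] := b01 j'.
  by apply: eq_eseriesr => k _; rewrite E.
have c0 k : 0 <= (1 - b j') ^+ k by rewrite exprn_ge0// subr_ge0; have /andP[] := b01 j'.
have p0 k t : 0 <= \prod_(i < M) wt (mixed_weight b j (mk k) i) (N (A i) t).
  by apply: prodr_ge0 => i _; have /andP[] := wt_bnd (N (A i) t) (fun l => mixed_weight01 j (mk k) i l b01).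
have mp k : measurable_fun setT (fun t => \prod_(i < M) wt (mixed_weight b j (mk k) i) (N (A i) t)).
  apply: measurable_prodr => i; apply: measurable_wt => // l.
  by have /andP[] := mixed_weight01 j (mk k) i l b01.
rewrite integral_nneseries//; last 2 first.
- by move=> k; apply/measurable_EFinP; apply: measurable_funM.
- by move=> k t _; rewrite lee_fin mulr_ge0.
pose c := \prod_(i < M | i != j') (if (i < j)%N then expR (- (mu i * b i)) else pois (mu i) (m i)).
transitivity (\sum_(k <oo) (c%:E * ((1 - b j') ^+ k * pois (mu j') k)%:E))%E.
  apply: eq_eseriesr => k _.
  under eq_integral do rewrite EFinM.
  rewrite ge0_integralZl_EFin//; [|by move=> t _; rewrite lee_fin|exact/measurable_EFinP].
  rewrite IH ?(ltnW jM)// (bigD1 j')//= ltnn [mk k j']/mk eqxx -!EFinM; congr EFin.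
  rewrite mulrA mulrC; congr (_ * _); by apply: eq_bigr => i ij; rewrite /mk (negbTE ij).
rewrite nneseriesZl//; last first.
  move=> k _; rewrite lee_fin mulr_ge0// /pois mulr_ge0 ?expR_ge0// divr_ge0// exprn_ge0//.
rewrite pois_geo// -EFinM [in RHS](bigD1 j')//= ltnSn mulrC; congr (_ * _)%:E.
by apply: eq_bigr => i ij; rewrite nj.
Qed.

Lemma one_sub_simple x : 1 - \sum_(i < M) a i * \1_(A i) x = \prod_(i < M) (1 - a i) ^+ (x \in A i).
Proof.
have [[j xj]|h] := pselect (exists j, A j x); last first.
  rewrite big1 ?subr0 ?big1// => i _; rewrite ?indicE; have [xi|_] := boolP (x \in A i);
    rewrite ?expr0 ?mulr0//; by exfalso; apply: h; exists i; rewrite inE in xi.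
have out i : i != j -> (x \in A i) = false.
  by move=> ij; apply: memNset => xi; have := dA ij; rewrite -subset0; apply; split; eauto.
rewrite (bigD1 j)//= [in RHS](bigD1 j)//= indicE mem_set// mulr1 expr1.
rewrite big1 ?addr0 ?big1 ?mulr1// => i ij; rewrite ?indicE out// ?mulr0 ?expr0//.
Qed.

Let V n t := \prod_(k < n) (1 - \sum_(i < M) a i * \1_(A i) (X k t)).

Let VE n t : V n t = \prod_(i < M) (1 - a i) ^+ (cnt X (A i) n t).
Proof.
rewrite /V; under eq_bigr do rewrite one_sub_simple.
by rewrite exchange_big /=; apply: eq_bigr => i _; rewrite prodrXr.
Qed.

(** Where all counts are integers, [V n] is eventually equal to the product of geometric weights
    [W], so bounded convergence applies. Multiplying by [F] restricts to that event. *)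
Lemma ppp_laplace_simple : (fun n => expect P (V n)) @ \oo --> \prod_(i < M) expR (- (mu i * a i)).
Proof.
have z01 (i : 'I_M) : 0 <= (fun=> 0 : R) i <= 1 by rewrite lexx ler01.
(* With zero parameters the geometric weights are 1 at integers and 0 elsewhere: [F] is the
   indicator that all counts are finite integers. *)
pose F t := \prod_(i < M) wt (mixed_weight (fun=> 0) M (fun=> 0%N) i) (N (A i) t).
pose W t := \prod_(i < M) wt (mixed_weight a M (fun=> 0%N) i) (N (A i) t).
have pw01 (f : 'I_M -> R) : (forall i, 0 <= f i <= 1) -> 0 <= \prod_(i < M) f i <= 1.
  move=> f01; apply/andP; split; first by apply: prodr_ge0 => i _; have /andP[] := f01 i.
  by apply: prodr_ile1 => i _; exact: f01.
have F01 t : 0 <= F t <= 1 by apply: pw01 => i; apply: wt_bnd => k; exact: mixed_weight01.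
have W01 t : 0 <= W t <= 1 by apply: pw01 => i; apply: wt_bnd => k; exact: mixed_weight01.
have V01 n t : 0 <= V n t <= 1.
  rewrite VE; apply: pw01 => i; have /andP[a0 a1] := a01 i.
  by rewrite exprn_ge0 ?exprn_ile1// ?subr_ge0// lerBlDr lerDl.
have b1 (x : R) : 0 <= x <= 1 -> `|x| <= 1 by move=> /andP[x0 x1]; rewrite ger0_norm.
have mF : measurable_fun setT F.
  apply: measurable_prodr => i; apply: measurable_wt => // k; by have /andP[] := mixed_weight01 M (fun=> 0%N) i k z01.
have mW : measurable_fun setT W.
  apply: measurable_prodr => i; apply: measurable_wt => // k; by have /andP[] := mixed_weight01 M (fun=> 0%N) i k a01.
have mV n : measurable_fun setT (V n).
  apply: measurable_prodr => k; apply: measurable_funB => //.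
  apply: measurable_sum => i; apply: measurable_funM => //.
  by apply: (measurableT_comp _ (mX k)); exact: measurable_indic.
have EF : expect P F = 1.
  apply: EFin_inj; rewrite (expectE P mF (fun t => b1 _ (F01 t))) (ppcount_weights _ z01 (leqnn M)); congr EFin.
  by apply: big1 => i _; rewrite ltn_ord mulr0 oppr0 expR0.
have EW : expect P W = \prod_(i < M) expR (- (mu i * a i)).
  apply: EFin_inj; rewrite (expectE P mW (fun t => b1 _ (W01 t))) (ppcount_weights _ a01 (leqnn M)); congr EFin.
  by apply: eq_bigr => i _; rewrite ltn_ord.
have VF01 n t : 0 <= V n t * F t <= 1.
  have /andP[v0 v1] := V01 n t; have /andP[f0 f1] := F01 t.
  by rewrite mulr_ge0// mulr_ile1.
have mVF n : measurable_fun setT (fun t => V n t * F t) by exact: measurable_funM.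
(* As [F] has expectation 1, inserting it does not change the expectation of a function with values
   between 0 and 1. *)
have E n : expect P (V n) = expect P (fun t => V n t * F t).
  have m1F : measurable_fun setT (fun t => V n t * (1 - F t)).
    by apply: measurable_funM => //; exact: measurable_funB.
  have b1F t : 0 <= V n t * (1 - F t) <= 1.
    have /andP[v0 v1] := V01 n t; have /andP[f0 f1] := F01 t.
    by rewrite mulr_ge0 ?subr_ge0// mulr_ile1 ?subr_ge0// lerBlDr lerDl.
  rewrite (_ : V n = fun t => V n t * F t + V n t * (1 - F t)); last by apply/funext => t; ring.
  rewrite (expectD P (mVF n) m1F (fun t => b1 _ (VF01 n t)) (fun t => b1 _ (b1F t))).
  rewrite (_ : expect P (fun t => V n t * (1 - F t)) = 0) ?addr0//.
    by congr (expect P _); apply/funext => t; ring.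
  apply/eqP; rewrite eq_le; apply/andP; split; last first.
    rewrite -(expect_cst P 0); apply: (@expect_le _ _ _ P _ _ 0 1) => //.
    - by move=> t; rewrite normr0.
    - by move=> t; apply: b1.
    - by move=> t; have /andP[] := b1F t.
  have : expect P (fun t => 1 - F t) = 0.
    rewrite (_ : (fun t => 1 - F t) = (fun t => 1 + (-1) * F t)); last by apply/funext => t; ring.
    rewrite (@expectD _ _ _ P _ _ 1 1)//; last 3 first.
    - exact: measurable_funM.
    - by move=> t; rewrite normr1.
    - by move=> t; rewrite mulN1r normrN; exact: b1.
    by rewrite expect_cst (expectZ P _ mF (fun t => b1 _ (F01 t))) EF mulr1 subrr.
  move=> <-; apply: (@expect_le _ _ _ P _ _ 1 1) => //.
  - exact: measurable_funB.
  - by move=> t; apply: b1.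
  - move=> t; apply: b1; have /andP[f0 f1] := F01 t.
    by rewrite subr_ge0 f1 lerBlDr lerDl.
  - move=> t; have /andP[v0 v1] := V01 n t; have /andP[f0 f1] := F01 t.
    by rewrite ler_piMl// subr_ge0.
rewrite (_ : (fun n => expect P (V n)) = fun n => expect P (fun t => V n t * F t)); last exact/funext.
rewrite -EW; apply: (@expect_cvg _ _ _ P _ _ 1) => // [n t|t]; first exact: b1.
have [[i hi]|h] := pselect (exists i, forall m : nat, N (A i) t <> m%:R%:E).
  have -> : W t = 0 by rewrite /W (bigD1 i)//= wt0// mul0r.
  have F0 : F t = 0 by rewrite /F (bigD1 i)//= wt0// mul0r.
  by rewrite (_ : (fun n => _) = fun=> 0); [exact: cvg_cst|apply/funext => n; rewrite F0 mulr0].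
have {}h i : exists m : nat, N (A i) t = m%:R%:E.
  have [//|h'] := wt_case (N (A i) t); by exfalso; apply: h; exists i.
have [m hm] := choice h.
have F1 : F t = 1 by rewrite /F big1// => i _; rewrite hm wtE /mixed_weight ltn_ord subr0 expr1n.
have WE : W t = \prod_(i < M) (1 - a i) ^+ m i.
  by apply: eq_bigr => i _; rewrite hm wtE /mixed_weight ltn_ord.
rewrite WE; apply: cvg_near_cst.
have : \forall n \near \oo, forall i : 'I_M, cnt X (A i) n t = m i.
  by apply: filter_forall => i; exact: cnt_near (hm i).
apply: filterS => n hn; rewrite F1 mulr1 VE.
by apply: eq_bigr => i _; rewrite hn.
Qed.

End simple.

Section laplace.
Variables (R : realType) (d : measure_display) (T : measurableType d) (P : probability T R).
Variables (X : nat -> T -> R * R) (lam : R).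
Hypothesis lam0 : 0 <= lam.
Hypothesis hX : is_PPP P X lam.
Variables (l : {measure set (R * R)%type -> \bar R}).
Hypothesis lE : forall A, l A = area A.
Variable v : R * R -> R.
Hypothesis mv : measurable_fun setT v.
Hypothesis v01 : forall x, 0 <= v x <= 1.
Hypothesis vf : (\int[l]_x (v x)%:E < +oo)%E.

Let v0 x : 0 <= v x. Proof. by have /andP[] := v01 x. Qed.
Let v1 x : v x <= 1. Proof. by have /andP[] := v01 x. Qed.
Let mX := hX.1.

(** Level sets of [v] with mesh [1 / (m + 1)]. The lowest level is left out, so that all areas are
    finite even if the support of [v] has infinite area. *)
Let A m (i : 'I_m.+1) : set (R * R) := [set x | i.+1%:R <= v x * m.+1%:R < i.+2%:R].
Let a m (i : 'I_m.+1) : R := i.+1%:R / m.+1%:R.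
Let u m x := \sum_(i < m.+1) a i * \1_(A i) x.

Let mA m (i : 'I_m.+1) : measurable (A i).
Proof.
have mf : measurable_fun setT (fun x => v x * m.+1%:R) by exact: measurable_funM.
rewrite -[X in measurable X]setTI.
rewrite (_ : A i = (fun x => v x * m.+1%:R) @^-1` `[i.+1%:R, i.+2%:R[%classic); first exact: mf.
by apply/seteqP; split => x; rewrite /A /= in_itv.
Qed.

Let dA m (i j : 'I_m.+1) : i != j -> A i `&` A j = set0.
Proof.
move=> ij; rewrite -subset0 => x [/= /andP[h1 h2] /andP[h3 h4]].
move/eqP: ij; apply; apply/val_inj/eqP; rewrite eqn_leq.
have := le_lt_trans h1 h4; have := le_lt_trans h3 h2.
by rewrite !ltr_nat !ltnS => -> ->.
Qed.

Let a01 m (i : 'I_m.+1) : 0 <= a i <= 1.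
Proof. by rewrite /a divr_ge0// ler_pdivrMr// mul1r ler_nat ltn_ord. Qed.

Let u_case m x : (exists i : 'I_m.+1, A i x /\ u m x = a i) \/ (v x * m.+1%:R < 1 /\ u m x = 0).
Proof.
have y0 : 0 <= v x * m.+1%:R by rewrite mulr_ge0.
have ym : v x * m.+1%:R <= m.+1%:R by rewrite ler_piMl.
have [y1|y1] := ltP (v x * m.+1%:R) 1.
  right; split => //; rewrite /u big1// => i _; rewrite indicE memNset ?mulr0//= => /andP[h _].
  by have := le_lt_trans h y1; rewrite ltrn1.
left; have /andP[h1 h2] := Num.Theory.truncn_itv y0.
(* Level [k] corresponds to the region of index [k.-1], level 0 being left out. *)
set k := Num.truncn _ in h1 h2.
have k0 : (0 < k)%N by have := le_lt_trans y1 h2; rewrite ltr1n ltnS.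
have km : (k.-1 < m.+1)%N by have := le_trans h1 ym; rewrite ler_nat prednK// => /(leq_ltn_trans _); case: (k) k0.
have Ai : A (Ordinal km) x by rewrite /A /= prednK// h1.
exists (Ordinal km); split => //; rewrite /u (bigD1 (Ordinal km))//= indicE mem_set// mulr1 big1 ?addr0// => i ij.
rewrite indicE memNset ?mulr0// => Aix.
by have := dA ij; rewrite -subset0; apply; split; [exact: Aix|exact: Ai].
Qed.

Let u_bnd m x : 0 <= u m x /\ u m x <= v x <= u m x + m.+1%:R^-1.
Proof.
have [[i [/= /andP[h1 h2] ->]]|[h ->]] := u_case m x; last first.
  by split => //; rewrite v0 add0r -[m.+1%:R^-1]mul1r ler_pdivlMr// ltW.
have /andP[a0 _] := a01 i; split=> //.
rewrite {1}/a ler_pdivrMr// h1 /=.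
rewrite /a -[X in _ <= _ + X]mul1r -mulrDl ler_pdivlMr// natr1.
exact: ltW.
Qed.

Let mu m : measurable_fun setT (u m).
Proof.
by apply: measurable_sum => i; apply: measurable_funM.
Qed.

Let vi : l.-integrable setT (EFin \o v).
Proof.
apply/integrableP; split; first exact/measurable_EFinP.
by rewrite (eq_integral (fun x => (v x)%:E))// => x _ /=; rewrite ger0_norm.
Qed.

(** Markov's inequality: [v] is at least [1 / (m + 1)] on [A i]. *)
Let fA m (i : 'I_m.+1) : (area (A i) < +oo)%E.
Proof.
rewrite -lE -[X in l X]setIT -integral_indic//.
have h : (m.+1%:R%:E * \int[l]_x (v x)%:E < +oo)%E.
  by rewrite lte_mul_pinfty.
apply: le_lt_trans h; rewrite -ge0_integralZl_EFin//; last exact/measurable_EFinP.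
apply: ge0_le_integral => //.
- by apply/measurable_EFinP; exact: measurable_indic.
- by apply: measurable_funeM; exact/measurable_EFinP.
- move=> x _; rewrite -EFinM lee_fin indicE; have [|_] := boolP (x \in A i).
    rewrite inE => /= /andP[h _]; rewrite mulrC; apply: le_trans h; by rewrite ler1n.
  by rewrite mulr_ge0.
- by move=> x _; rewrite lee_fin.
Qed.

Let int_u m : (\int[l]_x (u m x)%:E = (\sum_(i < m.+1) a i * fine (area (A i)))%:E)%E.
Proof.
under eq_integral do rewrite /u -sumEFin.
rewrite ge0_integral_sum//; last 2 first.
- move=> i; apply/measurable_EFinP; apply: measurable_funM => //; exact: measurable_indic.
- by move=> i x _; rewrite lee_fin mulr_ge0//; have /andP[] := a01 i.
rewrite -sumEFin; apply: eq_bigr => i _.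
under eq_integral do rewrite EFinM.
rewrite ge0_integralZl_EFin//; last 2 first.
- by apply/measurable_EFinP; exact: measurable_indic.
- by have /andP[] := a01 i.
rewrite [RHS]EFinM fineK; first by rewrite integral_indic// setIT lE.
by rewrite ge0_fin_numE ?fA// -lE; exact: measure_ge0.
Qed.

Lemma prod_lim n (f : nat -> 'I_n -> R) (g : 'I_n -> R) : (forall k, f ^~ k @ \oo --> g k) ->
  (fun m => \prod_(k < n) f m k) @ \oo --> \prod_(k < n) g k.
Proof.
elim: n f g => [|n IH] f g h.
  by under eq_fun do rewrite big_ord0; rewrite big_ord0; exact: cvg_cst.
under eq_fun do rewrite big_ord_recl; rewrite big_ord_recl.
by apply: cvgM => //; apply: IH => k; exact: h.
Qed.

Let u_cvg x : u ^~ x @ \oo --> v x.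
Proof.
apply: (@squeeze_cvgr _ _ _ _ (fun m => v x - m.+1%:R^-1) (fun=> v x)).
- apply: nearW => m; have [_ /andP[h1 h2]] := u_bnd m x.
  by rewrite h1 andbT lerBlDr.
- rewrite -[X in _ --> X]subr0; apply: cvgB; first exact: cvg_cst.
  exact: cvg_harmonic.
- exact: cvg_cst.
Qed.

Let I := fine (\int[l]_x (v x)%:E)%E.

(** Replacing [v] by [u m] from below gives upper bounds, whose limit in [n] is the case of a simple
    function. For fixed [m] these bounds decrease in [n], hence stay above their limit; letting [m]
    grow gives the lower bound [expR (- (lam * I))] for every [n]. *)
Lemma ppp_laplace :
  (fun n => expect P (fun t => \prod_(k < n) (1 - v (X k t)))) @ \oo --> expR (- (lam * I)).
Proof.
pose V n t := \prod_(k < n) (1 - v (X k t)).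
pose W m n t := \prod_(k < n) (1 - u m (X k t)).
have u01 m x : 0 <= u m x <= 1.
  by have [-> /andP[h _]] := u_bnd m x; rewrite (le_trans h).
have pw01 n (f : 'I_n -> R) : (forall i, 0 <= f i <= 1) -> 0 <= \prod_(i < n) (1 - f i) <= 1.
  move=> f01; apply/andP; split.
    by apply: prodr_ge0 => i _; rewrite subr_ge0; have /andP[] := f01 i.
  by apply: prodr_ile1 => i _; rewrite subr_ge0 lerBlDr lerDl andbC.
have b1 (x : R) : 0 <= x <= 1 -> `|x| <= 1 by move=> /andP[x0 x1]; rewrite ger0_norm.
have V01 n t : 0 <= V n t <= 1 by exact: pw01.
have W01 m n t : 0 <= W m n t <= 1 by exact: pw01.
have mV n : measurable_fun setT (V n).
  apply: measurable_prodr => k; apply: measurable_funB => //.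
  exact: (measurableT_comp mv (mX k)).
have mW m n : measurable_fun setT (W m n).
  apply: measurable_prodr => k; apply: measurable_funB => //.
  exact: (measurableT_comp (mu m) (mX k)).
have VW m n : expect P (V n) <= expect P (W m n).
  apply: (@expect_le _ _ _ P _ _ 1 1) => // [t|t|t]; [exact: b1|exact: b1|].
  apply: ler_prod => k _; have [_ /andP[h _]] := u_bnd m (X k t).
  by rewrite subr_ge0 v1 lerB.
have WV n : (fun m => expect P (W m n)) @ \oo --> expect P (V n).
  apply: (@expect_cvg _ _ _ P _ _ 1) => // [m t|t]; first exact: b1.
  by apply: prod_lim => k; apply: cvgB; [exact: cvg_cst|exact: u_cvg].
pose J m := \sum_(i < m.+1) a i * fine (area (A i)).
have JI : J @ \oo --> I.
  have : [sequence (\int[l]_x (u m x)%:E)%E]_m @ \oo --> (\int[l]_x (v x)%:E)%E.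
    have mu' m : measurable_fun setT (fun x => (u m x)%:E) by apply/measurable_EFinP; exact: mu.
    have mv' : measurable_fun setT (fun x => (v x)%:E) by exact/measurable_EFinP.
    have c1 : {ae l, forall x, setT x -> (fun m => (u m x)%:E) @ \oo --> (v x)%:E}.
      by apply: (@aeW _ _ R l) => x _; apply: cvg_EFin; [exact: nearW|exact: u_cvg].
    have c2 : {ae l, forall x m, setT x -> (`|(u m x)%:E| <= (EFin \o v) x)%E}.
      apply: (@aeW _ _ R l) => x m _ /=; rewrite lee_fin; have [h0 /andP[h _]] := u_bnd m x.
      by rewrite ger0_norm.
    by have [_ _] := dominated_convergence measurableT mu' mv' c1 vi c2.
  have vfin : (\int[l]_x (v x)%:E)%E \is a fin_num.
    by rewrite ge0_fin_numE//; apply: integral_ge0 => x _; rewrite lee_fin.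
  rewrite -(fineK vfin) => /fine_cvg; rewrite -/I; apply: cvg_trans.
  by apply: near_eq_cvg; apply: nearW => m /=; rewrite int_u.
have cJ : (fun m => expR (- (lam * J m))) @ \oo --> expR (- (lam * I)).
  apply: continuous_cvg; first exact: continuous_expR.
  by apply: cvgN; apply: cvgM; [exact: cvg_cst|exact: JI].
have WJ m : (fun n => expect P (W m n)) @ \oo --> expR (- (lam * J m)).
  have := ppp_laplace_simple lam0 hX (@mA m) (@fA m) (@dA m) (@a01 m).
  rewrite -expR_sum; congr (_ --> expR _).
  rewrite /J mulr_sumr -sumrN; apply: eq_bigr => i _; ring.
have Wdec m n : expR (- (lam * J m)) <= expect P (W m n).
  rewrite -(cvg_lim _ (WJ m))//; apply: nonincreasing_cvgn_ge; last by apply: cvgP (WJ m).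
  apply/nonincreasing_seqP => k; apply: (@expect_le _ _ _ P _ _ 1 1) => // [t|t|t]; [exact: b1|exact: b1|].
  rewrite /W big_ord_recr /= ler_piMr//; first by have /andP[] := W01 m k t.
  by rewrite lerBlDr lerDl; have /andP[] := u01 m (X k t).
have low n : expR (- (lam * I)) <= expect P (V n).
  by apply: (ler_cvg_to cJ (WV n)); apply: nearW => m; exact: Wdec.
apply/cvgrPdist_le => e e0.
have e20 : 0 < e / 2 by rewrite divr_gt0.
move/cvgrPdist_le: cJ => /(_ _ e20) [m _ /(_ m (leqnn m)) hm].
move/cvgrPdist_le: (WJ m) => /(_ _ e20); apply: filterS => n hn.
rewrite ler0_norm ?opprB; last by rewrite subr_le0; exact: low.
have := VW m n; rewrite /V; have := Wdec m n.
move: hm hn; rewrite !ler_norml => /andP[h1 _] /andP[h2 _]; lra.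
Qed.

End laplace.

(** * The interference integral *)

Section gamma.
Variable R : realType.
Notation mu := (@lebesgue_measure R).
Notation RR := (R * R)%type.

Lemma measurable_expN : measurable_fun setT (fun r : R => expR (- r)).
Proof. by apply: measurableT_comp => //; exact: measurable_oppr. Qed.

Lemma exp_int : (\int[mu]_(r in `[0%R, +oo[) (expR (- r))%:E = 1)%E.
Proof.
rewrite -(@integral_exponential_pdf R 1 ltr01) [LHS]integral_mkcond.
apply: eq_integral => x _; rewrite /exponential_pdf !patchE.
by case: ifP => // _; rewrite mul1r mulN1r.
Qed.

Lemma exp_tail (x : R) : (\int[mu]_u (if (x <= u)%R then (expR (- u))%:E else 0) = (expR (- x))%:E)%E.
Proof.
pose f (u : R) : \bar R := if 0 <= u then (expR (- u))%:E else 0%E.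
have mf : measurable_fun setT f.
  apply: measurable_fun_ifT => //; first exact: measurable_fun_ler.
  by apply/measurable_EFinP; exact: measurable_expN.
have f0 u : (0 <= f u)%E by rewrite /f; case: ifP => // _; rewrite lee_fin expR_ge0.
transitivity (\int[mu]_u ((expR (- x))%:E * f (1 * u - x)%R))%E.
  apply: eq_integral => u _; rewrite /f mul1r subr_ge0; case: ifP => _; last by rewrite mule0.
  by rewrite -EFinM -expRD; congr (expR _)%:E; ring.
rewrite ge0_integralZl_EFin//; last first.
  by apply: (measurableT_comp mf); apply: measurable_funB => //; exact: measurable_funM.
rewrite (@lebesgue_affine R 1 (- x) f)// normr1 invr1 mul1e.
rewrite (_ : \int[mu]_u f u = 1)%E ?mule1//.
rewrite -exp_int [RHS]integral_mkcond; apply: eq_integral => u _.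
by rewrite patchE /f mem_setE in_itv/= andbT.
Qed.

Lemma pow_int (a u : R) : 0 < a -> 0 < u ->
  (\int[mu]_(x in `]0%R, u]) (a * x `^ (a - 1))%:E = (u `^ a)%:E)%E.
Proof.
move=> a0 u0.
(* The integrand may be singular at 0, so the interval is exhausted by closed ones; [i.+2] makes the
   first of them nondegenerate. *)
pose F i : set R := `[u / i.+2%:R, u]%classic.
have n2 i : 0 < i.+2%:R :> R by [].
have FU : `]0, u]%classic = \bigcup_i F i.
  apply/seteqP; split => x /=.
    rewrite in_itv/= => /andP[x0 xu].
    exists (Num.truncn (u / x)) => //; rewrite /F /= in_itv/= xu andbT.
    have /andP[_ h] := Num.Theory.truncn_itv (ltW (divr_gt0 u0 x0)).
    by rewrite ler_pdivrMr// mulrC -ler_pdivrMr// ltW// (lt_le_trans h)// ler_nat ltnS leqnSn.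
  move=> [i _]; rewrite /F /= !in_itv/= => /andP[h ->]; rewrite andbT.
  by apply: lt_le_trans h; rewrite divr_gt0.
have mf : measurable_fun setT (fun x : R => (a * x `^ (a - 1))%:E).
  by apply/measurable_EFinP; apply: measurable_funM => //; exact: measurable_powR.
have h := @ge0_nondecreasing_set_cvg_integral _ (measurableTypeR R) R F (fun x => (a * x `^ (a - 1))%:E) mu.
rewrite FU; apply: (cvg_unique _ (h _ _ _ _)) => //.
- apply/nondecreasing_seqP => i; rewrite subsetEset => x; rewrite /F /= !in_itv/= => /andP[h1 ->].
  by rewrite andbT (le_trans _ h1)// ler_pM2l// lef_pV2 ?posrE// ler_nat.
- by move=> i; exact: measurable_itv.
- by move=> i; apply: (measurable_funS _ _ mf).
- by move=> i x _; rewrite lee_fin mulr_ge0 ?powR_ge0// ltW.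
have FE i : (\int[mu]_(x in F i) (a * x `^ (a - 1))%:E = (u `^ a - (u / i.+2%:R) `^ a)%:E)%E.
  have ui : 0 < u / i.+2%:R by rewrite divr_gt0.
  have dp (x : R) : 0 < x -> is_derive x 1 (@powR R ^~ a) (a * x `^ (a - 1)) by exact: is_derive1_powR.
  have cp (b x : R) : 0 < x -> {for x, continuous (@powR R ^~ b)}.
    move=> x0; apply: differentiable_continuous; apply/derivable1_diffP.
    by have [] := @is_derive1_powR R b x x0.
  rewrite (@continuous_FTC2 _ _ (@powR R ^~ a)) ?EFinB//.
  - by rewrite ltr_pdivrMr// ltr_pMr// ltr1n.
  - apply: continuous_in_subspaceT => x; rewrite inE /= in_itv/= => /andP[h1 _].
    by apply: cvgM; [exact: cvg_cst|apply: cp; exact: lt_le_trans h1].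
  - split.
    + by move=> x; rewrite in_itv/= => /andP[h1 _]; have [] := dp x (lt_trans ui h1).
    + by apply: cvg_at_right_filter; exact: cp.
    + by apply: cvg_at_left_filter; exact: cp.
  - move=> x; rewrite in_itv/= => /andP[h1 _]; rewrite derive1E.
    by have [_ ->] := dp x (lt_trans ui h1).
rewrite /= (_ : (fun i => (\int[mu]_(x in F i) (a * x `^ (a - 1))%:E)%E) =
  fun i => (u `^ a - (u / i.+2%:R) `^ a)%:E); last exact/funext.
apply: cvg_EFin; first exact: nearW.
rewrite /= -[X in _ --> X]subr0; apply: cvgB; first exact: cvg_cst.
have c0 := @powR_cvg0 R a a0.
move/cvg_at_rightP: c0 => /(_ (fun i => u / i.+2%:R)); apply; split.
  by move=> i; rewrite divr_gt0.
rewrite -[X in _ --> X](mulr0 u); apply: cvgM; first exact: cvg_cst.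
apply: (@squeeze_cvgr _ _ _ _ (fun=> 0) (fun i => i.+1%:R^-1)).
- by apply: nearW => i; rewrite invr_ge0 ler0n lef_pV2 ?posrE ?ltr0n// ler_nat leqnSn.
- exact: cvg_cst.
- exact: cvg_harmonic.
Qed.

Definition Gint (a : R) : \bar R := (\int[mu]_(x in [set x : R | (0 < x)%R]) ((x `^ (a - 1)) * expR (- x))%:E)%E.

Lemma GintE a : Gint a = (\int[mu]_x (if (0 < x)%R then (x `^ (a - 1) * expR (- x))%:E else 0))%E.
Proof.
rewrite /Gint integral_mkcond; apply: eq_integral => x _; rewrite patchE.
have [x0|x0] := ltP 0 x; first by rewrite mem_set.
by rewrite memNset//=; apply/negP; rewrite -leNgt.
Qed.

Lemma measurable_powexp (b : R) : measurable_fun setT (fun x : R => (x `^ b * expR (- x))%:E).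
Proof.
apply/measurable_EFinP; apply: measurable_funM; first exact: measurable_powR.
exact: measurable_expN.
Qed.

(** The power is integrable on the unit interval and at most 1 beyond, where the exponential takes
    over. The range of [a] covers both [2 / alpha] and [1 - 2 / alpha]. *)
Lemma Gint_fin a : 0 < a -> a <= 1 -> (Gint a < +oo)%E.
Proof.
move=> a0 a1; rewrite GintE.
pose f1 (x : R) : \bar R := if (0 < x <= 1)%R then (x `^ (a - 1))%:E else 0%E.
pose f2 (x : R) : \bar R := if (0 <= x)%R then (expR (- x))%:E else 0%E.
have m1 : measurable_fun setT f1.
  apply: measurable_fun_ifT => //.
    by apply: measurable_and; [exact: measurable_fun_ltr|exact: measurable_fun_ler].
  by apply/measurable_EFinP; exact: measurable_powR.
have m2 : measurable_fun setT f2.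
  apply: measurable_fun_ifT => //; first exact: measurable_fun_ler.
  by apply/measurable_EFinP; exact: measurable_expN.
have p1 x : (0 <= f1 x)%E by rewrite /f1; case: ifP => // _; rewrite lee_fin powR_ge0.
have p2 x : (0 <= f2 x)%E by rewrite /f2; case: ifP => // _; rewrite lee_fin expR_ge0.
have i1 : (\int[mu]_x f1 x = (a^-1)%:E)%E.
  have := pow_int a0 ltr01; rewrite powR1 => h.
  transitivity ((a^-1)%:E * \int[mu]_(x in `]0%R, 1%R]) (a * x `^ (a - 1))%:E)%E; last by rewrite h mule1.
  rewrite -ge0_integralZl_EFin//; last 3 first.
  - by move=> x _; rewrite lee_fin mulr_ge0 ?powR_ge0// ltW.
  - apply: measurable_funTS.
    by apply/measurable_EFinP; apply: measurable_funM => //; exact: measurable_powR.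
  - by rewrite invr_ge0 ltW.
  rewrite [RHS]integral_mkcond; apply: eq_integral => x _; rewrite patchE /f1 mem_setE in_itv/=.
  by case: ifP => // _; rewrite -EFinM mulrA mulVf ?gt_eqF// mul1r.
have i2 : (\int[mu]_x f2 x = 1)%E.
  rewrite -exp_int [RHS]integral_mkcond; apply: eq_integral => x _.
  by rewrite patchE /f2 mem_setE in_itv/= andbT.
apply: (@le_lt_trans _ _ (\int[mu]_x (f1 x + f2 x))%E); last first.
  by rewrite ge0_integralD// i1 i2 ltry.
apply: ge0_le_integral => //.
- by move=> x _; case: ifP => // _; rewrite lee_fin mulr_ge0 ?powR_ge0 ?expR_ge0.
- apply: measurable_fun_ifT => //; first exact: measurable_fun_ltr.
  exact: measurable_powexp.
- exact: emeasurable_funD.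
move=> x _; rewrite /f1 /f2; have [x0|x0] := ltP 0 x; last by rewrite add0e; case: ifP => // _; rewrite lee_fin expR_ge0.
rewrite (ltW x0)/=; have [x1|x1] := leP x 1.
  rewrite -EFinD lee_fin; apply: le_trans (_ : x `^ (a - 1) <= _).
    by rewrite ler_piMr ?powR_ge0// -expR0 ler_expR oppr_le0 ltW.
  by rewrite lerDl expR_ge0.
rewrite add0e lee_fin ler_piMl ?expR_ge0//.
by rewrite -[leRHS](powRr0 x); apply: ler_powR; [exact: ltW|rewrite subr_le0].
Qed.

(** Functional equation of Gamma by Tonelli: the power is written as the integral of its derivative,
    and exchanging the integrals leaves an exponential tail. *)
Lemma Gint_succ a : 0 < a ->
  (\int[mu]_u (if (0 < u)%R then (u `^ a * expR (- u))%:E else 0) = a%:E * Gint a)%E.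
Proof.
move=> a0.
pose f (z : RR) : \bar R := if (0 < z.1) && (z.1 <= z.2) then (a * z.1 `^ (a - 1) * expR (- z.2))%:E else 0%E.
have mf : measurable_fun setT f.
  apply: measurable_fun_ifT => //.
    by apply: measurable_and; [exact: measurable_fun_ltr|exact: measurable_fun_ler].
  apply/measurable_EFinP; apply: measurable_funM.
    by apply: measurable_funM => //; apply: (measurableT_comp (@measurable_powR R _)).
  by apply: (measurableT_comp measurable_expN).
have f0 z : (0 <= f z)%E.
  by rewrite /f; case: ifP => // _; rewrite lee_fin !mulr_ge0 ?powR_ge0 ?expR_ge0// ltW.
transitivity (\int[mu]_y \int[mu]_x f (x, y))%E.
  apply: eq_integral => u _; have [u0|u0] := ltP 0 u; last first.
    apply/esym/integral0_eq => x _; rewrite /f /=.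
    case: ifP => [/andP[h1 h2]|_]; last reflexivity.
    by have := lt_le_trans h1 (le_trans h2 u0); rewrite ltxx.
  rewrite mulrC EFinM -(pow_int a0 u0) -ge0_integralZl_EFin//; last 2 first.
  - by move=> x _; rewrite lee_fin mulr_ge0 ?powR_ge0// ltW.
  - apply: measurable_funTS.
    by apply/measurable_EFinP; apply: measurable_funM => //; exact: measurable_powR.
  rewrite integral_mkcond; apply: eq_integral => x _; rewrite patchE /f mem_setE in_itv/=.
  by case: ifP => // _; rewrite -EFinM mulrC.
apply: (eq_trans (esym (plane_fubini mf f0))).
rewrite GintE -ge0_integralZl_EFin//; last 3 first.
- by move=> x _; case: ifP => // _; rewrite lee_fin mulr_ge0 ?powR_ge0 ?expR_ge0.
- apply: measurable_fun_ifT => //; first exact: measurable_fun_ltr.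
  exact: measurable_powexp.
- exact: ltW.
apply: eq_integral => x _; rewrite /f /=; have [x0|x0] := ltP 0 x; last first.
  by rewrite mule0 integral0_eq.
transitivity ((a * x `^ (a - 1))%:E * \int[mu]_u (if (x <= u)%R then (expR (- u))%:E else 0))%E.
  rewrite -ge0_integralZl_EFin//; last 3 first.
  - by move=> u _; case: ifP => // _; rewrite lee_fin expR_ge0.
  - apply: measurable_fun_ifT => //; first exact: measurable_fun_ler.
    by apply/measurable_EFinP; exact: measurable_expN.
  - by rewrite mulr_ge0 ?powR_ge0// ltW.
  by apply: eq_integral => u _ /=; case: ifP => _; rewrite ?mule0// EFinM.
by rewrite exp_tail -!EFinM mulrA.
Qed.

Section interference.
Variables (dl g : R).
Hypotheses (dl0 : 0 < dl) (dl1 : dl < 1) (g0 : 0 < g).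
Let b := dl^-1.
Let b0 : 0 < b. Proof. by rewrite invr_gt0. Qed.

Lemma powR_le_inv (r c : R) : 0 < r -> 0 < c -> (r `^ b <= c) = (r <= c `^ dl).
Proof.
move=> r0 c0; apply/idP/idP => h.
  have -> : r = (r `^ b) `^ dl by rewrite -powRrM /b mulVf ?gt_eqF// powRr1// ltW.
  by apply: ge0_ler_powR => //; rewrite ?nnegrE ?powR_ge0// ltW.
have -> : c = (c `^ dl) `^ b by rewrite -powRrM /b mulfV ?gt_eqF// powRr1// ltW.
by apply: ge0_ler_powR => //; rewrite ?nnegrE ?powR_ge0// ltW.
Qed.

Lemma measurable_powb (y : R) : measurable_fun setT (fun r : R => y * r `^ b).
Proof. by apply: measurable_funM => //; exact: measurable_powR. Qed.

(** The exponential is written as the tail integral [exp_tail]. After the exchange the inner domain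
    is where y r^b is at most [u], an interval of length (u / y)^dl, and the functional equation of
    Gamma concludes. *)
Lemma weibull_int (y : R) : 0 < y ->
  (\int[mu]_r (if (0 < r)%R then (expR (- (y * r `^ b)))%:E else 0) = (y `^ (- dl))%:E * (dl%:E * Gint dl))%E.
Proof.
move=> y0.
pose f (z : RR) : \bar R := if (0 < z.1) && (y * z.1 `^ b <= z.2) then (expR (- z.2))%:E else 0%E.
have mf : measurable_fun setT f.
  apply: measurable_fun_ifT => //.
    apply: measurable_and; first exact: measurable_fun_ltr.
    by apply: measurable_fun_ler => //; exact: (measurableT_comp (measurable_powb y)).
  by apply/measurable_EFinP; apply: (measurableT_comp measurable_expN).
have f0 z : (0 <= f z)%E by rewrite /f; case: ifP => // _; rewrite lee_fin expR_ge0.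
transitivity (\int[mu]_x \int[mu]_u f (x, u))%E.
  apply: eq_integral => r _; have [r0|r0] := ltP 0 r; last first.
    by apply/esym/integral0_eq => u _; rewrite /f /= ltNge r0.
  by rewrite -exp_tail; apply: eq_integral => u _; rewrite /f /= r0.
apply: (eq_trans (plane_fubini mf f0)).
rewrite -Gint_succ// -ge0_integralZl_EFin//; last 3 first.
- by move=> x _; case: ifP => // _; rewrite lee_fin mulr_ge0 ?powR_ge0 ?expR_ge0.
- apply: measurable_fun_ifT => //; first exact: measurable_fun_ltr.
  exact: measurable_powexp.
- exact: powR_ge0.
apply: eq_integral => u _; have [u0|u0] := ltP 0 u; last first.
  rewrite mule0; apply: integral0_eq => r _; rewrite /f /=.
  case: ifP => [/andP[r0 h]|_]; last reflexivity.
  have : 0 < y * r `^ b by rewrite mulr_gt0// powR_gt0.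
  by move=> /lt_le_trans /(_ (le_trans h u0)); rewrite ltxx.
have uy : 0 < u / y by rewrite divr_gt0.
transitivity (\int[mu]_(r in `]0%R, ((u / y) `^ dl)%R]) cst (expR (- u))%:E r)%E.
  rewrite [RHS]integral_mkcond; apply: eq_integral => r _; rewrite patchE /f mem_setE in_itv/=.
  have [r0|//] := ltP 0 r.
  by rewrite mulrC -ler_pdivlMr// powR_le_inv.
rewrite integral_cst//= lebesgue_measure_itv/= lte_fin powR_gt0// oppr0 adde0 -!EFinM.
congr EFin; rewrite powRM ?invr_ge0 ?(ltW u0) ?(ltW y0)//.
rewrite -(powR_inv1 (ltW y0)) -powRrM mulN1r; ring.
Qed.

(** The fraction is the integral of g exp(- u (g + r^b)) over [u > 0]. Integrating in [r] first
    gives [dl] times Gamma at [dl] and the power [- dl] of [u]; the integral in [u] is then Gamma at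
    [1 - dl]. *)
Lemma interference_int :
  (\int[mu]_r (if (0 < r)%R then (g / (g + r `^ b))%:E else 0) =
   (dl * fine (Gint dl) * fine (Gint (1 - dl)) * g `^ dl)%:E)%E.
Proof.
pose f (z : RR) : \bar R := if (0 < z.1) && (0 < z.2) then (g * (expR (- (z.2 * g)) * expR (- (z.2 * z.1 `^ b))))%:E else 0%E.
have mf : measurable_fun setT f.
  apply: measurable_fun_ifT => //.
    by apply: measurable_and; exact: measurable_fun_ltr.
  apply/measurable_EFinP; apply: measurable_funM => //; apply: measurable_funM.
    by apply: (measurableT_comp measurable_expN); exact: measurable_funM.
  apply: (measurableT_comp measurable_expN); apply: measurable_funM => //.
  by apply: (measurableT_comp (@measurable_powR R _)).
have f0 z : (0 <= f z)%E.
  by rewrite /f; case: ifP => // _; rewrite lee_fin !mulr_ge0 ?expR_ge0// ltW.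
pose hE (u : R) : \bar R := if 0 < u then (expR (- u))%:E else 0%E.
have mE : measurable_fun setT hE.
  apply: measurable_fun_ifT => //; first exact: measurable_fun_ltr.
  by apply/measurable_EFinP; exact: measurable_expN.
have hE0 x : (0 <= hE x)%E by rewrite /hE; case: ifP => // _; rewrite lee_fin expR_ge0.
have hE1 : (\int[mu]_u hE u = 1)%E.
  rewrite -exp_int -integral_itv_obnd_cbnd; last first.
    by apply: measurable_funTS; apply/measurable_EFinP; exact: measurable_expN.
  by rewrite [RHS]integral_mkcond; apply: eq_integral => u _; rewrite patchE /hE mem_setE in_itv/= andbT.
transitivity (\int[mu]_x \int[mu]_u f (x, u))%E.
  apply: eq_integral => r _; have [r0|r0] := ltP 0 r; last first.
    by apply/esym/integral0_eq => u _; rewrite /f /= ltNge r0.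
  pose k := g + r `^ b; have k0 : 0 < k by rewrite addr_gt0// powR_gt0.
  transitivity (g%:E * \int[mu]_u hE (k * u + 0)%R)%E.
    rewrite (@lebesgue_affine R k 0 hE) ?gt_eqF//.
    by rewrite hE1 mule1 -EFinM gtr0_norm.
  rewrite -ge0_integralZl_EFin//; last 2 first.
  - by apply: (measurableT_comp mE); apply: measurable_funD => //; exact: measurable_funM.
  - exact: ltW.
  apply: eq_integral => u _; rewrite /f /hE /= r0 addr0 pmulr_rgt0//=.
  case: ifP => _; last by rewrite mule0.
  by rewrite -EFinM -expRD; congr (_ * expR _)%:E; rewrite /k; ring.
apply: (eq_trans (plane_fubini mf f0)).
have G1 : Gint dl \is a fin_num.
  rewrite ge0_fin_numE; last by apply: integral_ge0 => x _; rewrite lee_fin mulr_ge0 ?powR_ge0 ?expR_ge0.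
  by apply: Gint_fin => //; exact: ltW.
have dl' : 0 < 1 - dl by rewrite subr_gt0.
have G2 : Gint (1 - dl) \is a fin_num.
  rewrite ge0_fin_numE; last by apply: integral_ge0 => x _; rewrite lee_fin mulr_ge0 ?powR_ge0 ?expR_ge0.
  by apply: Gint_fin => //; rewrite lerBlDr lerDl ltW.
have Gp : 0 <= fine (Gint dl).
  by rewrite fine_ge0//; apply: integral_ge0 => x _; rewrite lee_fin mulr_ge0 ?powR_ge0 ?expR_ge0.
pose h (x : R) : \bar R := if 0 < x then (x `^ (- dl) * expR (- x))%:E else 0%E.
have mh : measurable_fun setT h.
  apply: measurable_fun_ifT => //; first exact: measurable_fun_ltr.
  exact: measurable_powexp.
have h0 x : (0 <= h x)%E by rewrite /h; case: ifP => // _; rewrite lee_fin mulr_ge0 ?powR_ge0 ?expR_ge0.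
(* The power of [u] is turned into a power of [g * u], the variable of the last integral; that
   rescaling takes back one factor [g]. *)
pose c := dl * fine (Gint dl) * (g * g `^ dl).
have c0 : 0 <= c by rewrite !mulr_ge0 ?powR_ge0// ltW.
transitivity (\int[mu]_u (c%:E * h (g * u + 0)%R))%E.
  apply: eq_integral => y _; rewrite /h addr0 pmulr_rgt0//.
  have [y0|y0] := ltP 0 y; last first.
    by rewrite mule0; apply: integral0_eq => x _; rewrite /f /= [0 < y]ltNge y0 andbF.
  transitivity ((g * expR (- (y * g)))%:E * \int[mu]_r (if (0 < r)%R then (expR (- (y * r `^ b)))%:E else 0))%E.
    rewrite -ge0_integralZl_EFin//; last 3 first.
    - by move=> x _; case: ifP => // _; rewrite lee_fin expR_ge0.
    - apply: measurable_fun_ifT => //; first exact: measurable_fun_ltr.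
      by apply/measurable_EFinP; apply: (measurableT_comp measurable_expN); exact: measurable_powb.
    - by rewrite mulr_ge0 ?expR_ge0// ltW.
    apply: eq_integral => x _; rewrite /f /= y0 andbT.
    by case: ifP => _; rewrite ?mule0// -EFinM mulrA.
  rewrite weibull_int// -(fineK G1) -!EFinM; congr EFin.
  rewrite /c powRM ?(ltW g0) ?(ltW y0)// [y * g]mulrC powRN.
  have gd0 : g `^ dl != 0 by rewrite gt_eqF// powR_gt0.
  rewrite [g `^ (- dl)]powRN; field.
  by rewrite gd0 gt_eqF// powR_gt0.
rewrite ge0_integralZl_EFin//; last first.
  by apply: (measurableT_comp mh); apply: measurable_funD => //; exact: measurable_funM.
rewrite (@lebesgue_affine R g 0 _ _ mh) ?gt_eqF// gtr0_norm//.
have -> : (\int[mu]_x h x = Gint (1 - dl))%E.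
  by rewrite GintE; apply: eq_integral => x _; rewrite /h addrAC subrr add0r.
rewrite -(fineK G2) -!EFinM; congr EFin; rewrite /c; field.
by rewrite gt_eqF.
Qed.

End interference.

End gamma.

Lemma area_measure_ex (R : realType) : exists l : {measure set (R * R)%type -> \bar R},
  (forall A, l A = area A) /\ forall f : R * R -> \bar R, measurable_fun setT f -> (forall x, 0 <= f x)%E ->
   (\int[l]_x f x = \int[@lebesgue_measure R]_x \int[@lebesgue_measure R]_y f (x, y))%E.
Proof.
pose mu := @lebesgue_measure R.
pose l0 : {measure set (measurableTypeR R * measurableTypeR R)%type -> \bar R} := (mu \x mu)%E.
pose idf : (measurableTypeR R * measurableTypeR R)%type -> (R * R)%type := id.
have mid : measurable_fun setT idf.
  by move=> _ Y mY; rewrite setTI; exact: mY.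
have [l lE] := pushforward_measure_ex l0 mid.
exists l; split => // f mf f0.
pose p := pushforward l0 idf.
transitivity (\int[l0]_x f x)%E; last exact: (@fubini_tonelli1 _ _ _ _ _ mu mu f).
transitivity (\int[pushforward l0 idf]_x f x)%E; first by apply: eq_measure_integral => A _ _; rewrite lE.
by rewrite ge0_integral_pushforward//= preimage_setT.
Qed.

Lemma measurable_inv_ge0 (R : realType) d (T : measurableType d) (f : T -> R) :
  measurable_fun setT f -> (forall x, 0 <= f x) -> measurable_fun setT (fun x => (f x)^-1).
Proof.
move=> mf f0; apply: (eq_measurable_fun (fun x => f x `^ (-1))).
  by move=> x _; rewrite powR_inv1.
exact: (measurableT_comp (@measurable_powR R _)).
Qed.

Lemma measurable_odds (R : realType) d (T : measurableType d) (f : T -> R) :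
  measurable_fun setT f -> (forall x, 0 <= f x) -> measurable_fun setT (fun x => f x / (1 + f x)).
Proof.
move=> mf f0; apply: measurable_funM => //; apply: measurable_inv_ge0; first exact: measurable_funD.
by move=> x; rewrite addr_ge0.
Qed.

Section interf.
Variables (R : realType) (alpha : R).
Hypothesis alpha2 : 2 < alpha.

(** The Bernoulli parameter contributed by an interferer located at [x]. *)
Definition satur (g : R) (x : R * R) : R := pathloss alpha x * g / (1 + pathloss alpha x * g).

Lemma pathloss_ge0 x : 0 <= pathloss alpha x. Proof. exact: powR_ge0. Qed.

Lemma measurable_pathloss : measurable_fun setT (pathloss alpha).
Proof. by apply: (measurableT_comp (@measurable_powR R _)); exact: measurable_sqnorm. Qed.

Lemma satur01 g x : 0 < g -> 0 <= satur g x <= 1.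
Proof.
move=> g0; have p0 := pathloss_ge0 x; have pg : 0 <= pathloss alpha x * g by rewrite mulr_ge0// ltW.
have d0 : 0 < 1 + pathloss alpha x * g by rewrite ltr_wpDr.
rewrite /satur divr_ge0//=; last exact: ltW.
by rewrite ler_pdivrMr// mul1r lerDr.
Qed.

Lemma measurable_satur g : 0 < g -> measurable_fun setT (satur g).
Proof.
move=> g0; apply: measurable_odds; last by move=> x; rewrite mulr_ge0 ?pathloss_ge0// ltW.
by apply: measurable_funM => //; exact: measurable_pathloss.
Qed.

(** In the variable r = |x|^2 the path loss is a power of exponent [- (alpha / 2)], whence
    [2 / alpha] in the result. The factor [c] will be [1 - z] in the generating function and 1 for
    the interference at one antenna. *)
Lemma satur_int (l : {measure set (R * R)%type -> \bar R}) g c : 0 < g -> 0 <= c ->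
  (forall f : R * R -> \bar R, measurable_fun setT f -> (forall x, 0 <= f x)%E ->
   (\int[l]_x f x = \int[@lebesgue_measure R]_x \int[@lebesgue_measure R]_y f (x, y))%E) ->
  (\int[l]_x (c * satur g x)%:E = (c * (Delta alpha * g `^ (2 / alpha)))%:E)%E.
Proof.
move=> g0 c0 lI.
have al0 : 0 < alpha by exact: lt_trans alpha2.
pose F (r : R) : \bar R := (c * (r `^ (- (alpha / 2)) * g / (1 + r `^ (- (alpha / 2)) * g)))%:E.
have F0 r : (0 <= F r)%E.
  by rewrite lee_fin mulr_ge0// divr_ge0// ?addr_ge0// mulr_ge0 ?powR_ge0// ltW.
have mF : measurable_fun setT F.
  apply/measurable_EFinP; apply: measurable_funM => //; apply: measurable_odds.
    by apply: measurable_funM => //; exact: measurable_powR.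
  by move=> x; rewrite mulr_ge0 ?powR_ge0// ltW.
rewrite lI; last 2 first.
- by apply/measurable_EFinP; apply: measurable_funM => //; exact: measurable_satur.
- by move=> x; rewrite lee_fin mulr_ge0//; have /andP[] := satur01 x g0.
transitivity (\int[@lebesgue_measure R]_x \int[@lebesgue_measure R]_y F (x ^+ 2 + y ^+ 2)%R)%E; first by [].
rewrite radial// -integral_itv_obnd_cbnd; last exact: measurable_funTS.
have dl0 : 0 < 2 / alpha by rewrite divr_gt0.
have dl1 : 2 / alpha < 1 by rewrite ltr_pdivrMr// mul1r.
transitivity (pi%:E * (c%:E * \int[@lebesgue_measure R]_r (if (0 < r)%R then (g / (g + r `^ ((2 / alpha)^-1)))%:E else 0)))%E.
  congr (_ * _)%E; rewrite -ge0_integralZl_EFin//; last 2 first.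
  - by move=> x _; case: ifP => // _; rewrite lee_fin divr_ge0// ?addr_ge0 ?powR_ge0// ltW.
  - apply: measurable_fun_ifT => //; first exact: measurable_fun_ltr.
    apply/measurable_EFinP; apply: measurable_funM => //; apply: measurable_inv_ge0.
      by apply: measurable_funD => //; exact: measurable_powR.
    by move=> x; rewrite addr_ge0 ?powR_ge0// ltW.
  rewrite [LHS]integral_mkcond; apply: eq_integral => r _; rewrite patchE mem_setE in_itv/= andbT.
  case: ifP => [r0|_]; last by rewrite mule0.
  rewrite /F -EFinM invf_div powRN; congr (_ * _)%:E.
  have h : 0 < r `^ (alpha / 2) by exact: powR_gt0.
  by field; apply/andP; split; apply: lt0r_neq0; rewrite ?addr_gt0.
rewrite interference_int// -!EFinM; congr EFin.
rewrite /Delta -[Gamma (2 / alpha)]/(fine (Gint (2 / alpha))) -[Gamma (1 - _)]/(fine (Gint (1 - 2 / alpha))).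
ring.
Qed.

Variables (d : measure_display) (T : measurableType d) (P : probability T R).
Variables (X : nat -> T -> R * R) (lam : R).
Hypothesis lam0 : 0 <= lam.
Hypothesis hX : is_PPP P X lam.

Lemma satur_laplace g c : 0 < g -> 0 <= c <= 1 ->
  (fun n => expect P (fun t => \prod_(k < n) (1 - c * satur g (X k t)))) @ \oo -->
  expR (- (c * (lam * Delta alpha * g `^ (2 / alpha)))).
Proof.
move=> g0 /andP[c0 c1]; have [l [lE lI]] := area_measure_ex R.
have vI := satur_int g0 c0 lI.
have v01 x : 0 <= c * satur g x <= 1.
  have /andP[s0 s1] := satur01 x g0.
  by rewrite mulr_ge0// mulr_ile1.
have mv : measurable_fun setT (fun x => c * satur g x) by apply: measurable_funM => //; exact: measurable_satur.
have vf : (\int[l]_x (c * satur g x)%:E < +oo)%E by rewrite vI ltry.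
have := ppp_laplace lam0 hX lE mv v01 vf.
rewrite vI /=; congr (_ --> expR (- _)); ring.
Qed.

End interf.

Section generating.
Variable R : realType.

(** * From generating functions to Poisson tails *)

Lemma exp_coeff_tail (M N : nat) (y z : R) : 0 <= y -> 0 <= z <= 1 -> (M <= N)%N ->
  0 <= \sum_(M <= j < N) (y * z) ^+ j / j`!%:R <= z ^+ M * \sum_(M <= j < N) y ^+ j / j`!%:R.
Proof.
move=> y0 /andP[z0 z1] MN; apply/andP; split.
  by apply: sumr_ge0 => j _; rewrite divr_ge0// exprn_ge0// mulr_ge0.
rewrite mulr_sumr big_nat [leRHS]big_nat; apply: ler_sum => j /andP[Mj _].
rewrite exprMn mulrA ler_pM2r ?invr_gt0 ?ltr0n ?fact_gt0// mulrC.
by rewrite ler_wpM2r ?exprn_ge0// ler_wiXn2l.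
Qed.

(** Termwise comparison of two remainders of the exponential series: from rank [M] on, each term
    gains a factor at most [z ^+ M]. *)
Lemma exp_tail_scale (M : nat) (y z : R) : 0 <= y -> 0 <= z <= 1 ->
  0 <= expR (y * z) - \sum_(j < M) (y * z) ^+ j / j`!%:R <=
  z ^+ M * (expR y - \sum_(j < M) y ^+ j / j`!%:R).
Proof.
move=> y0 z01.
have c (x : R) : (fun N => \sum_(M <= j < N) x ^+ j / j`!%:R) @ \oo --> expR x - \sum_(j < M) x ^+ j / j`!%:R.
  have h : series (exp_coeff x) @ \oo --> expR x by exact: is_cvg_series_exp_coeff.
  have : (fun N => series (exp_coeff x) N - \sum_(j < M) x ^+ j / j`!%:R) @ \oo --> expR x - \sum_(j < M) x ^+ j / j`!%:R.
    by apply: cvgB => //; exact: cvg_cst.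
  apply: cvg_trans; apply: near_eq_cvg; near=> N.
  rewrite /series /= (@big_cat_nat _ _ _ M)//=; last by near: N; exact: nbhs_infty_ge.
  by rewrite big_mkord addrAC subrr add0r.
have c2 : (fun N => z ^+ M * \sum_(M <= j < N) y ^+ j / j`!%:R) @ \oo --> z ^+ M * (expR y - \sum_(j < M) y ^+ j / j`!%:R).
  by apply: cvgM; [exact: cvg_cst|exact: c].
apply/andP; split.
  apply: (ler_cvg_to (cvg_cst 0) (c (y * z))); near=> N.
  have MN : (M <= N)%N by near: N; exact: nbhs_infty_ge.
  by have /andP[] := exp_coeff_tail y0 z01 MN.
apply: (ler_cvg_to (c (y * z)) c2); near=> N.
have MN : (M <= N)%N by near: N; exact: nbhs_infty_ge.
by have /andP[] := exp_coeff_tail y0 z01 MN.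
Unshelve. all: by end_near. Qed.

(** Summation by parts: consecutive values of [ptail] differ by one Poisson weight. *)
Lemma ptail_abel (M : nat) (y z : R) : (1 - z) * \sum_(i < M) ptail i.+1 y * z ^+ i =
  \sum_(j < M) (y * z) ^+ j / j`!%:R * expR (- y) - z ^+ M * ptail M y.
Proof.
elim: M => [|M IH]; first by rewrite !big_ord0 /ptail big_ord0 !mulr0 subr0.
rewrite big_ord_recr /= mulrDr IH [in RHS]big_ord_recr /=.
rewrite {2 3}/ptail big_ord_recr /= -/(ptail M y) exprMn exprS; ring.
Qed.

(** The error is the remainder of the exponential series plus the boundary term of the summation by
    parts; together they are at most [z ^+ M] times the total mass 1. *)
Lemma ptail_gf (M : nat) (y z : R) : 0 <= y -> 0 <= z <= 1 ->
  0 <= expR (- (y * (1 - z))) - (1 - z) * \sum_(i < M) ptail i.+1 y * z ^+ i <= z ^+ M.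
Proof.
move=> y0 z01; rewrite ptail_abel -mulr_suml.
have -> : expR (- (y * (1 - z))) = expR (y * z) * expR (- y) by rewrite -expRD; congr expR; ring.
have /andP[h1 h2] := exp_tail_scale M y0 z01; have /andP[z0 z1] := z01.
have zM : 0 <= z ^+ M by rewrite exprn_ge0.
have e0 := expR_gt0 (- y).
have pE : ptail M y = (\sum_(j < M) y ^+ j / j`!%:R) * expR (- y) by rewrite /ptail mulr_suml.
have e1 : expR y * expR (- y) = 1 by rewrite -expRD subrr expR0.
move: h1 h2 pE; set A := expR (y * z); set B := \sum_(j < M) _; set C := \sum_(j < M) _ => h1 h2 pE.
have p0 := ptail_ge0 M y0.
rewrite opprB addrCA -mulrBl addrC; apply/andP; split.
  by rewrite addr_ge0 ?mulr_ge0// ltW.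
have e3 : z ^+ M * (expR y - C) * expR (- y) = z ^+ M - z ^+ M * ptail M y.
  by rewrite -mulrA mulrBl e1 pE mulrBr mulr1.
have := ler_wpM2r (ltW e0) h2; rewrite e3; lra.
Qed.

(* The generating function in [L] is truncated at [M] terms with error at most [z ^+ M], so that no power series is needed. *)
Lemma pbtail_gf (q : nat -> R) n (M : nat) (y z : R) : 0 <= y -> 0 <= z <= 1 ->
  (forall k, 0 <= q k <= 1) ->
  0 <= expR (- (y * (1 - z))) * \prod_(k < n) (1 - (1 - z) * q k) -
    (1 - z) * \sum_(i < M) pbtail y q n i.+1 * z ^+ i <= z ^+ M.
Proof.
move=> y0 z01 q01; have /andP[z0 z1] := z01.
elim: n M => [|n IH] M.
  by rewrite big_ord0 mulr1; exact: ptail_gf.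
have /andP[q0 q1] := q01 n.
rewrite big_ord_recr /=; set G := expR _; set Q := \prod_(k < n) _.
case: M => [|M].
  have := IH 0%N; rewrite !big_ord0 !mulr0 !subr0 expr0 -/G -/Q => /andP[h0 h1].
  have w0 : 0 <= 1 - (1 - z) * q n by rewrite subr_ge0 mulr_ile1// ?subr_ge0// lerBlDr lerDl.
  rewrite mulrA mulr_ge0//= mulr_ile1//.
  by rewrite lerBlDr lerDl mulr_ge0// subr_ge0.
have /andP[a0 a1] := IH M.+1; have /andP[b0 b1] := IH M.
(* One antenna fewer amounts to a multiplication by [z]; the term of index 0 vanishes because
   [pbtail] is 0 without antennas. *)
have -> : \sum_(i < M.+1) ((1 - q n) * pbtail y q n i.+1 + q n * pbtail y q n i) * z ^+ i =
  (1 - q n) * (\sum_(i < M.+1) pbtail y q n i.+1 * z ^+ i) + q n * z * (\sum_(i < M) pbtail y q n i.+1 * z ^+ i).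
  under eq_bigr do rewrite mulrDl.
  rewrite big_split /= mulr_sumr [in X in _ + X = _]big_ord_recl pbtail0 mulr0 mul0r add0r mulr_sumr.
  by congr (_ + _); apply: eq_bigr => i _; rewrite ?lift0 ?exprS; ring.
move: a0 a1 b0 b1; rewrite -/G -/Q exprS; move: (\sum_(i < M.+1) _) (\sum_(i < M) _) => S1 S2 a0 a1 b0 b1.
have qz : 0 <= q n * z by rewrite mulr_ge0.
have q' : 0 <= 1 - q n by rewrite subr_ge0.
(* The error is the average, with weights [1 - q n] and [q n], of the error at rank [M.+1] and of
   [z] times the error at rank [M]; both are at most [z ^+ M.+1]. *)
have -> : G * (Q * (1 - (1 - z) * q n)) - (1 - z) * ((1 - q n) * S1 + q n * z * S2) =
  (1 - q n) * (G * Q - (1 - z) * S1) + q n * z * (G * Q - (1 - z) * S2) by ring.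
rewrite addr_ge0 ?mulr_ge0//=.
have := lerD (ler_wpM2l q' a1) (ler_wpM2l qz b1); move/le_trans; apply.
by rewrite le_eqVlt; apply/orP; left; apply/eqP; ring.
Qed.

Lemma sum_lim n (f : nat -> 'I_n -> R) (g : 'I_n -> R) : (forall k, f ^~ k @ \oo --> g k) ->
  (fun m => \sum_(k < n) f m k) @ \oo --> \sum_(k < n) g k.
Proof.
elim: n f g => [|n IH] f g h.
  by under eq_fun do rewrite big_ord0; rewrite big_ord0; exact: cvg_cst.
under eq_fun do rewrite big_ord_recl; rewrite big_ord_recl.
by apply: cvgD => //; apply: IH => k; exact: h.
Qed.

(* Convergence of the coefficients one after the other, by letting [z] tend to 0. *)
Lemma coef_cvg (b_ : nat -> nat -> R) (b : nat -> R) (H_ : R -> nat -> R) (H : R -> R) :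
  (forall z, 0 < z < 1 -> H_ z @ \oo --> H z) ->
  (forall z n M, 0 < z < 1 -> `|H_ z n - (1 - z) * \sum_(i < M) b_ n i * z ^+ i| <= z ^+ M) ->
  (forall z M, 0 < z < 1 -> `|H z - (1 - z) * \sum_(i < M) b i * z ^+ i| <= z ^+ M) ->
  forall i, b_ ^~ i @ \oo --> b i.
Proof.
move=> hH h_ h i; elim/ltn_ind: i => i IH.
apply/cvgrPdist_le => e e0.
(* The error on coefficient [i] is at most [z + z + e / 8] divided by [1 - z]. The first cap bounds
   this divisor below by one half, and the second then gives at most [e / 2]. *)
pose z := Num.min (2^-1) (e / 16).
have z0 : 0 < z by rewrite lt_min invr_gt0 ltr0n divr_gt0.
have zh : z <= 2^-1 by rewrite ge_min lexx.
have ze : z <= e / 16 by rewrite ge_min lexx orbT.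
have z01 : 0 < z < 1 by rewrite z0 (le_lt_trans zh)// invf_lt1// ltr1n.
have zi : 0 < z ^+ i by rewrite exprn_gt0.
have c0 : 0 < e / 8 * z ^+ i by rewrite mulr_gt0// divr_gt0.
(* Everything that tends to 0 at fixed [z]: the generating functions by hypothesis, the lower
   coefficients by induction. *)
pose A n := (H_ z n - H z) + (1 - z) * \sum_(j < i) (b j - b_ n j) * z ^+ j.
have cA : A @ \oo --> 0.
  rewrite (_ : 0 = (H z - H z) + (1 - z) * \sum_(j < i) (b j - b j) * z ^+ j); last first.
    by rewrite subrr big1 ?mulr0 ?addr0// => j _; rewrite subrr mul0r.
  apply: cvgD; first by apply: cvgB; [exact: hH|exact: cvg_cst].
  apply: cvgM; first exact: cvg_cst.
  apply: sum_lim => j; apply: cvgM; last exact: cvg_cst.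
  by apply: cvgB; [exact: cvg_cst|apply: IH; exact: ltn_ord].
move/cvgrPdist_le: cA => /(_ _ c0); apply: filterS => n.
rewrite sub0r normrN => hA.
have E : (1 - z) * z ^+ i * (b i - b_ n i) =
  (H_ z n - (1 - z) * \sum_(j < i.+1) b_ n j * z ^+ j) - (H z - (1 - z) * \sum_(j < i.+1) b j * z ^+ j) - A n.
  rewrite /A !big_ord_recr /=.
  have -> : \sum_(j < i) (b j - b_ n j) * z ^+ j = \sum_(j < i) b j * z ^+ j - \sum_(j < i) b_ n j * z ^+ j.
    by rewrite -sumrB; apply: eq_bigr => j _; rewrite mulrBl.
  ring.
have B1 := h_ z n i.+1 z01; have B2 := h z i.+1 z01.
have B : `|(1 - z) * z ^+ i * (b i - b_ n i)| <= z ^+ i * (z + z + e / 8).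
  rewrite E (le_trans (ler_normB _ _))// (le_trans (lerD (ler_normB _ _) hA))//.
  have -> : z ^+ i * (z + z + e / 8) = z ^+ i.+1 + z ^+ i.+1 + e / 8 * z ^+ i by rewrite exprS; ring.
  by rewrite lerD2r lerD.
have z1 : 2^-1 <= 1 - z by lra.
have z1' : 0 < 1 - z by rewrite (lt_le_trans _ z1)// invr_gt0.
rewrite !normrM (gtr0_norm z1') (gtr0_norm zi) mulrAC mulrC ler_pM2l// in B.
have := ler_wpM2r (normr_ge0 (b i - b_ n i)) z1; move: B.
move: (`|b i - b_ n i|) => u; lra.
Qed.

End generating.

Section bounded_mfun.
Variables (d : measure_display) (T : measurableType d) (R : realType) (P : probability T R).
Implicit Types (f g : T -> R).

Definition bounded_mfun f := measurable_fun setT f /\ exists M, forall t, `|f t| <= M.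

Lemma bm_cst k : bounded_mfun (fun=> k). Proof. by split => //; exists `|k|. Qed.

Lemma bmD f g : bounded_mfun f -> bounded_mfun g -> bounded_mfun (fun t => f t + g t).
Proof.
move=> [mf [M fM]] [mg [N gN]]; split; first exact: measurable_funD.
by exists (M + N) => t; rewrite (le_trans (ler_normD _ _))// lerD.
Qed.

Lemma bmM f g : bounded_mfun f -> bounded_mfun g -> bounded_mfun (fun t => f t * g t).
Proof.
move=> [mf [M fM]] [mg [N gN]]; split; first exact: measurable_funM.
by exists (M * N) => t; rewrite normrM ler_pM.
Qed.

Lemma bm01 f : measurable_fun setT f -> (forall t, 0 <= f t <= 1) -> bounded_mfun f.
Proof. by move=> mf f01; split => //; exists 1 => t; have /andP[f0 f1] := f01 t; rewrite ger0_norm. Qed.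

Lemma bm_sum n (f : nat -> T -> R) : (forall i, bounded_mfun (f i)) -> bounded_mfun (fun t => \sum_(i < n) f i t).
Proof.
move=> bf; elim: n => [|n IH].
  by under eq_fun do rewrite big_ord0; exact: bm_cst.
by under eq_fun do rewrite big_ord_recr /=; exact: bmD.
Qed.

Lemma bm_expectD f g : bounded_mfun f -> bounded_mfun g -> expect P (fun t => f t + g t) = expect P f + expect P g.
Proof. by move=> [mf [M fM]] [mg [N gN]]; exact: expectD fM gN. Qed.

Lemma bm_expectZ f k : bounded_mfun f -> expect P (fun t => k * f t) = k * expect P f.
Proof. by move=> [mf [M fM]]; exact: expectZ fM. Qed.

Lemma bm_expect_le f g : bounded_mfun f -> bounded_mfun g -> (forall t, f t <= g t) -> expect P f <= expect P g.
Proof. by move=> [mf [M fM]] [mg [N gN]]; exact: expect_le fM gN. Qed.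

Lemma bm_expect_sum n (f : nat -> T -> R) : (forall i, bounded_mfun (f i)) ->
  expect P (fun t => \sum_(i < n) f i t) = \sum_(i < n) expect P (f i).
Proof.
move=> bf; elim: n => [|n IH].
  by under eq_fun do rewrite big_ord0; rewrite big_ord0 expect_cst.
under eq_fun do rewrite big_ord_recr /=.
by rewrite bm_expectD// ?IH ?big_ord_recr//; exact: bm_sum.
Qed.

End bounded_mfun.

Lemma ptail01 (R : realType) L (y : R) : 0 <= y -> 0 <= ptail L y <= 1.
Proof.
move=> y0; rewrite ptail_ge0//=.
have h01 : 0 <= (1 : R) <= 1 by rewrite ler01 lexx.
have /andP[+ _] := exp_tail_scale L y0 h01; rewrite mulr1 subr_ge0 => h.
by rewrite /ptail -mulr_suml expRN ler_pdivrMr ?expR_gt0// mul1r.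
Qed.

Lemma pbtail01 (R : realType) (y : R) q n L : 0 <= y -> (forall k, 0 <= q k <= 1) ->
  0 <= pbtail y q n L <= 1.
Proof.
move=> y0 q01; elim: n L => [|n IH] L /=; first exact: ptail01.
have /andP[q0 q1] := q01 n; have /andP[a0 a1] := IH L.
have /andP[b0 b1] : 0 <= (if L is L'.+1 then pbtail y q n L' else 0) <= 1.
  by case: (L) => [|L']; rewrite ?lexx ?ler01.
have q' : 0 <= 1 - q n by rewrite subr_ge0.
rewrite addr_ge0 ?mulr_ge0//=.
by have := lerD (ler_wpM2l q' a1) (ler_wpM2l q0 b1); rewrite !mulr1 subrK.
Qed.

Lemma measurable_pbtail (R : realType) d (T : measurableType d) (y : R) (q : nat -> T -> R) n L :
  (forall k, measurable_fun setT (q k)) ->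
  measurable_fun setT (fun t => pbtail y (fun k => q k t) n L).
Proof.
move=> mq; elim: n L => [|n IH] L //=.
apply: measurable_funD; apply: measurable_funM => //; first exact: measurable_funB.
by case: L => [|L].
Qed.

(** * Averaging over the point process *)

Section limit.
Variables (R : realType) (alpha : R).
Hypothesis alpha2 : 2 < alpha.
Variables (d : measure_display) (T : measurableType d) (P : probability T R).
Variables (X : nat -> T -> R * R) (lam : R).
Hypothesis lam0 : 0 <= lam.
Hypothesis hX : is_PPP P X lam.

Lemma Delta_ge0 : 0 <= Delta alpha.
Proof.
have G0 s : 0 <= @Gamma R s.
  by apply: fine_ge0; apply: integral_ge0 => x _; rewrite lee_fin mulr_ge0 ?powR_ge0 ?expR_ge0.
by rewrite !mulr_ge0 ?pi_ge0// invr_ge0 ltW// (lt_trans _ alpha2).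
Qed.

(** The generating function factors over the points, so its mean is a Laplace functional at [1 - z]
    times [satur]. The parameter [y_ n] varies because the noise is perturbed along the sequence;
    [L = 0] is apart since the coefficient of rank [i] belongs to [i.+1] antennas. *)
Lemma pbtail_lim (g : R) (y_ : nat -> R) (y : R) L : 0 < g -> (forall n, 0 <= y_ n) -> y_ @ \oo --> y ->
  (fun n => expect P (fun t => pbtail (y_ n) (fun k => satur alpha g (X k t)) n L)) @ \oo -->
  ptail L (y + lam * Delta alpha * g `^ (2 / alpha)).
Proof.
move=> g0 y0 cy; set mu := lam * _ * _.
have yge0 : 0 <= y by apply: (ler_cvg_to (cvg_cst 0) cy); exact: nearW.
have mu0 : 0 <= mu by apply: mulr_ge0; [apply: mulr_ge0 => //; exact: Delta_ge0|exact: powR_ge0].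
case: L => [|L].
  under eq_fun do under eq_fun do rewrite pbtail0.
  by rewrite /ptail big_ord0; under eq_fun do rewrite expect_cst; exact: cvg_cst.
pose q k t := satur alpha g (X k t).
have mq k : measurable_fun setT (q k) by exact: (measurableT_comp (measurable_satur alpha g0) (hX.1 k)).
have q01 k t : 0 <= q k t <= 1 by exact: satur01.
have bq k : bounded_mfun (q k) by exact: bm01.
have bp n i : bounded_mfun (fun t => pbtail (y_ n) (fun k => q k t) n i).
  by apply: bm01; [exact: measurable_pbtail|move=> t; exact: pbtail01].
pose Pi z n t := \prod_(k < n) (1 - (1 - z) * q k t).
have bPi z n : 0 < z < 1 -> bounded_mfun (Pi z n).
  move=> /andP[z0 z1]; apply: bm01.
    apply: measurable_prodr => k; apply: measurable_funB => //; exact: measurable_funM.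
  have w01 k t : 0 <= 1 - (1 - z) * q k t <= 1.
    have /andP[a0 a1] := q01 k t; have z' : 0 <= 1 - z by rewrite subr_ge0 ltW.
    have m0 : 0 <= (1 - z) * q k t by exact: mulr_ge0.
    have z'' : 1 - z <= 1 by rewrite lerBlDr lerDl ltW.
    have m1 : (1 - z) * q k t <= 1 by exact: mulr_ile1.
    by rewrite subr_ge0 m1 lerBlDr lerDl.
  move=> t; apply/andP; split; first by apply: prodr_ge0 => k _; have /andP[] := w01 k t.
  by apply: prodr_ile1 => k _; exact: w01.
apply: (@coef_cvg R (fun n i => expect P (fun t => pbtail (y_ n) (fun k => q k t) n i.+1))
  (fun i => ptail i.+1 (y + mu)) (fun z n => expR (- (y_ n * (1 - z))) * expect P (Pi z n))
  (fun z => expR (- ((y + mu) * (1 - z))))).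
- move=> z /andP[z0 z1].
  rewrite (_ : - ((y + mu) * (1 - z)) = - (y * (1 - z)) + - ((1 - z) * mu)); last by ring.
  rewrite expRD; apply: cvgM.
    apply: continuous_cvg; first exact: continuous_expR.
    by apply: cvgN; apply: cvgM => //; exact: cvg_cst.
  apply: (satur_laplace alpha2 lam0 hX g0).
  by rewrite subr_ge0 ltW//= lerBlDr lerDl ltW.
- move=> z n M z01; have /andP[z0 z1] := z01.
  have z01' : 0 <= z <= 1 by rewrite !ltW.
  pose f t := expR (- (y_ n * (1 - z))) * Pi z n t +
    - (1 - z) * \sum_(i < M) z ^+ i * pbtail (y_ n) (fun k => q k t) n i.+1.
  have bf1 : bounded_mfun (fun t => expR (- (y_ n * (1 - z))) * Pi z n t) by apply: bmM; [exact: bm_cst|exact: bPi].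
  have bs i : bounded_mfun (fun t => z ^+ i * pbtail (y_ n) (fun k => q k t) n i.+1) by apply: bmM; [exact: bm_cst|exact: bp].
  have bf2 : bounded_mfun (fun t => \sum_(i < M) z ^+ i * pbtail (y_ n) (fun k => q k t) n i.+1) by exact: (bm_sum M bs).
  have bf3 : bounded_mfun (fun t => - (1 - z) * \sum_(i < M) z ^+ i * pbtail (y_ n) (fun k => q k t) n i.+1).
    by apply: bmM => //; exact: bm_cst.
  have bf : bounded_mfun f by exact: bmD.
  have f01 t : 0 <= f t <= z ^+ M.
    have := pbtail_gf n M (y0 n) z01' (q01 ^~ t); rewrite /f mulNr.
    by rewrite (eq_bigr (fun i : 'I_M => z ^+ i * pbtail (y_ n) (fun k => q k t) n i.+1)) => // i _; rewrite mulrC.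
  have -> : expR (- (y_ n * (1 - z))) * expect P (Pi z n) - (1 - z) *
      \sum_(i < M) expect P (fun t => pbtail (y_ n) (fun k => q k t) n i.+1) * z ^+ i = expect P f.
    rewrite bm_expectD// bm_expectZ; last exact: bPi.
    rewrite bm_expectZ// mulNr (bm_expect_sum P M bs); congr (_ - _ * _).
    by apply: eq_bigr => i _; rewrite bm_expectZ// mulrC.
  rewrite ger0_norm.
    rewrite -(expect_cst P (z ^+ M)); apply: bm_expect_le => //; first exact: bm_cst.
    by move=> t; have /andP[] := f01 t.
  rewrite -(expect_cst P 0); apply: bm_expect_le => //; first exact: bm_cst.
  by move=> t; have /andP[] := f01 t.
- move=> z M /andP[z0 z1].
  have z01' : 0 <= z <= 1 by rewrite !ltW.
  have ym : 0 <= y + mu by rewrite addr_ge0.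
  by have /andP[h0 h1] := ptail_gf M ym z01'; rewrite ger0_norm.
Qed.

End limit.

Section joint.
Variables (R : realType) (L : nat).
Notation I := (nat * 'I_L * bool)%type.
Notation I1 := (nat * bool)%type.
Notation IS := (I1 + I)%type.
Variables (dT : measure_display) (T : measurableType dT) (P : probability T R).
Variables (X : nat -> T -> R * R) (cre cim : nat -> 'I_L -> T -> R) (crre crim : 'I_L -> T -> R).
Hypothesis mX : forall k, measurable_fun setT (X k).
Hypothesis hF : fading_indep P X cre cim crre crim.

(** * Conditioning on the process *)

Definition xs (t : T) : rvec R I1 := fun i => if i.2 then (X i.1 t).2 else (X i.1 t).1.

Definition fade (t : T) : rvec R I := fun i =>
  match i with
  | (0%N, j, b) => if b then crim j t else crre j t
  | (k.+1, j, b) => if b then cim k j t else cre k j t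
  end.

(** Points and fading as one family over a sum of index types, to which [mix_law] applies with the
    left summand frozen. *)
Definition pair_all (t : T) : rvec R IS := fun i => match i with inl i => xs t i | inr i => fade t i end.

Lemma measurable_xs : measurable_fun setT xs.
Proof.
apply: measurable_rvecP => -[k []] /=.
- by apply: (measurableT_comp _ (mX k)); exact: measurable_snd.
- by apply: (measurableT_comp _ (mX k)); exact: measurable_fst.
Qed.

Lemma measurable_fade : measurable_fun setT fade.
Proof.
have [h1 [h2 [h3 [h4 _]]]] := hF.
by apply: measurable_rvecP => -[[[|k] j] []] /=.
Qed.

Lemma measurable_pair_all : measurable_fun setT pair_all.
Proof.
apply: measurable_rvecP => -[i|i] /=.
- exact: (measurableT_comp (measurable_coord i) measurable_xs).
- exact: (measurableT_comp (measurable_coord i) measurable_fade).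
Qed.

Definition box K : seq I :=
  [seq (kj, b) | kj <- [seq (k, j) | k <- iota 0 K, j <- enum 'I_L], b <- [:: false; true]].

Lemma mem_box K i : (i \in box K) = (i.1.1 < K)%N.
Proof.
case: i => [[k j] b] /=; apply/allpairsP/idP.
  by move=> [[kj b'] /= [/allpairsP[[k' j'] /= [+ _ ->]] _ [-> _ _]]]; rewrite mem_iota.
move=> kK; exists ((k, j), b) => /=; split => //; last by case: b.
by apply/allpairsP; exists (k, j); rewrite /= mem_iota mem_enum.
Qed.

Lemma uniq_box K : uniq (box K).
Proof.
apply: allpairs_uniq => //; last by move=> [? ?] [? ?] _ _ [-> ->].
apply: allpairs_uniq; [exact: iota_uniq|exact: enum_uniq|by move=> [? ?] [? ?] _ _ [-> ->]].
Qed.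

Lemma big_box K (F : I -> \bar R) : (\prod_(i <- box K) F i =
  \prod_(k < K) \prod_(j < L) (F (nat_of_ord k, j, false) * F (nat_of_ord k, j, true)))%E.
Proof.
rewrite /box big_allpairs big_allpairs /= -[K in iota 0 K]subn0 -/(index_iota 0 K) big_mkord.
apply: eq_bigr => k _; rewrite big_enum /=; apply: eq_bigr => j _.
by rewrite big_cons big_seq1.
Qed.

(** The product formula of [fading_indep] in the coordinates of [fade]: since the desired vector has
    index 0, [K] points go with [K.+1] vectors. *)
Lemma fading_box K (D : nat -> set (R * R)) (C : I -> set R) :
  (forall k, measurable (D k)) -> (forall i, measurable (C i)) ->
  P [set t | (forall k, (k < K)%N -> D k (X k t)) /\ (forall i, (i.1.1 < K.+1)%N -> C i (fade t i))] =
  (P [set t | forall k, (k < K)%N -> D k (X k t)] * \prod_(i <- box K.+1) hgauss R (C i))%E.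
Proof.
move=> mD mC; have [_ [_ [_ [_ h]]]] := hF.
have e := h K D (fun k j => C (k.+1, j, false)) (fun k j => C (k.+1, j, true))
  (fun j => C (0%N, j, false)) (fun j => C (0%N, j, true)) mD (fun _ _ => mC _) (fun _ _ => mC _)
  (fun _ => mC _) (fun _ => mC _).
rewrite big_box big_ord_recl [in RHS]muleC -muleA [in RHS]muleC.
transitivity (P [set t | forall k, (k < K)%N -> D k (X k t)] *
  (\prod_(k < K) \prod_(j < L) (halfgauss (C (k.+1, j, false)) * halfgauss (C (k.+1, j, true)))) *
  \prod_(j < L) (halfgauss (C (0%N, j, false)) * halfgauss (C (0%N, j, true))))%E; last first.
  by congr (_ * _)%E; exact: muleC.
rewrite -e; congr (P _); apply/seteqP; split => t /=.
  move=> [hD hC]; split; first split => //.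
    by move=> k j kK; split; [exact: (hC (k.+1, j, false))|exact: (hC (k.+1, j, true))].
  by move=> j; split; [exact: (hC (0%N, j, false))|exact: (hC (0%N, j, true))].
move=> [[hD h1] h2]; split => // -[[[|k] j] b] /= kK.
  by case: b; [exact: (h2 j).2|exact: (h2 j).1].
by case: b; [exact: (h1 k j kK).2|exact: (h1 k j kK).1].
Qed.

Let hgT : hgauss R setT = 1%E. Proof. exact: probability_setT. Qed.

(** Indices outside [s] receive the whole space, so that a cylinder becomes a condition on complete
    initial segments. *)
Let fC (s : seq IS) (B : IS -> set R) (i : I) : set R := if inr i \in s then B (inr i) else setT.
Let xD (s : seq IS) (B : IS -> set R) k : set (R * R) :=
  [set x | (inl (k, false) \in s -> B (inl (k, false)) x.1) /\ (inl (k, true) \in s -> B (inl (k, true)) x.2)].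
Let idx (i : IS) : nat := match i with inl i => i.1 | inr i => i.1.1 end.

Let mxD s B k : (forall i, measurable (B i)) -> measurable (xD s B k).
Proof.
move=> mB.
have -> : xD s B k = (fst @^-1` (if inl (k, false) \in s then B (inl (k, false)) else setT)) `&`
  (snd @^-1` (if inl (k, true) \in s then B (inl (k, true)) else setT)).
  apply/seteqP; split => x /=; rewrite /xD /=.
    by move=> [h1 h2]; split; case: ifP.
  by move=> []; do 2!(case: ifP => _); move=> h1 h2; split.
have m1 (A : set R) : measurable A -> measurable (fst @^-1` A : set (R * R)).
  by move=> mA; rewrite -[X in measurable X]setTI; exact: measurable_fst.
have m2 (A : set R) : measurable A -> measurable (snd @^-1` A : set (R * R)).
  by move=> mA; rewrite -[X in measurable X]setTI; exact: measurable_snd.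
by apply: measurableI; [apply: m1|apply: m2]; case: ifP.
Qed.

Lemma pair_all_cyl K s B : (forall i, i \in s -> (idx i < K)%N) -> (forall i, measurable (B i)) ->
  P (pair_all @^-1` cyl s B) =
  (P [set t | forall k, (k < K)%N -> xD s B k (X k t)] * \prod_(i <- box K.+1) hgauss R (fC s B i))%E.
Proof.
move=> sK mB; rewrite -fading_box; last 2 first.
- by move=> k; exact: mxD.
- by move=> i; rewrite /fC; case: ifP.
congr (P _); apply/seteqP; split => t /=; rewrite /cyl /=.
  move=> h; split.
    by move=> k kK; split => ks; exact: (h _ ks).
  by move=> i _; rewrite /fC; case: ifP => // si; exact: (h _ si).
move=> [h1 h2] [[k b]|i] si.
  by have [e1 e2] := h1 k (sK _ si); case: b si => si; [exact: e2|exact: e1].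
by have := h2 i (ltnW (sK _ si)); rewrite /fC si.
Qed.

Let Kb (s : seq IS) : nat := (\max_(i <- s) idx i).+1.

Let KbP s i : i \in s -> (idx i < Kb s)%N.
Proof. by move=> si; rewrite ltnS; exact: leq_bigmax_seq. Qed.

(** The three probabilities are computed with the common bound [Kb s]; in each factor the conditions
    on the other half are void. *)
Lemma pair_all_indep s B : uniq s -> (forall i, measurable (B i)) ->
  P (pair_all @^-1` cyl s B) =
  (P (pair_all @^-1` cyl [seq i <- s | is_inl i] B) * P (pair_all @^-1` cyl [seq i <- s | ~~ is_inl i] B))%E.
Proof.
move=> us mB.
have sub (a : pred IS) i : i \in [seq i <- s | a i] -> (idx i < Kb s)%N.
  by rewrite mem_filter => /andP[_]; exact: KbP.
rewrite (pair_all_cyl (@KbP s) mB) (pair_all_cyl (sub _) mB) (pair_all_cyl (sub _) mB).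
have e1 : (\prod_(i <- box (Kb s).+1) hgauss R (fC [seq i <- s | is_inl i] B i) = 1)%E.
  by apply: big1 => i _; rewrite /fC mem_filter /= hgT.
have e2 i : fC [seq i <- s | ~~ is_inl i] B i = fC s B i by rewrite /fC mem_filter.
have e3 k : xD [seq i <- s | is_inl i] B k = xD s B k by rewrite /xD !mem_filter.
have e4 : P [set t | forall k, (k < Kb s)%N -> xD [seq i <- s | ~~ is_inl i] B k (X k t)] = 1%E.
  rewrite -(probability_setT P); congr (P _); apply/seteqP; split => t // _ k _.
  by rewrite /xD !mem_filter.
rewrite e1 e4 mule1 mul1e; congr (_ * _)%E.
  congr (P _); apply/seteqP; split => t /= h k kK; have := h k kK; by rewrite e3.
by apply: eq_bigr => i _; rewrite e2.
Qed.

Lemma fade_iid (nu : probability (rvec R I) R) : (forall A, nu A = P (fade @^-1` A)) -> iid (hgauss R) nu.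
Proof.
move=> nuE s B us mB; rewrite nuE.
pose s' : seq IS := map inr s; pose B' (i : IS) := match i with inr i => B i | inl _ => setT end.
have mB' i : measurable (B' i) by case: i => [j|j]; [exact: measurableT|exact: mB].
have -> : fade @^-1` cyl s B = pair_all @^-1` cyl s' B'.
  apply/seteqP; split => t; rewrite /cyl /=.
    by move=> h i /mapP[j js ->]; exact: h.
  by move=> h i si; apply: (h (inr i)); rewrite map_f.
rewrite (pair_all_cyl (@KbP s') mB').
have -> : P [set t | forall k, (k < Kb s')%N -> xD s' B' k (X k t)] = 1%E.
  by rewrite -(probability_setT P); congr (P _); apply/seteqP; split => t // _ k _; split.
rewrite mul1e.
have inj : injective (inr : I -> IS) by move=> ? ? [].
transitivity (\prod_(i <- box (Kb s').+1 | i \in s) hgauss R (B i))%E.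
  by rewrite [RHS]big_mkcond; apply: eq_bigr => i _; rewrite /fC mem_map//; case: ifP.
rewrite -big_filter; apply: perm_big; apply: uniq_perm => //.
  by apply: filter_uniq; exact: uniq_box.
move=> i; rewrite mem_filter; case si : (i \in s) => //=.
by rewrite mem_box ltnW// ltnS; apply: (@KbP s' (inr i)); rewrite map_f.
Qed.

(** Independence turned into Fubini: the fading is replaced by an independent copy while the points
    are kept. *)
Theorem joint_law (nu : probability (rvec R I) R) (S : set (rvec R I1 * rvec R I)) :
  (forall A, nu A = P (fade @^-1` A)) -> measurable S ->
  P [set t | S (xs t, fade t)] = (\int[P]_t nu (xsection S (xs t)))%E.
Proof.
move=> nuE mS.
have [k kE] := pushforward_probability_ex P measurable_pair_all.
pose pl (w : rvec R IS) : rvec R I1 := fun i => w (inl i).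
pose pr (w : rvec R IS) : rvec R I := fun i => w (inr i).
have mpl : measurable_fun setT pl by apply: measurable_rvecP => i; exact: (measurable_coord (inl i : IS)).
have mpr : measurable_fun setT pr by apply: measurable_rvecP => i; exact: (measurable_coord (inr i : IS)).
pose E : set (rvec R IS) := [set w | S (pl w, pr w)].
have mE : measurable E.
  rewrite -[E]setTI; apply: (measurable_fun_pair mpl mpr) => //.
have := @mix_law R IS k is_inl _ E mE.
rewrite !kE => ->; last first.
  by move=> s B us mB; rewrite !kE; exact: pair_all_indep.
pose h (w : rvec R IS) := nu (xsection S (pl w)).
transitivity (\int[k]_w h w)%E.
  apply: eq_integral => w _; rewrite /h nuE kE; congr (P _).
  by apply/seteqP; split => t; rewrite /xsection /= inE.
have mh : measurable_fun setT h.
  exact: (measurableT_comp (measurable_fun_xsection nu mS) mpl).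
transitivity (\int[pushforward P pair_all]_w h w)%E.
  by apply: eq_measure_integral; [exact: measurable_pair_all|move=> Hm A mA sA; exact: kE].
rewrite ge0_integral_pushforward//= ?preimage_setT//; exact: measurable_pair_all.
Qed.

End joint.

Section comp.
Variables (d d' : measure_display) (S : measurableType d) (T : measurableType d') (R : realType).
Notation C := R[i].

Lemma cmeas_comp (f : T -> C) (h : S -> T) : cmeas f -> measurable_fun setT h -> cmeas (fun x => f (h x)).
Proof. by move=> [f1 f2] mh; split; [exact: (measurableT_comp f1 mh)|exact: (measurableT_comp f2 mh)]. Qed.

Lemma mmeas_comp m n (F : T -> 'M[C]_(m, n)) (h : S -> T) : mmeas F -> measurable_fun setT h ->
  mmeas (fun x => F (h x)).
Proof. by move=> mF mh a b; exact: cmeas_comp (mF a b) mh. Qed.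

End comp.

Section law.
Variables (R : realType) (L : nat) (alpha : R).
Notation C := R[i].
Notation I := (nat * 'I_L * bool)%type.
Notation I1 := (nat * bool)%type.
Variables (dT : measure_display) (T : measurableType dT) (P : probability T R).
Variables (X : nat -> T -> R * R) (cre cim : nat -> 'I_L -> T -> R) (crre crim : 'I_L -> T -> R).
Hypothesis mX : forall k, measurable_fun setT (X k).
Hypothesis hF : fading_indep P X cre cim crre crim.

Definition ploss (u : I1 -> R) k := pathloss alpha (u (k, false), u (k, true)).

Local Notation xs := (xs X).
Local Notation fade := (fade cre cim crre crim).

Lemma measurable_ploss k : measurable_fun setT (fun u : rvec R I1 => ploss u k).
Proof.
apply: (@measurable_comp2 _ _ _ _ _ (pathloss alpha)); last 2 first.
- exact: measurable_coord.
- exact: measurable_coord.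
exact: measurable_pathloss.
Qed.

Lemma mmeas_Amat_pair s n :
  mmeas (fun z : rvec R I1 * rvec R I => Amat s (ploss z.1) n z.2).
Proof.
have m1 : measurable_fun setT (fst : rvec R I1 * rvec R I -> rvec R I1) by exact: measurable_fst.
have m2 : measurable_fun setT (snd : rvec R I1 * rvec R I -> rvec R I) by exact: measurable_snd.
apply: mmeasD; first exact: mmeas_cst.
apply: mmeas_sum => k; apply: mmeasZ.
  by apply: cmeas_real; exact: (measurableT_comp (measurable_ploss k) m1).
have mv : mmeas (fun z : rvec R I1 * rvec R I => vec z.2 k.+1) by exact: (mmeas_comp (@mmeas_vec R L k.+1) m2).
by apply: mmeasM => //; apply: mmeas_ctrans.
Qed.

Lemma fade_law_ex : exists nu : probability (rvec R I) R, (forall A, nu A = P (fade @^-1` A)) /\ iid (hgauss R) nu.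
Proof.
have [nu nuE] := pushforward_probability_ex P (measurable_fade hF).
by exists nu; split => //; exact: (fade_iid hF nuE).
Qed.

Lemma gram_outage s g n : 0 < s -> 0 < g ->
  P [set t | g < gram (Amat s (fun k => pathloss alpha (X k t)) n (fade t)) (vec (fade t) 0)] =
  (expect P (fun t => pbtail (s * g) (fun k => satur alpha g (X k t)) n L))%:E.
Proof.
move=> s0 g0; have [nu [nuE nuI]] := fade_law_ex.
pose S : set (rvec R I1 * rvec R I) := [set z | g < gram (Amat s (ploss z.1) n z.2) (vec z.2 0)].
have m2 : measurable_fun setT (snd : rvec R I1 * rvec R I -> rvec R I) by exact: measurable_snd.
have mS : measurable S.
  apply: measurable_ltf; first exact: measurable_cst.
  apply: measurable_gram; first exact: mmeas_Amat_pair.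
  exact: (mmeas_comp (@mmeas_vec R L 0) m2).
have sg0 : 0 <= s * g by rewrite mulr_ge0// ltW.
have q01 t k : 0 <= satur alpha g (X k t) <= 1 by exact: satur01.
have mq k : measurable_fun setT (fun t => satur alpha g (X k t)).
  exact: (measurableT_comp (measurable_satur alpha g0) (mX k)).
rewrite (expectE (M := 1) P); last 2 first.
- exact: measurable_pbtail.
- move=> t; have /andP[h0 h1] := pbtail01 n L sg0 (q01 t); by rewrite ger0_norm.
apply: (eq_trans (joint_law mX hF nuE mS)).
apply: eq_integral => t _.
rewrite -(gram_law n s0 g0 (fun k => pathloss_ge0 alpha (X k t)) nuI).
by congr (nu _); apply/seteqP; split => w; rewrite /xsection /= inE.
Qed.

Definition antenna_interference (a : 'I_L) (p : nat -> R) (w : I -> R) n : R := \sum_(k < n) p k * nsq w (k.+1, a).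

(* The Laplace transform of the interference at one antenna, read as the probability that it is exceeded by an independent exponential variable. *)
Lemma interf_law (nu : probability (rvec R I) R) (p : nat -> R) a c n : iid (hgauss R) nu ->
  (forall k, 0 <= p k) -> 0 <= c ->
  nu [set w | c + antenna_interference a p w n < nsq w (0%N, a)] = (expR (- c) * \prod_(k < n) (1 + p k)^-1)%:E.
Proof.
move=> nuI p0; elim: n c => [|n IH] c c0.
  rewrite big_ord0 mulr1 -(nsq_tail nuI (0%N, a) c0); congr (nu _).
  by apply/seteqP; split => w /=; rewrite /antenna_interference big_ord0 addr0.
have mI k : measurable_fun setT (fun w : rvec R I => antenna_interference a p w k).
  apply: measurable_sum => i; apply: measurable_funM => //; exact: measurable_nsq.
have mE : measurable [set w : rvec R I | c + antenna_interference a p w n.+1 < nsq w (0%N, a)].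
  by apply: measurable_ltf; [exact: measurable_funD|exact: measurable_nsq].
rewrite (iid_mix nuI (fun i : I => (pred1 (n.+1, a)) i.1) mE).
have nm w w' q : q != (n.+1, a) -> nsq (mix (fun i : I => (pred1 (n.+1, a)) i.1) w w') q = nsq w' q.
  by move=> /negbTE qn; rewrite (nsq_mix (pred1 (n.+1, a))) /= qn.
transitivity (\int[nu]_w ((expR (- c) * \prod_(k < n) (1 + p k)^-1)%:E * (expR (- (p n * nsq w (n.+1, a))))%:E))%E.
  apply: eq_integral => w _.
  have c1 : 0 <= c + p n * nsq w (n.+1, a) by rewrite addr_ge0// mulr_ge0// nsq_ge0.
  rewrite -EFinM mulrAC -expRD -opprD -(IH _ c1); congr (nu _); apply/seteqP.
  suff h w' : (c + antenna_interference a p (mix (fun i : I => (pred1 (n.+1, a)) i.1) w w') n.+1 < nsq (mix (fun i : I => (pred1 (n.+1, a)) i.1) w w') (0%N, a)) =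
    (c + p n * nsq w (n.+1, a) + antenna_interference a p w' n < nsq w' (0%N, a)) by split => w' /=; rewrite h.
  rewrite nm// /antenna_interference big_ord_recr /= (nsq_mix (pred1 (n.+1, a))) /= eqxx.
  rewrite (eq_bigr (fun k : 'I_n => p k * nsq w' (k.+1, a))) => [|k _]; last first.
    by rewrite nm// xpair_eqE eqSS (ltn_eqF (ltn_ord k)).
  by rewrite addrA addrAC.
have pn : 0 <= \prod_(k < n) (1 + p k)^-1 by apply: prodr_ge0 => k _; rewrite invr_ge0 addr_ge0.
rewrite ge0_integralZl_EFin//; last 2 first.
- apply/measurable_EFinP; apply: (measurableT_comp (@measurable_expN R)); apply: measurable_funM => //.
  exact: measurable_nsq.
- by rewrite mulr_ge0// expR_ge0.
by rewrite (nsq_laplace nuI)// -EFinM -mulrA big_ord_recr.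
Qed.

Lemma interf_outage (a : 'I_L) g n : 0 < g ->
  P [set t | antenna_interference a (fun k => pathloss alpha (X k t) * g) (fade t) n < nsq (fade t) (0%N, a)] =
  (expect P (fun t => \prod_(k < n) (1 - 1 * satur alpha g (X k t))))%:E.
Proof.
move=> g0; have [nu [nuE nuI]] := fade_law_ex.
pose S : set (rvec R I1 * rvec R I) := [set z | antenna_interference a (fun k => ploss z.1 k * g) z.2 n < nsq z.2 (0%N, a)].
have m1 : measurable_fun setT (fst : rvec R I1 * rvec R I -> rvec R I1) by exact: measurable_fst.
have m2 : measurable_fun setT (snd : rvec R I1 * rvec R I -> rvec R I) by exact: measurable_snd.
have mn q : measurable_fun setT (fun z : rvec R I1 * rvec R I => nsq z.2 q).
  exact: (measurableT_comp (@measurable_nsq R L q) m2).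
have mS : measurable S.
  apply: measurable_ltf => //; apply: measurable_sum => k; apply: measurable_funM => //.
  by apply: measurable_funM => //; exact: (measurableT_comp (measurable_ploss k) m1).
have q01 t k : 0 <= satur alpha g (X k t) <= 1 by exact: satur01.
have mq k : measurable_fun setT (fun t => satur alpha g (X k t)).
  exact: (measurableT_comp (measurable_satur alpha g0) (mX k)).
rewrite (expectE (M := 1) P); last 2 first.
- by apply: measurable_prodr => k; apply: measurable_funB => //; exact: measurable_funM.
- move=> t; have w01 k : 0 <= 1 - 1 * satur alpha g (X k t) <= 1.
    by have /andP[h0 h1] := q01 t k; rewrite mul1r subr_ge0 h1 lerBlDr lerDl.
  rewrite ger0_norm; first by apply: prodr_ile1 => k _; exact: w01.
  by apply: prodr_ge0 => k _; have /andP[] := w01 k.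
apply: (eq_trans (joint_law mX hF nuE mS)).
apply: eq_integral => t _.
have p0 k : 0 <= pathloss alpha (X k t) * g by rewrite mulr_ge0 ?pathloss_ge0// ltW.
(* The complement of [satur] is the Laplace transform of one exponential term of the
   interference. *)
have -> : \prod_(k < n) (1 - 1 * satur alpha g (X k t)) = expR (- 0) * \prod_(k < n) (1 + pathloss alpha (X k t) * g)^-1.
  rewrite oppr0 expR0 mul1r; apply: eq_bigr => k _; rewrite /satur; field.
  by rewrite gt_eqF// ltr_wpDr.
rewrite -(interf_law a n nuI p0 (lexx 0)).
by congr (nu _); apply/seteqP; split => w; rewrite /xsection /= inE /S /= add0r.
Qed.

End law.

(** * Limits of events and null sets *)

Section nullsets.
Variables (R : realType).

(** Fatou's lemma for events: outside a null set, [C] is contained in the lower limit of the [B n].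
    Applied to events and to complements, it plays the part of convergence in law. *)
Lemma liminf_law d (T : measurableType d) (P : probability T R) (B : nat -> set T) (C Z : set T) (l : R) :
  (forall n, measurable (B n)) -> measurable C -> measurable Z -> P Z = 0%E ->
  (fun n => fine (P (B n))) @ \oo --> l ->
  (forall t, C t -> ~ Z t -> \forall n \near \oo, B n t) -> (P C <= l%:E)%E.
Proof.
move=> mB mC mZ Z0 cB CB.
pose E N := \bigcap_(n in [set n | (N <= n)%N]) B n.
have mE N : measurable (E N) by apply: bigcap_measurable => //; exists N => /=.
have Eh : {homo E : n m / (n <= m)%N >-> (n <= m)%O}.
  move=> n m nm; rewrite subsetEset => t h k /= mk; apply: h => /=; exact: leq_trans mk.
have El N : (P (E N) <= l%:E)%E.
  have Ef : P (E N) \is a fin_num by exact: fin_num_measure.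
  rewrite -(fineK Ef) lee_fin; apply: (ler_cvg_to (cvg_cst _) cB); near=> n.
  apply: fine_le => //; first exact: fin_num_measure.
  apply: le_measure; rewrite ?inE//.
  by move=> t; apply => /=; near: n; exact: nbhs_infty_ge.
have mU : measurable (\bigcup_N E N) by exact: bigcup_measurable.
have Ul : (P (\bigcup_N E N) <= l%:E)%E.
  have c := @nondecreasing_cvg_mu _ _ _ P E mE mU Eh.
  rewrite -(cvg_lim _ c)//; apply: lime_le; first exact: cvgP c.
  exact: nearW.
apply: le_trans (_ : P ((\bigcup_N E N) `|` Z) <= _)%E; last first.
  apply: le_trans (_ : P (\bigcup_N E N) + P Z <= _)%E; first exact: measureU2.
  by rewrite Z0 adde0.
apply: le_measure; rewrite ?inE//; first exact: measurableU.
move=> t Ct; have [Zt|Zt] := pselect (Z t); first by right.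
left; have [N _ h] := CB t Ct Zt; by exists N => // n /= Nn; exact: h.
Unshelve. all: by end_near. Qed.

Lemma prob1_null d (T : measurableType d) (P : probability T R) (A : set T) :
  measurable A -> P A = 1%E -> P (~` A) = 0%E.
Proof. by move=> mA A1; rewrite probability_setC// A1 subee. Qed.

End nullsets.

Lemma measurable_eq0 (R : realType) d (T : measurableType d) (f : T -> R[i]) : cmeas f ->
  measurable [set x | f x = 0].
Proof.
move=> mf; rewrite -[X in measurable X]setTI.
rewrite (_ : [set x | f x = 0] = (fun x => f x == 0) @^-1` [set true]).
  exact: (measurable_ceq0 mf).
by apply/seteqP; split => x /= /eqP.
Qed.

Section det.
Variable R : realType.

Definition cols (L : nat) (w : nat * 'I_L * bool -> R) : 'M[R[i]]_L := \matrix_(a, j) cz w (j.+1, a).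

(** The real part already has no atom, the normal law being dominated by Lebesgue measure. *)
Lemma cz_null L (nu : probability (rvec R (nat * 'I_L * bool)%type) R) q (c : R[i]) : iid (hgauss R) nu ->
  nu [set w | cz w q = c] = 0%E.
Proof.
move=> nuI.
have m1 : measurable [set w : rvec R (nat * 'I_L * bool)%type | w (q, false) = complex.Re c].
  rewrite -[X in measurable X]setTI.
  exact: (@measurable_coord R _ (q, false) measurableT _ (measurable_set1 (complex.Re c))).
have m2 : measurable [set w : rvec R (nat * 'I_L * bool)%type | cz w q = c].
  have [h1 h2] := @cmeas_cz R L q.
  rewrite (_ : [set w | _] = [set w : rvec R (nat * 'I_L * bool)%type | complex.Re (cz w q) = complex.Re c] `&`
     [set w : rvec R (nat * 'I_L * bool)%type | complex.Im (cz w q) = complex.Im c]); last first.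
    apply/seteqP; split => w /=; first by move=> <-.
    by move=> [e1 e2]; apply/eqP; rewrite eq_complex /= e1 e2 !eqxx.
  apply: measurableI; rewrite -[X in measurable X]setTI.
    exact: (h1 measurableT _ (measurable_set1 _)).
  exact: (h2 measurableT _ (measurable_set1 _)).
apply/eqP; rewrite eq_le measure_ge0 andbT.
apply: (@le_trans _ _ (nu [set w | w (q, false) = complex.Re c])).
  by apply: le_measure; rewrite ?inE// => w /= <-.
have e := iid_coord nuI (q, false) (measurable_set1 (complex.Re c)).
apply: (le_trans _ (_ : hgauss R [set complex.Re c] <= 0)%E); first by rewrite -e.
have s0 : Num.sqrt (2^-1 : R) != 0 by rewrite sqrtr_eq0 -ltNge invr_gt0.
have /null_content_dominatesP dom := normal_prob_dominates (0 : R) (Num.sqrt (2^-1 : R)).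
have h := dom _ (measurable_set1 (complex.Re c)) (lebesgue_measure_set1 _).
exact: (eq_ind_r (fun x => (x <= 0)%E) (lexx 0%E) h).
Qed.

(** Drops the first antenna and the first interferer: composing with it replaces [cols] by its
    submatrix without first row and column. *)
Definition shift_coords (L : nat) (i : nat * 'I_L * bool) : nat * 'I_L.+1 * bool := (i.1.1.+1, lift ord0 i.1.2, i.2).

Lemma shift_coords_inj L : injective (@shift_coords L).
Proof.
case=> [[k j] b] [[k' j'] b'] e.
have := congr1 snd e; have := congr1 (fun i => i.1.2) e; have := congr1 (fun i => i.1.1) e.
by move=> /= [->] /lift_inj -> ->.
Qed.

(** Given all other entries, the determinant is affine in the entry [q0]. Its slope is a minor,
    almost surely nonzero by induction, and a Gaussian entry avoids the single root. *)
Lemma det_null L (nu : probability (rvec R (nat * 'I_L * bool)%type) R) : iid (hgauss R) nu ->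
  nu [set w | \det (cols w) = 0] = 0%E.
Proof.
elim: L nu => [|L IH] nu nuI.
  rewrite (_ : [set _ | _] = set0) ?measure0//; apply/seteqP; split => w //=.
  by rewrite det_mx00 => /eqP; rewrite oner_eq0.
have [nu' [nu'I nu'E]] := iid_reindex (@shift_coords_inj L) nuI.
have N := IH nu' nu'I; rewrite nu'E in N.
pose q0 : nat * 'I_L.+1 := (1%N, ord0).
have mcols : mmeas (fun w : rvec R (nat * 'I_L.+1 * bool)%type => cols w).
  by move=> a b; apply: cmeas_ext (@cmeas_cz R L.+1 (b.+1, a)) => w; rewrite mxE.
have mD : measurable [set w : rvec R (nat * 'I_L.+1 * bool)%type | \det (cols w) = 0].
  exact: measurable_eq0 (cmeas_det mcols).
have mcols' : mmeas (fun w : rvec R (nat * 'I_L * bool)%type => cols w).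
  by move=> a b; apply: cmeas_ext (@cmeas_cz R L (b.+1, a)) => w; rewrite mxE.
pose Z : set (rvec R (nat * 'I_L.+1 * bool)%type) := (fun w : rvec R (nat * 'I_L.+1 * bool)%type => w \o @shift_coords L : rvec R (nat * 'I_L * bool)%type) @^-1` [set w | \det (cols w) = 0].
have mZ : measurable Z.
  rewrite -[Z]setTI; apply: (_ : measurable_fun setT _) => //.
    by apply: measurable_rvecP => i; exact: (measurable_coord (shift_coords i)).
  exact: measurable_eq0 (cmeas_det mcols').
apply: (@iid_mix_ae R _ (hgauss R) nu (fun i => predC1 q0 i.1) _ Z 0%E nuI mD mZ N) => // w Zw.
have cm w' q : cz (mix (fun i : (nat * 'I_L.+1 * bool)%type => predC1 q0 i.1) w w') q = if q != q0 then cz w q else cz w' q.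
  by rewrite (cz_mix (predC1 q0)).
pose D0 := cofactor (cols w) ord0 ord0.
have D00 : D0 != 0.
  apply/negP => /eqP h; apply: Zw; rewrite /Z /=; move: h.
  rewrite /D0 /cofactor /= addn0 expr0 mul1r => <-; congr (\det _).
  by apply/matrixP => a b; rewrite !mxE.
pose rest := \sum_(j < L) cz w (j.+2, ord0) * cofactor (cols w) ord0 (lift ord0 j).
rewrite -(cz_null q0 (- (rest / D0)) nuI); congr (nu _); apply/seteqP.
suff h w' : \det (cols (mix (fun i : (nat * 'I_L.+1 * bool)%type => predC1 q0 i.1) w w')) = cz w' q0 * D0 + rest.
  split => w' /=; rewrite h.
    by move/eqP; rewrite addr_eq0 => /eqP e; rewrite -mulNr -e mulfK.
  by move=> ->; rewrite mulNr divfK// addNr.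
have nq (k : nat) (a : 'I_L) : ((k, lift ord0 a) : nat * 'I_L.+1) != q0.
  apply/negP => /eqP e; have /eqP := congr1 snd e.
  by rewrite /= eq_sym (negbTE (neq_lift _ _)).
have cofE (j : 'I_L.+1) : cofactor (cols (mix (fun i : (nat * 'I_L.+1 * bool)%type => predC1 q0 i.1) w w')) ord0 j =
    cofactor (cols w) ord0 j.
  by rewrite /cofactor; apply: f_equal2 => //; congr (\det _); apply/matrixP => a b; rewrite !mxE cm nq.
rewrite (expand_det_row _ ord0) big_ord_recl; apply: f_equal2.
  by rewrite cofE mxE cm eqxx.
by apply: eq_bigr => j _; rewrite cofE mxE cm.
Qed.

End det.

(** * Convergence of the random matrices *)

Section ccvg.
Variable R : realType.
Notation C := R[i].
Notation Re := complex.Re.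
Notation Im := complex.Im.
Implicit Types (u v : nat -> C) (l : C).

Definition ccvg u l := (fun n => Re (u n)) @ \oo --> Re l /\ (fun n => Im (u n)) @ \oo --> Im l.

Lemma ccvg_ext u v l : (forall n, u n = v n) -> ccvg u l -> ccvg v l.
Proof. by move=> /funext ->. Qed.

Lemma ccvg_cst l : ccvg (fun=> l) l.
Proof. by split; exact: cvg_cst. Qed.

Lemma ccvgD u v l (m : C) : ccvg u l -> ccvg v m -> ccvg (fun n => u n + v n) (l + m).
Proof.
move=> [u1 u2] [v1 v2]; split.
  rewrite (_ : (fun n => _) = (fun n => Re (u n) + Re (v n))); last by apply/funext => n; case: (u n) (v n) => ? ? [].
  by rewrite (_ : Re (l + m) = Re l + Re m); [exact: cvgD|case: (l) (m) => ? ? []].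
rewrite (_ : (fun n => _) = (fun n => Im (u n) + Im (v n))); last by apply/funext => n; case: (u n) (v n) => ? ? [].
by rewrite (_ : Im (l + m) = Im l + Im m); [exact: cvgD|case: (l) (m) => ? ? []].
Qed.

Lemma ccvgM u v l (m : C) : ccvg u l -> ccvg v m -> ccvg (fun n => u n * v n) (l * m).
Proof.
move=> [u1 u2] [v1 v2]; split.
  rewrite (_ : (fun n => _) = (fun n => Re (u n) * Re (v n) - Im (u n) * Im (v n))); last by apply/funext => n; case: (u n) (v n) => ? ? [].
  rewrite (_ : Re (l * m) = Re l * Re m - Im l * Im m); last by case: (l) (m) => ? ? [].
  by apply: cvgB; exact: cvgM.
rewrite (_ : (fun n => _) = (fun n => Re (u n) * Im (v n) + Im (u n) * Re (v n))); last by apply/funext => n; case: (u n) (v n) => ? ? [].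
rewrite (_ : Im (l * m) = Re l * Im m + Im l * Re m); last by case: (l) (m) => ? ? [].
by apply: cvgD; exact: cvgM.
Qed.

Lemma ccvgV u l : l != 0 -> ccvg u l -> ccvg (fun n => (u n)^-1) l^-1.
Proof.
move=> l0 [u1 u2].
have invE (z : C) : z^-1 = ((Re z / normsq z) +i* (- Im z / normsq z))%C.
  have [->|z0] := eqVneq z 0.
    by rewrite invr0 /normsq /= oppr0 !mul0r.
  have nz : normsq z != 0 by rewrite normsq_eq0.
  apply: (mulfI z0); rewrite mulfV//; apply/esym/eqP; rewrite eq_complex.
  move: nz; case: (z) => a b; rewrite /normsq /= => nz; apply/andP; split; apply/eqP; field.
    by [].
  by [].
have cn : (fun n => normsq (u n)) @ \oo --> normsq l.
  by apply: cvgD; rewrite expr2; under eq_fun do rewrite expr2; exact: cvgM.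
have nl : normsq l != 0 by rewrite normsq_eq0.
have cv : (fun n => (normsq (u n))^-1) @ \oo --> (normsq l)^-1 by exact: cvgV.
split; rewrite invE /=; under eq_fun do rewrite invE /=.
  exact: cvgM.
by apply: cvgM => //; exact: cvgN.
Qed.

Lemma ccvg_sum (I : Type) (s : seq I) (P : pred I) (F : I -> nat -> C) (l : I -> C) :
  (forall i, ccvg (F i) (l i)) -> ccvg (fun n => \sum_(i <- s | P i) F i n) (\sum_(i <- s | P i) l i).
Proof.
move=> h; elim: s => [|i s IH].
  by rewrite big_nil; apply: ccvg_ext (ccvg_cst 0) => n; rewrite big_nil.
rewrite big_cons; case Pi : (P i); last by apply: ccvg_ext IH => n; rewrite big_cons Pi.
by apply: ccvg_ext (ccvgD (h i) IH) => n; rewrite big_cons Pi.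
Qed.

Lemma ccvg_prod (I : Type) (s : seq I) (P : pred I) (F : I -> nat -> C) (l : I -> C) :
  (forall i, ccvg (F i) (l i)) -> ccvg (fun n => \prod_(i <- s | P i) F i n) (\prod_(i <- s | P i) l i).
Proof.
move=> h; elim: s => [|i s IH].
  by rewrite big_nil; apply: ccvg_ext (ccvg_cst 1) => n; rewrite big_nil.
rewrite big_cons; case Pi : (P i); last by apply: ccvg_ext IH => n; rewrite big_cons Pi.
by apply: ccvg_ext (ccvgM (h i) IH) => n; rewrite big_cons Pi.
Qed.

Definition mcvg m n (F : nat -> 'M[C]_(m, n)) (A : 'M[C]_(m, n)) := forall i j, ccvg (fun k => F k i j) (A i j).

Lemma mcvg_cst m n (A : 'M[C]_(m, n)) : mcvg (fun=> A) A.
Proof. by move=> i j; exact: ccvg_cst. Qed.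

Lemma mcvgM m n p (F : nat -> 'M[C]_(m, n)) (G : nat -> 'M[C]_(n, p)) A B :
  mcvg F A -> mcvg G B -> mcvg (fun k => F k *m G k) (A *m B).
Proof.
move=> hF hG i j; rewrite mxE; apply: ccvg_ext (fun k => esym (mxE _ _ _ _)) _.
by apply: ccvg_sum => k; exact: ccvgM.
Qed.

Lemma ccvg_det n (F : nat -> 'M[C]_n) A : mcvg F A -> ccvg (fun k => \det (F k)) (\det A).
Proof.
move=> hF; apply: ccvg_sum => s; apply: ccvgM; first exact: ccvg_cst.
by apply: ccvg_prod => i; exact: hF.
Qed.

Lemma mcvg_inv n (F : nat -> 'M[C]_n) A : A \in unitmx -> (forall k, F k \in unitmx) ->
  mcvg F A -> mcvg (fun k => invmx (F k)) (invmx A).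
Proof.
move=> uA uF hF i j.
have invE (B : 'M[C]_n) : B \in unitmx -> (invmx B) i j = (\det B)^-1 * ((-1) ^+ (j + i) * \det (row' j (col' i B))).
  by move=> uB; rewrite /invmx uB !mxE.
rewrite invE//; apply: ccvg_ext (fun k => esym (invE _ (uF k))) _.
apply: ccvgM.
  by apply: ccvgV; [rewrite -unitfE -unitmxE|exact: ccvg_det].
apply: ccvgM; first exact: ccvg_cst.
apply: ccvg_det => a b; rewrite !mxE; apply: ccvg_ext (hF (lift j a) (lift i b)) => k.
by rewrite !mxE.
Qed.

Lemma ccvg_iform n (F : nat -> 'M[C]_n) A x : A \in unitmx -> (forall k, F k \in unitmx) ->
  mcvg F A -> ccvg (fun k => iform (F k) x x) (iform A x x).
Proof.
move=> uA uF hF; rewrite /iform /sform.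
have h : mcvg (fun k => ctrans x *m invmx (F k) *m x) (ctrans x *m invmx A *m x).
  apply: mcvgM; last exact: mcvg_cst.
  by apply: mcvgM; [exact: mcvg_cst|exact: mcvg_inv].
exact: h.
Qed.

End ccvg.

Lemma Re_sum (R : realType) n (f : nat -> R[i]) :
  complex.Re (\sum_(k < n) f k) = \sum_(k < n) complex.Re (f k).
Proof.
elim: n => [|n IH]; first by rewrite !big_ord0.
by rewrite !big_ord_recr /= -IH; case: (\sum_(k < n) f k) (f n) => ? ? [].
Qed.

Lemma Im_sum (R : realType) n (f : nat -> R[i]) :
  complex.Im (\sum_(k < n) f k) = \sum_(k < n) complex.Im (f k).
Proof.
elim: n => [|n IH]; first by rewrite !big_ord0.
by rewrite !big_ord_recr /= -IH; case: (\sum_(k < n) f k) (f n) => ? ? [].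
Qed.

Section limit.
Variables (R : realType) (L : nat) (sigma2 : R) (p : nat -> R) (w : nat * 'I_L * bool -> R).
Notation C := R[i].
Notation Re := complex.Re.
Notation Im := complex.Im.
Hypothesis sg0 : 0 <= sigma2.
Hypothesis p0 : forall k, 0 <= p k.
Hypothesis bnd : forall a, exists M, forall n, antenna_interference a p w n <= M.
Hypothesis pL : forall k, (k < L)%N -> 0 < p k.
Hypothesis dL : \det (cols w) != 0.

Let S n : 'M[C]_L := \sum_(k < n) (p k)%:C%C *: (vec w k.+1 *m ctrans (vec w k.+1)).
Let Rm : 'M[C]_L := \matrix_(a < L, b < L) clim (fun n => S n a b) + (sigma2%:C%C)%:M.
Let An n := Amat (sigma2 + n.+1%:R^-1) p n w.

Let term a b k : C := (p k)%:C%C * (cz w (k.+1, a) * conjc (cz w (k.+1, b))).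

Let SE n a b : S n a b = \sum_(k < n) term a b k.
Proof.
rewrite /S summxE; apply: eq_bigr => k _.
by rewrite !mxE big_ord1 !mxE.
Qed.

Let sum_cvg (f : nat -> R) a b : (forall k, `|f k| <= p k * nsq w (k.+1, a) + p k * nsq w (k.+1, b)) ->
  cvgn (series f).
Proof.
move=> hf; apply: normed_cvg.
have [M hM] := bnd a; have [N hN] := bnd b.
apply: nondecreasing_is_cvgn.
  by apply: nondecreasing_series => k _ _; rewrite /= normr_ge0.
exists (M + N) => _ [n _ <-] /=.
have : antenna_interference a p w n + antenna_interference b p w n <= M + N by exact: lerD.
apply: le_trans; rewrite /antenna_interference -big_split /= /series /= big_mkord.
by apply: ler_sum => k _; exact: hf.
Qed.

(** Off-diagonal series converge absolutely: the parts of a product of two entries are bounded by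
    the sum of the squared moduli, so bounded interference at the two antennas is enough.
    Convergence has to be proved because [clim] is defined for every sequence. *)
Lemma SlimE a b : ccvg (fun n => S n a b) (clim (fun n => S n a b)).
Proof.
have tb k : `|Re (term a b k)| <= p k * nsq w (k.+1, a) + p k * nsq w (k.+1, b) /\
            `|Im (term a b k)| <= p k * nsq w (k.+1, a) + p k * nsq w (k.+1, b).
  rewrite /term /nsq; case: (cz w _) (cz w _) => x y [x' y']; rewrite /normsq /=.
  have pk := p0 k; rewrite !mul0r subr0 !addr0 -mulrDr !normrM (ger0_norm pk).
  have := sqr_ge0 (x' + x); have := sqr_ge0 (x' - x); have := sqr_ge0 (y' + y); have := sqr_ge0 (y' - y).
  have := sqr_ge0 (x' + y); have := sqr_ge0 (x' - y); have := sqr_ge0 (y' + x); have := sqr_ge0 (y' - x).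
  have := sqr_ge0 x; have := sqr_ge0 y; have := sqr_ge0 x'; have := sqr_ge0 y'.
  by move=> *; split; apply: ler_wpM2l => //; rewrite ler_norml; apply/andP; split; lra.
have ReS n : Re (S n a b) = series (fun k => Re (term a b k)) n.
  by rewrite SE Re_sum -(big_mkord xpredT (fun k => Re (term a b k))).
have ImS n : Im (S n a b) = series (fun k => Im (term a b k)) n.
  by rewrite SE Im_sum -(big_mkord xpredT (fun k => Im (term a b k))).
split; rewrite /clim /=.
  rewrite (_ : (fun n => Re (S n a b)) = series (fun k => Re (term a b k))); last exact/funext.
  by apply: (@sum_cvg _ a b) => k; have [] := tb k.
rewrite (_ : (fun n => Im (S n a b)) = series (fun k => Im (term a b k))); last exact/funext.
by apply: (@sum_cvg _ a b) => k; have [] := tb k.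
Qed.

Lemma mcvg_Rm : mcvg An Rm.
Proof.
move=> a b; rewrite !mxE.
apply: (@ccvg_ext _ (fun n => S n a b + (sigma2 + n.+1%:R^-1)%:C%C *+ (a == b))).
  by move=> n; rewrite /An /Amat !mxE addrC.
apply: ccvgD; first exact: SlimE.
have c : (fun n => sigma2 + n.+1%:R^-1) @ \oo --> sigma2.
  rewrite -[X in _ --> X]addr0; apply: cvgD; first exact: cvg_cst.
  exact: cvg_harmonic.
case: (a == b); last exact: ccvg_cst.
by split; rewrite /= ?mulr1n//; exact: cvg_cst.
Qed.

Lemma Re_sform_Amat s n (v : 'cV[C]_L) : Re (sform (Amat s p n w) v v) =
  s * Re (sform 1%:M v v) + \sum_(k < n) p k * normsq (sform 1%:M (vec w k.+1) v).
Proof.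
elim: n => [|n IH].
  rewrite /Amat !big_ord0 !addr0 -[(s%:C%C)%:M]scalemx1 sformZm.
  by case: (sform _ _ _) => a b /=; rewrite mul0r subr0.
rewrite AmatS sformDm sformZm sform_rank1 mulrC big_ord_recr /= addrA -IH.
rewrite [conjc _ * _]mulrC -normsqE.
case: (sform (Amat s p n w) v v) => a b /=; rewrite mulr0 subr0; ring.
Qed.

(** This covers the noiseless case. At a kernel vector the forms of the approximating matrices tend
    to 0 while dominating the form of the first [L] rank-one terms; the vector is then orthogonal to
    [L] independent columns. *)
Lemma Rm_unit : Rm \in unitmx.
Proof.
rewrite -row_free_unit -kermx_eq0; apply/negP => /negP h.
have [i ri] : exists i, row i (kermx Rm) != 0.
  apply/existsP; rewrite -negb_forall; apply: contra h => /forallP h.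
  by apply/eqP/row_matrixP => i; rewrite (eqP (h i)) row0.
pose v := ctrans (row i (kermx Rm)).
have v0 : v != 0 by rewrite ctrans_eq0.
have Rv : sform Rm v v = 0 by rewrite /sform ctransK -row_mul mulmx_ker row0 mul0mx mxE.
have cv : ccvg (fun n => sform (An n) v v) (sform Rm v v).
  have hm : mcvg (fun k => ctrans v *m An k *m v) (ctrans v *m Rm *m v).
    apply: mcvgM; last exact: mcvg_cst.
    by apply: mcvgM; [exact: mcvg_cst|exact: mcvg_Rm].
  exact: hm.
have [cr _] := cv; rewrite Rv /= in cr.
pose m := \sum_(k < L) p k * normsq (sform 1%:M (vec w k.+1) v).
have mle : m <= 0.
  apply: (ler_cvg_to (cvg_cst m) cr); near=> n.
  have Ln : (L <= n)%N by near: n; exact: nbhs_infty_ge.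
  rewrite Re_sform_Amat; apply: ler_wpDl.
    rewrite mulr_ge0 ?addr_ge0//.
    by have := sform1_ge0 v; case: (sform _ _ _) => x y; rewrite lecE /= => /andP[].
  rewrite -(subnKC Ln) big_split_ord /= lerDl; apply: sumr_ge0 => k _.
  by rewrite mulr_ge0// normsq_ge0.
have z (k : 'I_L) : sform 1%:M (vec w k.+1) v = 0.
  apply/eqP; rewrite -normsq_eq0.
  have := mle; rewrite /m (bigD1 k)//= => hk.
  have t0 : 0 <= \sum_(i < L | i != k) p i * normsq (sform 1%:M (vec w i.+1) v).
    by apply: sumr_ge0 => j _; rewrite mulr_ge0// normsq_ge0.
  have pk := pL (ltn_ord k); have nk := normsq_ge0 (sform 1%:M (vec w k.+1) v).
  have : p k * normsq (sform 1%:M (vec w k.+1) v) <= 0 by rewrite (le_trans _ hk)// lerDl.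
  by rewrite pmulr_rle0// => hh; rewrite eq_le hh nk.
have uC : cols w \in unitmx by rewrite unitmxE unitfE.
have Cv : ctrans (cols w) *m v = 0.
  apply/matrixP => k b; rewrite ord1 [RHS]mxE -(z k) /sform mulmx1 !mxE.
  by apply: eq_bigr => j _; rewrite !mxE.
move/negP: v0; apply; apply/eqP.
have uC' : ctrans (cols w) \in unitmx.
  by rewrite /ctrans map_unitmx unitmx_tr.
by rewrite -[v](mulKmx uC') Cv mulmx0.
Unshelve. all: by end_near. Qed.

(** The imaginary part is followed too, because comparing with a real number in [R[i]] requires it
    to vanish. *)
Lemma limit_gram (x : 'cV[C]_L) :
  (fun n => gram (An n) x) @ \oo --> Re (iform Rm x x) /\ Im (iform Rm x x) = 0.
Proof.
have pA n : pd (An n) by apply: pd_Amat => //; rewrite ltr_wpDl.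
have [c1 c2] := @ccvg_iform R L An Rm x Rm_unit (fun k => pd_unit (pA k)) mcvg_Rm.
split; first exact: c1.
have : (fun n => Im (iform (An n) x x)) = fun=> 0.
  by apply/funext => n; rewrite (gramE x (pA n)).
by move=> e; rewrite e in c2; apply: (cvg_unique _ c2 (cvg_cst _)).
Qed.

End limit.

(** * Measurability of limits *)

Section measlim.
Variables (R : realType) (d : measure_display) (T : measurableType d).

Lemma einf_esup_cvg (u : (\bar R)^nat) (l : \bar R) : limn_einf u = l -> limn_esup u = l -> u @ \oo --> l.
Proof.
rewrite limn_einf_lim limn_esup_lim => hi hs.
apply: (@squeeze_cvge _ _ _ _ (einfs u) u (esups u)).
- apply: nearW => n; rewrite /einfs /esups; apply/andP; split.
    by apply: ereal_inf_lbound; exists n => /=.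
  by apply: ereal_sup_ubound; exists n => /=.
- by rewrite -hi; exact: is_cvg_einfs.
- by rewrite -hs; exact: is_cvg_esups.
Qed.

(* The limit of a divergent real sequence is 0 by convention. *)
Lemma limn_real (u : R^nat) : limn u =
  if (limn_einf (EFin \o u) == limn_esup (EFin \o u)) && (limn_esup (EFin \o u) \is a fin_num)
  then fine (limn_esup (EFin \o u)) else 0.
Proof.
case: ifPn => [/andP[/eqP h f]|h].
  have c := einf_esup_cvg h erefl; rewrite -(fineK f) in c.
  exact: (cvg_lim _ (fine_cvg c)).
apply: dvgP => /cvg_ex[l cl]; move/negP: h; apply.
have c : (EFin \o u) @ \oo --> l%:E by apply: cvg_EFin => //; exact: nearW.
by have [-> ->] := cvg_limn_einf_sup c; rewrite eqxx.
Qed.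

(** The entries of [Rmat] are limits taken at every outcome, so divergence has to be covered: lower
    and upper limits are measurable and decide whether the sequence converges. *)
Lemma measurable_limn (h : nat -> T -> R) : (forall n, measurable_fun setT (h n)) ->
  measurable_fun setT (fun t => limn (h ^~ t)).
Proof.
move=> mh.
have ms : measurable_fun setT (fun t => limn_esup (fun n => (h n t)%:E)).
  by apply: measurable_fun_limn_esup => n; exact/measurable_EFinP.
have mi : measurable_fun setT (fun t => limn_einf (fun n => (h n t)%:E)).
  apply: (eq_measurable_fun (fun t => - limn_esup (fun n => (- h n t)%:E))%E).
    move=> t _; rewrite -limn_einfN; congr limn_einf; apply/funext => n /=.
    by rewrite opprK.
  apply: measurableT_comp => //; apply: measurable_fun_limn_esup => n.
  by apply/measurable_EFinP; exact: measurableT_comp.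
apply/measurable_EFinP; apply: (eq_measurable_fun (fun t =>
   if (limn_einf (fun n => (h n t)%:E) == limn_esup (fun n => (h n t)%:E)) && (limn_esup (fun n => (h n t)%:E) \is a fin_num)
   then limn_esup (fun n => (h n t)%:E) else 0%E)).
  by move=> t _; rewrite /= limn_real; case: ifP => // /andP[_ f]; rewrite fineK.
apply: measurable_fun_ifT => //.
apply: measurable_and; first exact: measurable_fun_eqe.
apply: (measurable_fun_bool true).
exact: (emeasurable_fin_num measurableT ms).
Qed.

End measlim.

Lemma ptail_cvg (R : realType) L (y_ : nat -> R) (y : R) : y_ @ \oo --> y ->
  (fun m => ptail L (y_ m)) @ \oo --> ptail L y.
Proof.
move=> cy; apply: sum_lim => i; apply: cvgM; last first.
  by apply: continuous_cvg; [exact: continuous_expR|exact: cvgN].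
apply: cvgM; last exact: cvg_cst.
by apply: (cvg_comp y_ (fun x : R => x ^+ i) cy); exact: exprn_continuous.
Qed.

(** * The outage probability *)

Section final.
Variables (R : realType) (L : nat) (alpha sigma2 lam : R).
Variables (dT : measure_display) (T : measurableType dT) (P : probability T R).
Variables (X : nat -> T -> R * R) (cre cim : nat -> 'I_L -> T -> R) (crre crim : 'I_L -> T -> R).
Hypotheses (alpha2 : 2 < alpha) (sg0 : 0 <= sigma2) (lam0 : 0 < lam).
Hypothesis hX : is_PPP P X lam.
Hypothesis hF : fading_indep P X cre cim crre crim.
Local Notation C := R[i].
Local Notation Re := complex.Re.
Local Notation Im := complex.Im.
Local Notation fd := (fade cre cim crre crim).
Local Notation pk t := (fun k => pathloss alpha (X k t)).
Let mX := hX.1.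

Let mfd : measurable_fun setT fd. Proof. exact: (measurable_fade hF). Qed.

Let mpk k : measurable_fun setT (fun t => pathloss alpha (X k t)).
Proof. exact: (measurableT_comp (measurable_pathloss alpha) (mX k)). Qed.

Let mnsq q : measurable_fun setT (fun t => nsq (fd t) q).
Proof. exact: (measurableT_comp (@measurable_nsq R L q) mfd). Qed.

Lemma null_le0 (A : set T) (r : nat -> R) : measurable A ->
  (forall m, (P A <= (1 - r m)%:E)%E) -> r @ \oo --> (1 : R) -> P A = 0%E.
Proof.
move=> mA h cr; apply/eqP; rewrite eq_le measure_ge0 andbT.
have Af : P A \is a fin_num by exact: fin_num_measure.
rewrite -(fineK Af) lee_fin.
have c : (fun m => 1 - r m) @ \oo --> (0 : R).
  by rewrite -[X in _ --> X](subrr 1); apply: cvgB => //; exact: cvg_cst.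
apply: (ler_cvg_to (cvg_cst _) c); apply: nearW => m.
by rewrite -lee_fin fineK.
Qed.

(* If the interference is unbounded then so are its multiples by [g > 0], an event whose probability is at most [1 - expR (- c g ^ (2 / alpha))] and tends to 0 with [g]. *)
Lemma interf_unbounded_null (a : 'I_L) : exists Z, [/\ measurable Z, P Z = 0%E &
  forall t, ~ Z t -> exists M, forall n, antenna_interference a (pk t) (fd t) n <= M].
Proof.
pose E g n : set T := [set t | antenna_interference a (fun k => pathloss alpha (X k t) * g) (fd t) n < nsq (fd t) (0%N, a)].
have mE g n : measurable (E g n).
  apply: measurable_ltf => //; apply: measurable_sum => k; apply: measurable_funM => //.
  exact: measurable_funM.
have mI g : measurable (\bigcap_n E g n) by apply: bigcap_measurable => //; exists 0%N.
pose gm (m : nat) : R := m.+1%:R^-1.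
have gm0 m : 0 < gm m by rewrite invr_gt0.
pose Z := \bigcap_m ~` (\bigcap_n E (gm m) n).
have mZ : measurable Z by apply: bigcap_measurable => [|m _]; [exists 0%N|exact: measurableC].
exists Z; split => //; last first.
  move=> t Zt; have [m hm] : exists m, (\bigcap_n E (gm m) n) t.
    apply: contrapT => h; apply: Zt => m _ hm; apply: h; exists m; exact: hm.
  exists (nsq (fd t) (0%N, a) / gm m) => n; rewrite ler_pdivlMr//.
  have := ltW (hm n Logic.I); apply: le_trans.
  rewrite /antenna_interference mulr_suml; apply: ler_sum => k _; by rewrite mulrAC.
pose r m := expR (- (1 * (lam * Delta alpha * (gm m) `^ (2 / alpha)))).
apply: (@null_le0 _ r) => //.
  move=> m.
  have Edec : {homo E (gm m) : i j / (i <= j)%N >-> (j <= i)%O}.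
    apply/nonincreasing_seqP => i; rewrite subsetEset => t; apply: le_lt_trans.
    rewrite /antenna_interference big_ord_recr /= lerDl !mulr_ge0 ?pathloss_ge0 ?nsq_ge0// ltW//.
  have c1 : P \o E (gm m) @ \oo --> P (\bigcap_n E (gm m) n).
    apply: nonincreasing_cvg_mu => //.
    by rewrite -ge0_fin_numE// fin_num_measure.
  have c2 := satur_laplace alpha2 (ltW lam0) hX (gm0 m) (_ : 0 <= (1 : R) <= 1).
  have {}c2 : (P \o E (gm m)) @ \oo --> (r m)%:E.
    rewrite (_ : P \o E (gm m) = fun n => (expect P (fun t => \prod_(k < n) (1 - 1 * satur alpha (gm m) (X k t))))%:E); last first.
      by apply/funext => n /=; exact: (interf_outage alpha mX hF _ _ (gm0 m)).
    apply: cvg_EFin; first exact: nearW.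
    by apply: c2; rewrite ler01 lexx.
  have e : P (\bigcap_n E (gm m) n) = (r m)%:E by exact: (cvg_unique _ c1 c2).
  rewrite EFinB -e -probability_setC//; apply: le_measure; rewrite ?inE//; first exact: measurableC.
  by move=> t Zt; exact: (Zt m Logic.I).
have c : (fun m => (gm m) `^ (2 / alpha)) @ \oo --> (0 : R).
  have dl0 : 0 < 2 / alpha by rewrite divr_gt0// (lt_trans _ alpha2).
  have /cvg_at_rightP := @powR_cvg0 R _ dl0; apply; split => //.
  exact: cvg_harmonic.
rewrite -(@expR0 R) -oppr0; apply: continuous_cvg; first exact: continuous_expR.
apply: cvgN; rewrite -[X in _ --> X](mulr0 (1 * (lam * Delta alpha))).
rewrite (_ : (fun m => _) = fun m => 1 * (lam * Delta alpha) * (gm m `^ (2 / alpha))); last first.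
  by apply/funext => m; ring.
by apply: cvgM => //; exact: cvg_cst.
Qed.

(** The path loss takes the default value 0 at the origin, whereas positive powers are required for
    invertibility. The origin has area 0, so the number of points there is Poisson of mean 0. *)
Lemma origin_null : exists Z, [/\ measurable Z, P Z = 0%E & forall t, ~ Z t -> forall k, 0 < pathloss alpha (X k t)].
Proof.
pose Og : set (R * R) := [set x | sqnorm x = 0].
have mO : measurable Og.
  rewrite -[Og]setTI; apply: (@measurable_sqnorm R measurableT [set 0]); exact: measurable_set1.
have aO : area Og = 0%E.
  have [l [lE lI]] := area_measure_ex R.
  rewrite -lE -[X in l X]setIT -integral_indic// lI//; last first.
    by apply/measurable_EFinP; exact: measurable_indic.
  pose f (r : R) : \bar R := (\1_[set 0 : R] r)%:E.
  have mf : measurable_fun setT f by apply/measurable_EFinP; exact: measurable_indic.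
  transitivity (\int[@lebesgue_measure R]_x \int[@lebesgue_measure R]_y f (x ^+ 2 + y ^+ 2)%R)%E.
    apply: eq_integral => x _; apply: eq_integral => y _; by rewrite /f !indicE; congr (_%:R%:E).
  rewrite radial//; last by move=> r; rewrite lee_fin.
  rewrite integral_indic// [X in (_ * X)%E](_ : _ = 0%E) ?mule0//.
  apply/eqP; rewrite eq_le measure_ge0 andbT -(@lebesgue_measure_set1 R 0).
  by apply: le_measure; rewrite ?inE//; exact: measurableI.
pose N0 : set T := [set t | ppcount X Og t = 0%:R%:E].
have mN0 : measurable N0.
  rewrite -[N0]setTI; exact: (measurable_ppcount mX mO measurableT (emeasurable_set1 _)).
have N01 : P N0 = 1%E.
  have dj (i j : 'I_1) : i != j -> Og `&` Og = set0 by rewrite !ord1 eqxx.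
  have fa (i : 'I_1) : (area Og < +oo)%E by rewrite aO.
  have := hX.2 1%N (fun=> Og) (fun=> 0%N) (fun _ => mO) fa dj.
  rewrite aO big_ord1 /= mulr0 /pois expr0 fact0 divr1 mul1r oppr0 expR0 => <-.
  by congr (P _); apply/seteqP; split => t; [move=> h' i|apply; exact: ord0].
exists (~` N0); split; [exact: measurableC|exact: prob1_null|move=> t /contrapT Nt k].
rewrite lt_neqAle pathloss_ge0 andbT eq_sym /pathloss powR_eq0 negb_and; apply/orP; left.
apply/negP => /eqP xk.
(* Taking at least [k.+1] points makes the point [k] one of those counted. *)
have [n _ /(_ (maxn n k.+1) (leq_maxl _ _))] := cnt_near Nt.
move/eqP; rewrite /cnt (bigD1 (Ordinal (leq_maxr n k.+1)))//= addn_eq0 => /andP[+ _].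
by rewrite mem_set.
Qed.

Lemma cols_null : exists Z, [/\ measurable Z, P Z = 0%E & forall t, ~ Z t -> \det (cols (fd t)) != 0].
Proof.
have [nu [nuE nuI]] := fade_law_ex hF.
have mcols : mmeas (fun w : rvec R (nat * 'I_L * bool)%type => cols w).
  by move=> a b; apply: cmeas_ext (@cmeas_cz R L (b.+1, a)) => w; rewrite mxE.
have mD := measurable_eq0 (cmeas_det mcols).
exists (fd @^-1` [set w : rvec R (nat * 'I_L * bool)%type | \det (cols w) = 0]); split.
- by rewrite -[X in measurable X]setTI; exact: mfd.
- by rewrite -nuE; exact: det_null.
- by move=> t /= h; apply/eqP.
Qed.

Let Rm t := Rmat alpha sigma2 X cre cim t.
Let xr t : 'cV[C]_L := vec (fd t) 0.
Let An n t := Amat (sigma2 + n.+1%:R^-1) (pk t) n (fd t).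

Let RmE t : Rm t = \matrix_(a < L, b < L) clim (fun n => (\sum_(k < n) (pathloss alpha (X k t))%:C%C *:
    (vec (fd t) k.+1 *m ctrans (vec (fd t) k.+1))) a b) + (sigma2%:C%C)%:M.
Proof. by []. Qed.

Lemma mmeas_S n : mmeas (fun t => \sum_(k < n) (pathloss alpha (X k t))%:C%C *:
    (vec (fd t) k.+1 *m ctrans (vec (fd t) k.+1))).
Proof.
apply: mmeas_sum => k; apply: mmeasZ; first by apply: cmeas_real.
have mv : mmeas (fun t => vec (fd t) k.+1) by exact: (mmeas_comp (@mmeas_vec R L k.+1) mfd).
by apply: mmeasM => //; exact: mmeas_ctrans.
Qed.

Lemma measurable_Rmat : mmeas Rm.
Proof.
move=> a b; have mS n := mmeas_S n a b.
apply: (@cmeas_ext _ _ _ (fun t => clim (fun n => (\sum_(k < n) (pathloss alpha (X k t))%:C%C *: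
    (vec (fd t) k.+1 *m ctrans (vec (fd t) k.+1))) a b) + (sigma2%:C%C)%:M a b)).
  by move=> t; rewrite RmE [in RHS]mxE; congr (_ + _); rewrite mxE.
apply: cmeasD; last exact: cmeas_cst.
by split; apply: measurable_limn => n; have [] := mS n.
Qed.

Let cbeta t : C := iform (Rm t) (xr t) (xr t).

Let mxr : mmeas xr. Proof. exact: (mmeas_comp (@mmeas_vec R L 0) mfd). Qed.

Let mcb : cmeas cbeta.
Proof. exact: (cmeas_iform measurable_Rmat mxr mxr). Qed.

(** The exceptional set collects unbounded interference at some antenna, a point at the origin, and
    linear dependence of the first [L] interferer vectors. *)
Lemma limit_null : exists Z, [/\ measurable Z, P Z = 0%E &
  forall t, ~ Z t -> (fun n => gram (An n t) (xr t)) @ \oo --> Re (cbeta t) /\ Im (cbeta t) = 0].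
Proof.
have [Z1 hZ1] := choice interf_unbounded_null.
have [Z2 [mZ2 Z20 h2]] := origin_null.
have [Z3 [mZ3 Z30 h3]] := cols_null.
pose U := \big[setU/set0]_(a < L) Z1 a.
pose K (A : set T) := measurable A /\ P A = 0%E.
have KU A B : K A -> K B -> K (A `|` B).
  move=> [mA A0] [mB B0]; split; first exact: measurableU.
  apply/eqP; rewrite eq_le measure_ge0 andbT.
  by apply: (le_trans (measureU2 P mA mB)); rewrite -[X in (_ <= X)%E]adde0; rewrite -{1}A0 -B0.
have K1 : K U.
  apply: big_ind => [|//|a _]; first by split => //; exact: measure0.
  by have [] := hZ1 a.
have [mZ Z0] := KU _ _ (KU _ _ K1 (conj mZ2 Z20)) (conj mZ3 Z30).
exists (U `|` Z2 `|` Z3); split => // t Zt.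
have n1 a : ~ Z1 a t by move=> h; apply: Zt; left; left; rewrite /U (bigD1 a)//=; left.
have n2 : ~ Z2 t by move=> h; apply: Zt; left; right.
have n3 : ~ Z3 t by move=> h; apply: Zt; right.
apply: (limit_gram sg0 (fun k => pathloss_ge0 alpha (X k t))).
- by move=> a; have [_ _ h] := hZ1 a; exact: h.
- by move=> k _; exact: h2.
- exact: h3.
Qed.

(** Convergence of the forms preserves strict inequalities only. It bounds the probability of
    [Re > g] by [G g], and that of [Re <= g] by [1 - G h] for every [h > g]; continuity of [G] at
    [g] closes the gap. *)
Theorem outage (g : R) : 0 < g ->
  P [set t | Re (cbeta t) <= g /\ Im (cbeta t) = 0] =
  (1 - ptail L (sigma2 * g + lam * Delta alpha * g `^ (2 / alpha)))%:E.
Proof.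
move=> g0; have [Z [mZ Z0 hZ]] := limit_null.
pose G (g : R) := ptail L (sigma2 * g + lam * Delta alpha * g `^ (2 / alpha)).
have [mRe mIm] := mcb.
have mAn n : mmeas (An n) by apply: mmeasD; [exact: mmeas_cst|exact: mmeas_S].
have mf n : measurable_fun setT (fun t => gram (An n t) (xr t)) := measurable_gram (mAn n) mxr.
pose B (h : R) n := [set t | h < gram (An n t) (xr t)].
have mB h n : measurable (B h n) := measurable_ltf (measurable_cst h) (mf n).
have lawB h : 0 < h -> (fun n => fine (P (B h n))) @ \oo --> G h.
  move=> h0.
  have y0 n : 0 <= (sigma2 + n.+1%:R^-1) * h by rewrite mulr_ge0 ?addr_ge0// ltW.
  have cy : (fun n => (sigma2 + n.+1%:R^-1) * h) @ \oo --> sigma2 * h.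
    apply: cvgM; last exact: cvg_cst.
    rewrite -[X in _ --> X]addr0; apply: cvgD; [exact: cvg_cst|exact: cvg_harmonic].
  have := pbtail_lim (L := L) alpha2 (ltW lam0) hX h0 y0 cy; apply: cvg_trans.
  apply: near_eq_cvg; apply: nearW => n; rewrite /B /An.
  by rewrite (gram_outage alpha mX hF n _ h0)// ltr_wpDl.
have mU : measurable [set t | g < Re (cbeta t)] := measurable_ltf (measurable_cst g) mRe.
have mD : measurable [set t | Re (cbeta t) <= g].
  rewrite (_ : [set t | _] = ~` [set t | g < Re (cbeta t)]); first exact: measurableC.
  by apply/seteqP; split => t /=; rewrite leNgt => /negP.
have up : (P [set t | (g < Re (cbeta t))%R] <= (G g)%:E)%E.
  apply: (liminf_law (mB g) mU mZ Z0 (lawB g g0)).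
  by move=> t /= tg Zt; have [c _] := hZ t Zt; apply: (cvgr_gt _ c).
have lo h : g < h -> (P [set t | (Re (cbeta t) <= g)%R] <= (1 - G h)%:E)%E.
  move=> gh; have mBC n : measurable (~` B h n) := measurableC (mB h n).
  apply: (liminf_law mBC mD mZ Z0).
  - rewrite (_ : (fun n => _) = fun n => 1 - fine (P (B h n))); last first.
      apply/funext => n; rewrite (probability_setC P (mB h n)) fineB//; exact: fin_num_measure (mB h n).
    by apply: cvgB; [exact: cvg_cst|apply: lawB; exact: lt_trans gh].
  - move=> t /= tg Zt; have [c _] := hZ t Zt.
    have tlh := le_lt_trans tg gh.
    have hn : \forall n \near \oo, gram (An n t) (xr t) < h by apply: (cvgr_lt _ c).
    apply: filterS hn => n hn.
    by rewrite /B /=; apply/negP; rewrite -leNgt ltW.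
have Df : P [set t | Re (cbeta t) <= g] \is a fin_num by exact: fin_num_measure.
have E : P [set t | Re (cbeta t) <= g] = (1 - G g)%:E.
  apply/eqP; rewrite eq_le; apply/andP; split.
    rewrite -(fineK Df) lee_fin.
    have c : (fun m => 1 - G (g + m.+1%:R^-1)) @ \oo --> 1 - G g.
      apply: cvgB; first exact: cvg_cst.
      have cg : (fun m => g + m.+1%:R^-1) @ \oo --> g.
        rewrite -[X in _ --> X]addr0; apply: cvgD; [exact: cvg_cst|exact: cvg_harmonic].
      have cp : (fun m => (g + m.+1%:R^-1) `^ (2 / alpha)) @ \oo --> g `^ (2 / alpha).
        have pc : {for g, continuous (fun x : R => x `^ (2 / alpha))}.
          apply: differentiable_continuous; apply/derivable1_diffP.
          by have [] := @is_derive1_powR R (2 / alpha) g g0.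
        exact: (cvg_comp (fun m => g + m.+1%:R^-1) (fun x : R => x `^ (2 / alpha)) cg pc).
      apply: ptail_cvg; apply: cvgD; apply: cvgM => //; exact: cvg_cst.
    apply: (ler_cvg_to (cvg_cst _) c); apply: nearW => m.
    by rewrite -lee_fin fineK//; apply: lo; rewrite ltrDl.
  rewrite (_ : [set t | _] = ~` [set t | g < Re (cbeta t)]); last first.
    by apply/seteqP; split => t /=; rewrite leNgt => /negP.
  by rewrite probability_setC// EFinB leeB.
rewrite -E.
have mI : measurable [set t | Re (cbeta t) <= g /\ Im (cbeta t) = 0].
  apply: measurableI => //; rewrite -[X in measurable X]setTI.
  exact: (mIm measurableT _ (measurable_set1 0)).
apply/eqP; rewrite eq_le; apply/andP; split.
  by apply: le_measure; rewrite ?inE// => t [].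
(* The condition on the imaginary part removes only a null set. *)
rewrite -[X in (_ <= X)%E]adde0 -[X in (_ <= _ + X)%E]Z0.
apply: le_trans (measureU2 P mI mZ).
apply: le_measure; rewrite ?inE//; first exact: measurableU.
move=> t /= tg; have [Zt|Zt] := pselect (Z t); first by right.
by left; split => //; have [] := hZ t Zt.
Qed.

End final.

Theorem theorem1 (R : realType) (L : nat) (alpha d sigma2 lam beta : R)
  (dT : measure_display) (T : measurableType dT) (P : probability T R)
  (X : nat -> T -> R * R)
  (cre cim : nat -> 'I_L -> T -> R) (crre crim : 'I_L -> T -> R) :
  (1 <= L)%N -> 2 < alpha -> 0 < d -> 0 <= sigma2 -> 0 < lam -> 0 < beta ->
  is_PPP P X lam ->
  fading_indep P X cre cim crre crim ->
  let gamma := beta * d `^ alpha in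
  let s := lam * Delta alpha * gamma `^ (2 / alpha) + sigma2 * gamma in
  P [set w | beta_out alpha d sigma2 X cre cim crre crim w <= (beta%:C)%C] =
  (1 - \sum_(i < L) (s ^+ i / (i`!)%:R) * expR (- s))%:E.
Proof.
move=> _ alpha2 d0 sg0 lam0 beta0 hX hF gamma s.
have da : 0 < d `^ alpha by exact: powR_gt0.
have g0 : 0 < gamma by exact: mulr_gt0.
have := outage alpha2 sg0 lam0 hX hF g0.
rewrite [sigma2 * _ + _]addrC -/s => <-; congr (P _); apply/seteqP.
suff h w : (beta_out alpha d sigma2 X cre cim crre crim w <= (beta%:C)%C) <->
  complex.Re (iform (Rmat alpha sigma2 X cre cim w) (vec (fade cre cim crre crim w) 0) (vec (fade cre cim crre crim w) 0)) <= gamma /\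
  complex.Im (iform (Rmat alpha sigma2 X cre cim w) (vec (fade cre cim crre crim w) 0) (vec (fade cre cim crre crim w) 0)) = 0.
  by split => w /=; apply h.
have -> : beta_out alpha d sigma2 X cre cim crre crim w = (d `^ (- alpha))%:C%C *
  iform (Rmat alpha sigma2 X cre cim w) (vec (fade cre cim crre crim w) 0) (vec (fade cre cim crre crim w) 0) by [].
(* The order of [R[i]] compares real parts and asks for equal imaginary parts. The positive factor
   [d] to the power [- alpha] moves to the other side and turns [beta] into [gamma]. *)
move: (iform _ _ _) => -[a b]; rewrite lecE /= !mul0r subr0 addr0 powRN.
rewrite ler_pdivrMl// [d `^ alpha * beta]mulrC -/gamma eq_sym mulf_eq0 invr_eq0 (gt_eqF da) /=.
by split => [/andP[/eqP -> ->]//|[-> ->]]; rewrite eqxx.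
Qed.
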